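(* Let $\Omega$ be a bounded domain of $\mathbb{R}^n$, let $1<p<2$ and $\sigma>0$. Let $\bm{a}:\Omega\times\mathbb{R}^n\to\mathbb{R}^n$ be a Carathéodory function (measurable in $x$, continuous in $\xi$) such that there is $\gamma>0$ with $$(\bm{a}(x,\xi)-\bm{a}(x,\eta))\cdot(\xi-\eta)\ge\gamma\,(1+|\xi|+|\eta|)^{p-2}|\xi-\eta|^2$$ for all $x\in\Omega$, $\xi,\eta\in\mathbb{R}^n$. Let $f,g:\Omega\times\mathbb{R}\to\mathbb{R}$ be continuous, with $f(x,t)$ and $g(x,t)$ non-decreasing in $t\in\mathbb{R}$ for every $x\in\Omega$. Suppose $u,v\in W^{1,\infty}_{loc}(\Omega)$ and one of the following holds: ($\widetilde{A}_1$) $0<\sigma<1$ and $f$ is increasing in $t$; ($\widetilde{A}_2$) $1\le\sigma$. If $Q^*u\le Q^*v$ in $\Omega$ and $u\le v$ on $\partial\Omega$, then $u\le v$ in $\Omega$.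
   Context: Here $Q^*u:=-\operatorname{div}(\bm{a}(x,\nabla u))+f(x,u)+g(x,u)|\nabla u|^\sigma$. ''Increasing in $t$'' means strictly increasing in $t$ for every $x\in\Omega$. The inequality $Q^*u\le Q^*v$ in $\Omega$ means $$\int_\Omega(\bm{a}(x,\nabla u)-\bm{a}(x,\nabla v))\cdot\nabla\varphi\le\int_\Omega\big(f(x,v)+g(x,v)|\nabla v|^\sigma-f(x,u)-g(x,u)|\nabla u|^\sigma\big)\varphi$$ for all $\varphi\in C^1_c(\Omega)$ with $\varphi\ge0$; whenever this is used it is understood that $|\bm{a}(x,\nabla u)|,|\bm{a}(x,\nabla v)|,f(x,u),f(x,v)\in L^1_{loc}(\Omega)$, so that the integrals are well defined and the inequality may be used with non-negative test functions $\varphi\in W^{1,p}(\Omega)$ of compact support in $\Omega$. ''$u\le v$ in $\Omega$'' means a.e.; ''$u\le v$ on $\partial\Omega$'' means $\limsup_{x\to\partial\Omega}(u(x)-v(x))\le0$. *)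

(* Defs.v *)
From HB Require Import structures.
From mathcomp Require Import all_boot all_order all_algebra.
From mathcomp Require Import all_classical all_reals all_analysis.
Set Implicit Arguments. Unset Strict Implicit. Unset Printing Implicit Defensive.
Import Order.TTheory GRing.Theory Num.Theory.
Import numFieldNormedType.Exports.
Local Open Scope classical_set_scope.
Local Open Scope ring_scope.

Fixpoint RnT (R : realType) (n : nat) : {d : measure_display & measurableType d} :=
  match n with
  | 0 => existT (fun d => measurableType d) _ (measurableTypeR R : measurableType _)
  | m.+1 => existT (fun d => measurableType d) _
      ((projT2 (RnT R m) * measurableTypeR R)%type : measurableType _)
  end.

Fixpoint lebn (R : realType) (n : nat) :
  {measure set (projT2 (RnT R n)) -> \bar R} :=
  match n return {measure set (projT2 (RnT R n)) -> \bar R} with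
  | 0 => @lebesgue_measure R
  | m.+1 => [the {measure set _ -> \bar R} of (lebn R m \x @lebesgue_measure R)%E]
  end.

Definition lebRn (R : realType) (n : nat) := @completed_measure_extension _ _ R (lebn R n).

(* the coordinate bijection from the iterated product R x ... x R (n+1 factors)
   onto the row vectors 'rV[R]_n.+1 *)
Fixpoint ofRn (R : realType) (n : nat) : projT2 (RnT R n) -> 'rV[R]_n.+1 :=
  match n return projT2 (RnT R n) -> 'rV[R]_n.+1 with
  | 0 => fun x => \row_(i < 1) (x : R)
  | m.+1 => fun p => \row_(i < m.+2)
       (if (i <= m)%N then @ofRn R m p.1 0 (inord i) else (p.2 : R))
  end.

Section Rn.
Context {R : realType} {n : nat}.
Local Notation V := 'rV[R]_n.+1.
Local Notation mu := (@lebRn R n).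
Local Notation phi := (@ofRn R n).
(* R^{n+1} with the Lebesgue (completed) sigma-algebra *)
Local Notation CT := (caratheodory_type ((@lebn R n)^*)%mu).

(* Lebesgue measurability of F on D *)
Definition Lmeasurable (D : set V) (F : V -> R) : Prop :=
  measurable_fun (phi @^-1` D : set CT) (F \o phi).

(* Lebesgue integral over D *)
Definition Vint (D : set V) (F : V -> R) : \bar R :=
  (\int[mu]_(x in phi @^-1` D) (F (phi x))%:E)%E.

Definition Vintegrable (D : set V) (F : V -> R) : Prop :=
  mu.-integrable (phi @^-1` D) (fun x => (F (phi x))%:E).

(* P holds for a.e. x in D *)
Definition ae_on (D : set V) (P : V -> Prop) : Prop :=
  mu.-negligible [set x | D (phi x) /\ ~ P (phi x)].

Definition L1loc (O : set V) (F : V -> R) : Prop :=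
  Lmeasurable O F /\
  forall K : set V, compact K -> K `<=` O -> Vintegrable K F.

Definition Linfloc (O : set V) (F : V -> R) : Prop :=
  Lmeasurable O F /\
  forall K : set V, compact K -> K `<=` O ->
    exists M : R, ae_on K (fun x => `|F x| <= M).

Definition pderiv (F : V -> R) (i : 'I_n.+1) (x : V) : R :=
  'D_(delta_mx ord0 i) F x.

Definition grad (F : V -> R) (x : V) : V := \row_i pderiv F i x.

(* C^1_c(O) *)
Definition C1c (O : set V) (F : V -> R) : Prop :=
  (forall x, differentiable F x) /\
  (forall i, continuous (pderiv F i)) /\
  exists K : set V, [/\ compact K, K `<=` O & forall x, ~ K x -> F x = 0].

Definition dotv (xi eta : V) : R := \sum_i xi ord0 i * eta ord0 i.
Definition enorm (xi : V) : R := Num.sqrt (dotv xi xi).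

(* Du is the weak gradient of u in O *)
Definition weak_gradient (O : set V) (u : V -> R) (Du : V -> V) : Prop :=
  forall F, C1c O F -> forall i,
    Vint O (fun x => u x * pderiv F i x) = (- Vint O (fun x => (Du x ord0 i * F x)%R))%E.

(* u is in W^{1,oo}_loc(O) with weak gradient Du *)
Definition W1inf_loc (O : set V) (u : V -> R) (Du : V -> V) : Prop :=
  [/\ Linfloc O u, forall i, Linfloc O (fun x => Du x ord0 i) & weak_gradient O u Du].

Definition is_domain (O : set V) : Prop :=
  [/\ open O, connected O & O !=set0].

(* weak inequality Q^* u <= Q^* v in O, with the integrability convention *)
Definition Qstar_le (O : set V) (a : V -> V -> V) (f g : V -> R -> R) (sigma : R)
  (u : V -> R) (Du : V -> V) (v : V -> R) (Dv : V -> V) : Prop :=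
  [/\ L1loc O (fun x => enorm (a x (Du x))), L1loc O (fun x => enorm (a x (Dv x))),
      L1loc O (fun x => f x (u x)), L1loc O (fun x => f x (v x)) &
  forall F, C1c O F -> (forall x, 0 <= F x) ->
    (Vint O (fun x => dotv (a x (Du x) - a x (Dv x))%R (grad F x))
     <= Vint O (fun x => ((f x (v x) + g x (v x) * enorm (Dv x) `^ sigma
                          - f x (u x) - g x (u x) * enorm (Du x) `^ sigma) * F x)%R))%E].

(* u <= v on the boundary: limsup_{x -> boundary} (u - v) <= 0 *)
Definition bdry_le (O : set V) (u v : V -> R) : Prop :=
  forall y, closure O y -> ~ O y -> forall eps : R, 0 < eps ->
    \forall x \near y, O x -> u x - v x <= eps.

End Rn.

(* Main.v *)
(* Let w = u - v and suppose that w > 0 on a set of positive measure. For small kappa > 0 the set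
   {w > kappa} is relatively compact in Omega, so (w - k)_+^3 with k >= kappa, w mollified, is an
   admissible test function. On its support Du and Dv are bounded, so [a] is uniformly monotone
   there and, by the monotonicity of f and g (and, for sigma < 1, a quantitative form of the strict
   monotonicity of f), the right-hand side is at most C |Dw|. In the limit
     3 c0 int phi^2 |Dw|^2 <= C int phi^3 |Dw|,  phi = (w - k)_+.
   As k increases to the essential supremum m of w this first gives Dw = 0 a.e. on {w = m}; hence
   the sets {w > k, Dw <> 0} shrink to a null set, and a Faber-Krahn inequality for phi^2 on sets of
   small measure absorbs the right-hand side, so that phi = 0 for some k < m: a contradiction.
   The Poincare and Faber-Krahn inequalities are derived from the translation estimate
   int |G(x+h) - G(x)|^2 <= C |h|^2 int |DG|^2. *)
Require Import Defs.
From HB Require Import structures.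
From mathcomp Require Import all_boot all_order all_algebra.
From mathcomp Require Import all_classical all_reals all_analysis.
From mathcomp Require Import measurable_realfun ring lra zify.
Set Implicit Arguments. Unset Strict Implicit. Unset Printing Implicit Defensive.
Import Order.TTheory GRing.Theory Num.Theory.
Import numFieldNormedType.Exports.
Local Open Scope classical_set_scope.
Local Open Scope ring_scope.

(** * Lebesgue measure on R^{n+1} *)

(** Test functions must be C^1 with compact support, while the flux [a x (Du x)] is only locally
    integrable: passing to the limit requires gradients bounded along the mollification, and this
    shapes the powers. Both [t_+^2] and [t_+^3] have locally Lipschitz derivatives. The energy of
    phi^2 is 4 phi^2 |Dw|^2, a multiple of the left-hand integrand; Young's inequality bounds C
    phi^3 |Dw| by c0 phi^2 |Dw|^2 + C^2/(4 c0) phi^4, and phi^4 is the square of phi^2 that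
    Faber-Krahn controls. With X the integral of phi^2 |Dw|^2, the 3 of the cube leaves the margin 3
    c0 X <= 2 c0 X. The sets {w > k} themselves need not become small as k tends to m, for w may
    equal m on a set of positive measure; hence the detour through the part where Dw <> 0. The
    analysis runs over an abstract sigma-finite space with a coordinate map, of which it uses
    measurability of the coordinates, finite and positive measure of boxes, translation invariance
    for continuous non-negative integrands, and approximation of indicators by continuous
    functions. *)

Section SigmaFiniteMeasure.
Context {d} {T : measurableType d} {R : realType} (m : {measure set T -> \bar R}).

(** The proof of sigma-finiteness is a phantom argument to which the canonical instance is attached.
    The alias stays convertible to [m], so Tonelli applies to measures whose type does not record
    sigma-finiteness. *)
Definition sfmeasure of sigma_finite setT m : set T -> \bar R := m.

Variable sf : sigma_finite setT m.
HB.instance Definition _ := Measure.copy (sfmeasure sf) m.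
HB.instance Definition _ := Measure_isSigmaFinite.Build _ _ _ (sfmeasure sf) sf.
End SigmaFiniteMeasure.

Section LebRn.
Context {R : realType}.
Local Notation Xs n := (projT2 (RnT R n)).

Lemma measurable_ofRn n (i : 'I_n.+1) :
  measurable_fun setT (fun x : Xs n => ofRn x ord0 i).
Proof.
elim: n i => [|n IH] i /=.
  rewrite (_ : (fun _ => _) = id); last by apply/funext => x; rewrite mxE.
  exact: measurable_id.
case: (leqP i n) => hi.
  rewrite (_ : (fun _ => _) = (fun x : Xs n => ofRn x ord0 (inord i)) \o fst).
    exact: measurableT_comp.
  by apply/funext => x; rewrite mxE hi.
rewrite (_ : (fun _ => _) = snd); first exact: measurable_snd.
by apply/funext => x; rewrite mxE leqNgt hi.
Qed.

Lemma lebn_sigma_finite n : sigma_finite setT (lebn R n).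
Proof.
elim: n => [|n IH]; first exact: sigma_finiteT.
have /sigma_finiteP[F [TF ndF Foo]] := IH.
have /sigma_finiteP[G [TG ndG Goo]] := sigma_finiteT (@lebesgue_measure R).
exists (fun k => F k `*` G k).
  rewrite -setXTT TF TG predeqE => -[x y]; split; last first.
    by move=> [k _ []/= ? ?]; split; exists k.
  move=> [/= [j _ Fx] [k _ Gy]]; exists (maxn j k) => //; split.
  - by move: x Fx; exact/subsetPset/ndF/leq_maxl.
  - by move: y Gy; exact/subsetPset/ndG/leq_maxr.
move=> k; have [? ?] := Foo k; have [? ?] := Goo k.
split; first exact: measurableX.
rewrite [X in (X < _)%E](@product_measure1E _ _ _ _ _ (lebn R n) (@lebesgue_measure R))//.
by rewrite lte_mul_pinfty// ge0_fin_numE.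
Qed.

Lemma integral_lebnS n (F : (Xs n * measurableTypeR R)%type -> \bar R) : measurable_fun setT F ->
  (forall x, 0 <= F x)%E ->
  (\int[lebn R n.+1]_x F x =
   \int[lebn R n]_x \int[@lebesgue_measure R]_t F (x, t))%E.
Proof.
exact: (@fubini_tonelli1 _ _ _ _ _ (sfmeasure (lebn_sigma_finite n)) (@lebesgue_measure R)).
Qed.

Lemma measurable_box n (r : R) :
  measurable [set x : Xs n | forall i, `|ofRn x ord0 i| <= r].
Proof.
rewrite (_ : [set _ | _] = \bigcap_(i in [set: 'I_n.+1])
    ((fun x : Xs n => ofRn x ord0 i) @^-1` `[-r, r]%classic)); last first.
  apply/seteqP; split => x /= h i; first by move=> _; rewrite /= in_itv/= -ler_norml.
  by have := h i I; rewrite /= in_itv/= -ler_norml.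
apply: fin_bigcap_measurable => [|i _]; first exact: finite_finset; rewrite -[X in measurable X]setTI.
exact: measurable_ofRn.
Qed.

Lemma lebn_box n (r : R) : 0 <= r ->
  lebn R n [set x | forall i, `|ofRn x ord0 i| <= r] = ((r *+ 2) ^+ n.+1)%:E.
Proof.
move=> r0; elim: n => [|n IH].
  rewrite (_ : [set _ | _] = `[-r, r]%classic); last first.
    apply/seteqP; split => x /=.
      by move=> /(_ ord0); rewrite mxE in_itv/= ler_norml.
    by rewrite in_itv/= => h i; rewrite mxE ler_norml.
  rewrite /= lebesgue_measure_itv/= lte_fin.
  case: ltP => h; first by rewrite expr1 -EFinD opprK mulr2n.
  have -> : r = 0 by lra.
  by rewrite expr1 mul0rn.
rewrite (_ : [set _ | _] =
    [set x : Xs n | forall i, `|ofRn x ord0 i| <= r] `*` `[-r, r]%classic); last first.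
  apply/seteqP; split => -[x t] /= h.
    split=> [i|].
      have := h (inord i); rewrite mxE inordK ?ltnS; last exact/ltnW.
      by rewrite -ltnS ltn_ord inord_val.
    have := h ord_max; rewrite mxE/= ltnn in_itv/= ler_norml //.
  move=> i; rewrite mxE; case: ifPn => _; first exact: h.1.
  by have := h.2; rewrite in_itv/= ler_norml.
rewrite [LHS](@product_measure1E _ _ _ _ _ (lebn R n) (@lebesgue_measure R)) //=.
  rewrite IH lebesgue_measure_itv/= lte_fin.
  case: ltP => h; first by rewrite -EFinD opprK -mulr2n -EFinM -exprSr.
  have -> : r = 0 by lra.
  by rewrite mule0 mul0rn exprS mul0r.
exact: (measurable_box n r).
Qed.

Local Notation leb := (@lebesgue_measure R).

(** By uniqueness of Lebesgue measure it is enough that the pushforward by the translation has the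
    right value on half-open intervals. *)
Lemma integral_translation1 (s : R) (F : R -> \bar R) : measurable_fun setT F ->
  (forall x, 0 <= F x)%E -> (\int[leb]_t F (t + s)%R = \int[leb]_t F t)%E.
Proof.
move=> mF F0.
have mh : measurable_fun setT (fun t : measurableTypeR R => t + s : measurableTypeR R).
  exact: measurable_funD.
pose mh' := isMeasurableFun.Build _ _ _ _ _ mh.
pose h : {mfun measurableTypeR R >-> measurableTypeR R} := HB.pack (fun t : measurableTypeR R => t + s : measurableTypeR R) mh'.
rewrite -(@ge0_integral_pushforward _ _ _ _ _ _ mh leb setT)//.
apply: eq_measure_integral => //= A mA _.
rewrite -[LHS]/(pushforward leb h A); apply/esym/lebesgue_measure_unique => //= _ [[a b]] _ <-.
rewrite /pushforward.
rewrite (_ : _ @^-1` _ = `]a - s, b - s]%classic); last first.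
  by apply/seteqP; split => x /=; rewrite !in_itv/= ltrBlDr lerBrDr.
rewrite !lebesgue_measure_itv/= !lte_fin ltrD2r.
by case: ifP => // _; rewrite -!EFinB; congr (_%:E); ring.
Qed.

(** Translation of the iterated product, factor by factor, so that Tonelli reduces its invariance to
    one variable; [toRn] below turns a row vector into such a translation. *)
Fixpoint addRn n : Xs n -> Xs n -> Xs n :=
  match n return Xs n -> Xs n -> Xs n with
  | 0 => fun x y => (x : R) + (y : R)
  | m.+1 => fun x y => (@addRn m x.1 y.1, (x.2 : R) + (y.2 : R))
  end.
Arguments addRn {n}.

Fixpoint toRn n : 'rV[R]_n.+1 -> Xs n :=
  match n return 'rV[R]_n.+1 -> Xs n with
  | 0 => fun x => x ord0 ord0
  | m.+1 => fun x => (@toRn m (\row_i x ord0 (widen_ord (leqnSn _) i)), x ord0 ord_max)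
  end.

Lemma ofRnK n : cancel (@toRn n) (@ofRn R n).
Proof.
elim: n => [|n IH] x; apply/rowP => i; rewrite mxE /=; first by rewrite (ord1 i).
case: ifPn => hi.
  rewrite -/(@ofRn R n) IH mxE; congr (x _ _); apply/val_inj => /=.
  by rewrite inordK.
congr (x _ _); apply/val_inj => /=.
by have := ltn_ord i; lia.
Qed.

Lemma ofRnD n (x y : Xs n) : ofRn (addRn x y) = ofRn x + ofRn y.
Proof.
elim: n x y => [|n IH] x y; apply/rowP => i; rewrite !mxE//=.
by case: ifP => // _; rewrite -/(@ofRn R n) IH mxE.
Qed.

Lemma measurable_addRn n (h : Xs n) : measurable_fun setT (addRn^~ h).
Proof.
elim: n h => [|n IH] h /=; first exact: measurable_funD.
apply: measurable_fun_pair; first exact: (measurableT_comp (IH h.1) measurable_fst).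
by apply: measurable_funD => //; exact: measurable_snd.
Qed.

Lemma integral_translation n (h : Xs n) (F : Xs n -> \bar R) :
  measurable_fun setT F -> (forall x, 0 <= F x)%E ->
  (\int[lebn R n]_x F (addRn x h) = \int[lebn R n]_x F x)%E.
Proof.
elim: n h F => [|n IH] h F mF F0; first exact: integral_translation1.
rewrite (@integral_lebnS n (fun x => F (@addRn n.+1 x h)))//; last first.
  exact: (measurableT_comp mF (@measurable_addRn n.+1 h)).
rewrite (@integral_lebnS n F)//.
transitivity (\int[lebn R n]_x \int[leb]_t F (addRn x h.1, t))%E.
  apply: eq_integral => x _.
  rewrite -(@integral_translation1 h.2 (fun t => F (addRn x h.1, t)))//.
  exact: (measurableT_comp mF (measurable_pair1 _)).
apply: (IH h.1 (fun x => \int[leb]_t F (x, t))%E).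
  exact: (@measurable_fun_fubini_tonelli_F _ _ _ _ _ leb).
by move=> x; exact: integral_ge0.
Qed.

End LebRn.

(** * Continuity, coordinates and Caratheodory compositions *)

Section RealContinuity.
Context {R : realType} {V : topologicalType}.
Implicit Types F G : V -> R.

Lemma fcontinuousD F G : continuous F -> continuous G -> continuous (fun v => F v + G v).
Proof. by move=> cF cG v; apply: cvgD; [exact: cF|exact: cG]. Qed.

Lemma fcontinuousB F G : continuous F -> continuous G -> continuous (fun v => F v - G v).
Proof. by move=> cF cG v; apply: cvgB; [exact: cF|exact: cG]. Qed.

Lemma fcontinuousM F G : continuous F -> continuous G -> continuous (fun v => F v * G v).
Proof. by move=> cF cG v; apply: cvgM; [exact: cF|exact: cG]. Qed.

Lemma fcontinuous_max F G : continuous F -> continuous G ->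
  continuous (fun v => Num.max (F v) (G v)).
Proof. by move=> cF cG v; exact: (continuous_max (cF v) (cG v)). Qed.

Lemma fcontinuous_min F G : continuous F -> continuous G ->
  continuous (fun v => Num.min (F v) (G v)).
Proof. by move=> cF cG v; exact: (continuous_min (cF v) (cG v)). Qed.

Lemma fcontinuous_cst (c : R) : continuous (fun _ : V => c).
Proof. exact: cst_continuous. Qed.

Lemma fcontinuous_sum I (s : seq I) (F : I -> V -> R) : (forall i, continuous (F i)) ->
  continuous (fun v => \sum_(i <- s) F i v).
Proof.
move=> cF; elim: s => [|i s IH].
  by under eq_fun do rewrite big_nil; exact: fcontinuous_cst.
by under eq_fun do rewrite big_cons; exact: fcontinuousD.
Qed.
End RealContinuity.

Section RowNorm.
Context {R : realType} {n : nat}.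
Implicit Types x : 'rV[R]_n.+1.

Lemma rV_norm_leP x (r : R) : reflect (forall i, `|x ord0 i| <= r) (`|x| <= r).
Proof.
have -> : `|x| = mx_norm x by []. rewrite mx_normrE; apply: (iffP idP) => [h i|h].
  by have /bigmax_leP[_ /(_ (ord0, i) isT)] := h.
apply/bigmax_leP; split; first exact: le_trans (normr_ge0 _) (h ord0).
by move=> -[i j] _ /=; rewrite (ord1 i).
Qed.

Lemma rV_coord_le x i : `|x ord0 i| <= `|x|.
Proof. by have /rV_norm_leP := lexx `|x|; exact. Qed.

Lemma cvg_rV (u : nat -> 'rV[R]_n.+1) x :
  (forall i, (fun k => u k ord0 i) @ \oo --> x ord0 i) -> u @ \oo --> x.
Proof.
move=> h; apply/cvgrPdist_le => e e0.
have : \forall k \near \oo, forall i, `|x ord0 i - u k ord0 i| <= e.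
  apply: filter_forall => i; exact: cvgr_dist_le.
apply: filterS => k hk; apply/rV_norm_leP => i; rewrite !mxE; exact: hk.
Qed.
End RowNorm.

Section Caratheodory.
Context {R : realType} {d} {T : measurableType d} {m : nat}.
Variables (D : set T) (mD : measurable D).

Let grid (k : nat) (t : R) : int := Num.floor (t * k.+1%:R).

Let measurable_grid k (U : T -> R) (z : int) : measurable_fun D U ->
  measurable (D `&` [set x | grid k (U x) = z]).
Proof.
move=> mU.
have := mU mD `[z%:~R / k.+1%:R, (z + 1)%:~R / k.+1%:R[%classic (measurable_itv _).
congr (measurable (_ `&` _)); apply/seteqP; split => x /=; rewrite in_itv/=.
  rewrite ler_pdivrMr// ltr_pdivlMr// => h; exact: floor_def.
by move=> <-; rewrite ler_pdivrMr// ltr_pdivlMr//; exact: floor_itv.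
Qed.

Let cvg_grid (t : R) : (fun k => (grid k t)%:~R / k.+1%:R : R) @ \oo --> t.
Proof.
apply/cvgrPdist_le => e e0.
have := @cvg_harmonic R => /cvgrPdist_le/(_ e e0); apply: filterS => k.
rewrite sub0r normrN /harmonic/= => /(le_trans _); apply.
have := floor_itv (t * k.+1%:R); rewrite -/(grid k t) intrD => /andP[h1 h2].
have k0 : 0 < k.+1%:R :> R by [].
rewrite ger0_norm; last by rewrite subr_ge0 ler_pdivrMr.
rewrite ger0_norm; last by rewrite invr_ge0.
rewrite -(ler_pM2r k0) mulVf ?gt_eqF// mulrBl mulfVK ?gt_eqF// lerBlDl.
exact: ltW.
Qed.

(** [U] is rounded down to the grid of mesh [1/(k+1)]. The rounded map takes countably many values,
    so the composite is measurable piece by piece, and continuity in the second variable gives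
    pointwise convergence to [A x (U x)]. *)
Lemma measurable_caratheodory (A : T -> 'rV[R]_m.+1 -> R) (U : T -> 'rV[R]_m.+1) :
  (forall xi, measurable_fun D (A ^~ xi)) -> (forall x, D x -> continuous (A x)) ->
  (forall i, measurable_fun D (fun x => U x ord0 i)) ->
  measurable_fun D (fun x => A x (U x)).
Proof.
move=> mA cA mU.
pose G k (z : 'rV[int]_m.+1) : 'rV[R]_m.+1 := \row_i ((z ord0 i)%:~R / k.+1%:R).
pose Z k x : 'rV[int]_m.+1 := \row_i grid k (U x ord0 i).
apply: (@measurable_fun_cvg _ _ _ _ (fun k x => A x (G k (Z k x)))); last first.
  move=> x Dx; apply: continuous_cvg; first exact: cA.
  apply: cvg_rV => i; under eq_fun do rewrite !mxE; exact: cvg_grid.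
move=> k _ Y mY.
rewrite (_ : _ `&` _ = \bigcup_(z in [set: 'rV[int]_m.+1])
   ((D `&` [set x | Z k x = z]) `&` (D `&` (A ^~ (G k z)) @^-1` Y))); last first.
  apply/seteqP; split => [x [Dx Yx]|x [z _ [[Dx /= <-] [_ ?]]]]; last by split.
  by exists (Z k x).
apply: countable_bigcupT_measurable => // z; apply: measurableI; last exact: mA.
rewrite (_ : _ `&` _ = \bigcap_(i in [set: 'I_m.+1])
    (D `&` [set x | grid k (U x ord0 i) = z ord0 i])); last first.
  apply/seteqP; split => [x [Dx /= Zx] i _ /=|x h].
    by split => //; rewrite -Zx mxE.
  split; first by have [] := h ord0 I.
  by apply/rowP => i; rewrite mxE; have [] := h i I.
apply: fin_bigcap_measurable; first exact: finite_finset.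
by move=> i _; exact: measurable_grid.
Qed.

Lemma measurable_continuous_comp (G : 'rV[R]_m.+1 -> R) (U : T -> 'rV[R]_m.+1) :
  continuous G -> (forall i, measurable_fun D (fun x => U x ord0 i)) ->
  measurable_fun D (fun x => G (U x)).
Proof.
by move=> cG mU; apply: (measurable_caratheodory (A := fun _ => G)).
Qed.
End Caratheodory.

(** * Approximation by continuous functions *)

Section Approximation.
Context {R : realType} {d} {T : measurableType d} {n : nat}.
Variables (mu : {measure set T -> \bar R}) (phi : T -> 'rV[R]_n.+1).
Hypothesis mphi : forall i, measurable_fun setT (fun x => phi x ord0 i).

Definition box (r : R) : set T := [set x | `|phi x| <= r].

Lemma measurable_phibox r : measurable (box r).
Proof.
have := @measurable_continuous_comp R d T n setT measurableT (fun v => `|v|) phi.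
move=> /(_ (@norm_continuous _ _) mphi measurableT `]-oo, r]%classic (measurable_itv _)).
by rewrite setTI; congr measurable; apply/seteqP; split => x /=; rewrite in_itv.
Qed.
Hint Resolve measurable_phibox : core.

Hypothesis box_fin : forall r, (mu (box r) < +oo)%E.

Definition L1dist (r : R) (F G : T -> R) : \bar R :=
  (\int[mu]_(x in box r) `|F x - G x|%:E)%E.

Lemma L1dist_triangle r (F G H : T -> R) : measurable_fun setT F -> measurable_fun setT G ->
  measurable_fun setT H -> (L1dist r F H <= L1dist r F G + L1dist r G H)%E.
Proof.
move=> mF mG mH; rewrite /L1dist -ge0_integralD//; last 2 first.
- by apply/measurable_EFinP/measurableT_comp => //; exact/measurable_funTS/measurable_funB.
- by apply/measurable_EFinP/measurableT_comp => //; exact/measurable_funTS/measurable_funB.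
apply: ge0_le_integral => //.
- by apply/measurable_EFinP/measurableT_comp => //; exact/measurable_funTS/measurable_funB.
- by apply: emeasurable_funD; apply/measurable_EFinP/measurableT_comp => //;
    exact/measurable_funTS/measurable_funB.
by move=> x _; rewrite -EFinD lee_fin ler_distD.
Qed.

Lemma L1dist_indic_le r (F G : T -> R) (C : set T) : measurable_fun setT F -> measurable_fun setT G ->
  measurable C -> (forall x, `|F x - G x| <= \1_C x) -> (L1dist r F G <= mu (C `&` box r))%E.
Proof.
move=> mF mG mC h; rewrite -integral_indic//; apply: ge0_le_integral => //.
- by apply/measurable_EFinP/measurableT_comp => //; exact/measurable_funTS/measurable_funB.
- by apply/measurable_EFinP; exact: measurable_funTS.
- by move=> x _; rewrite lee_fin.
Qed.

Lemma measure_capbox_small r (C : nat -> set T) (e : R) :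
  (forall k, measurable (C k)) -> (forall k, C k.+1 `<=` C k) -> \bigcap_k C k = set0 ->
  0 < e -> exists k, (mu (C k `&` box r) <= e%:E)%E.
Proof.
move=> mC dC C0 e0.
have : (fun k => mu (C k `&` box r)) @ \oo --> mu (\bigcap_k (C k `&` box r)).
  apply: nonincreasing_cvg_mu.
  - apply: le_lt_trans (box_fin r); apply: le_measure; rewrite ?inE//.
    exact: measurableI.
  - by move=> k; exact: measurableI.
  - by apply: bigcapT_measurable => k; exact: measurableI.
  apply/nonincreasing_seqP => k; apply/subsetPset; apply: setSI; exact: dC.
rewrite (_ : \bigcap_k _ = set0); last first.
  by rewrite -subset0 -C0 => x h k _; have [] := h k I.
rewrite measure0 => /fine_cvgP[fc /cvgrPdist_le/(_ e e0) cv].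
have [k _ hk] := filterI fc cv.
exists k; have [h1 h2] := hk k (leqnn k).
rewrite -(fineK h1) lee_fin; apply: le_trans h2.
by rewrite sub0r normrN ler_norm.
Qed.

(** A local form of the density of continuous functions in L^1, with an approximant that may depend
    on the box; it is what makes mollifications converge in [mollify_L1]. *)
Definition approx_L1 (W : T -> R) := forall r e, 0 < e ->
  exists2 G : 'rV[R]_n.+1 -> R, continuous G & (L1dist r W (G \o phi) <= e%:E)%E.

Lemma approx_L1_closed W : measurable_fun setT W ->
  (forall r e, 0 < e -> exists W', [/\ measurable_fun setT W', approx_L1 W' &
     (L1dist r W W' <= e%:E)%E]) -> approx_L1 W.
Proof.
move=> mW h r e e0; have e20 : 0 < e / 2 by rewrite divr_gt0.
have [W' [mW' aW' hW']] := h r _ e20.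
have [G cG hG] := aW' r _ e20; exists G => //.
apply: (le_trans (L1dist_triangle r mW mW' _)).
  exact: measurable_continuous_comp.
by rewrite (splitr e) EFinD leeD.
Qed.

Lemma approx_L1_continuous G : continuous G -> approx_L1 (G \o phi).
Proof.
move=> cG r e e0; exists G => //; rewrite /L1dist.
by rewrite integral0_eq ?lee_fin ?ltW// => x _; rewrite subrr normr0.
Qed.

(** Lipschitz operations preserve approximability. Complements, unions (as a maximum of indicators),
    halving and rescaling are all instances, the unary ones with an [h] that ignores its second
    argument. *)
Lemma approx_L1_lip2 (h : R -> R -> R) (V W : T -> R) (c : R) :
  (forall G H : 'rV[R]_n.+1 -> R, continuous G -> continuous H ->
     continuous (fun v => h (G v) (H v))) -> 0 < c ->
  (forall a b a' b', `|h a b - h a' b'| <= c * (`|a - a'| + `|b - b'|)) ->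
  measurable_fun setT V -> measurable_fun setT W ->
  measurable_fun setT (fun x => h (V x) (W x)) ->
  approx_L1 V -> approx_L1 W -> approx_L1 (fun x => h (V x) (W x)).
Proof.
move=> ch c0 hh mV mW mh aV aW r e e0.
have e20 : 0 < e / (2 * c) by rewrite divr_gt0// mulr_gt0.
have [G cG hG] := aV r _ e20; have [H cH hH] := aW r _ e20.
have cGH : continuous (fun v => h (G v) (H v)).
  exact: ch.
exists (fun v => h (G v) (H v)) => //.
have mG := measurable_continuous_comp measurableT cG mphi.
have mH := measurable_continuous_comp measurableT cH mphi.
have mGH := measurable_continuous_comp measurableT cGH mphi.
apply: (@le_trans _ _ (c%:E * (L1dist r V (G \o phi) + L1dist r W (H \o phi)))%E).
  have m1 : measurable_fun (box r) (fun x => `|V x - (G \o phi) x|%:E).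
    by apply/measurable_EFinP/measurableT_comp => //; exact/measurable_funTS/measurable_funB.
  have m2 : measurable_fun (box r) (fun x => `|W x - (H \o phi) x|%:E).
    by apply/measurable_EFinP/measurableT_comp => //; exact/measurable_funTS/measurable_funB.
  rewrite /L1dist -ge0_integralD// -ge0_integralZl//; last 3 first.
  - exact: emeasurable_funD.
  - by move=> x _; rewrite adde_ge0.
  - by rewrite ltW.
  apply: ge0_le_integral => //.
  - by apply/measurable_EFinP/measurableT_comp => //; exact/measurable_funTS/measurable_funB.
  - by apply: emeasurable_funM => //; exact: emeasurable_funD.
  by move=> x _; rewrite -EFinD -EFinM lee_fin /=; exact: hh.
rewrite (_ : e%:E = c%:E * ((e / (2 * c))%:E + (e / (2 * c))%:E))%E.
  by apply: lee_wpmul2l; [rewrite lee_fin ltW|exact: leeD].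
by rewrite -EFinD -EFinM; congr (_%:E); field; rewrite gt_eqF.
Qed.

Definition approx_set (B : set T) := measurable B /\ approx_L1 \1_B.

Lemma approx_setC B : approx_set B -> approx_set (~` B).
Proof.
move=> [mB aB]; split; first exact: measurableC.
rewrite (_ : \1_(~` B) = (fun x => (fun a _ : R => 1 - a) (\1_B x) (\1_B x))); last first.
  by apply/funext => x /=; rewrite !indicE in_setC; case: (x \in B); rewrite /= ?subrr ?subr0.
apply: (@approx_L1_lip2 (fun a _ => 1 - a) \1_B \1_B 1) => //=.
- by move=> G _ cG _ x; exact: (fcontinuousB (@fcontinuous_cst _ _ 1) cG).
- move=> a b a' b'; have -> : 1 - a - (1 - a') = - (a - a') by ring.
  by rewrite normrN mul1r lerDl.
- exact: measurable_funB.
Qed.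

Lemma approx_setU A B : approx_set A -> approx_set B -> approx_set (A `|` B).
Proof.
move=> [mA aA] [mB aB]; split; first exact: measurableU.
rewrite (_ : \1_(_ `|` _) = (fun x => Num.max (\1_A x) (\1_B x))); last first.
  apply/funext => x /=; rewrite !indicE in_setU.
  by case: (x \in A); case: (x \in B); rewrite /= /Num.max ?ltxx ?ltr01 ?ltr10.
apply: (@approx_L1_lip2 Num.max \1_A \1_B 1) => //=.
- by move=> G H cG cH x; exact: (fcontinuous_max cG cH).
- move=> a b a' b'; rewrite mul1r /Num.max.
  have := ler_norm (a - a'); have := ler_norm (b - b').
  have := ler_norm (a' - a); have := ler_norm (b' - b).
  rewrite (distrC b') (distrC a') => *; rewrite ler_norml.
  by case: ltP => ?; case: ltP => ?; apply/andP; split; lra.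
- exact: measurable_maxr.
Qed.

(** What the first [k] sets miss of the union decreases to the empty set as [k] grows; boxes have
    finite measure, so inside a box the missing part becomes small. *)
Lemma approx_set_bigcup (B : nat -> set T) :
  (forall k, approx_set (B k)) -> approx_set (\bigcup_k B k).
Proof.
move=> aB; pose U k := \big[setU/set0]_(i < k) B i.
have aU k : approx_set (U k).
  rewrite /U; elim: k => [|k IH]; last by rewrite big_ord_recr/=; exact: approx_setU.
  rewrite big_ord0; split => //; rewrite indic0.
  by apply: (@approx_L1_continuous (cst 0)); exact: cst_continuous.
have mB : measurable (\bigcup_k B k) by apply: bigcupT_measurable => k; have [] := aB k.
split => //; apply: approx_L1_closed => // r e e0.
have [||k hk] := @measure_capbox_small r (fun k => \bigcup_k B k `\` U k) e
  (fun k => measurableD mB (aU k).1) _ _ e0.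
- by move=> k; apply: setDS; rewrite /U big_ord_recr/=; exact: subsetUl.
- rewrite -subset0 => x h; have [[i _ Bi] _] := h 0%N I.
  have [_] := h i.+1 I; apply; rewrite /U big_ord_recr/=; by right.
have [mU aUk] := aU k; exists \1_(U k); split => //.
apply: le_trans hk; apply: L1dist_indic_le => //; first exact: measurableD.
move=> x; rewrite !indicE in_setD.
case: (boolP (x \in U k)) => xU /=; last by rewrite subr0 andbT; case: (x \in _); rewrite ?normr1 ?normr0.
rewrite (_ : x \in _ = true) ?subrr ?normr0//; apply/mem_set.
by move/set_mem : xU; rewrite /U -bigcup_mkord => -[i _ ?]; exists i.
Qed.

(** A ramp of slope [k+1] differs from the indicator only on the strip between [c] and
    [c + 1/(k+1)], and these strips decrease to the empty set. *)
Lemma approx_halfspace i (c : R) : approx_set [set x | c < phi x ord0 i].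
Proof.
have mH e : measurable [set x | e < phi x ord0 i].
  rewrite (_ : [set _ | _] = setT `&` (fun x => phi x ord0 i) @^-1` `]e, +oo[%classic).
    exact: mphi.
  by rewrite setTI; apply/seteqP; split => x /=; rewrite in_itv/= andbT.
split => //; apply: approx_L1_closed => // r e e0.
pose H := [set x | c < phi x ord0 i].
pose C (k : nat) := H `\` [set x | c + k.+1%:R^-1 < phi x ord0 i].
have mC k : measurable (C k) by apply: measurableD; exact: mH.
have [||k hk] := @measure_capbox_small r C e mC _ _ e0.
- move=> k; apply: setDS => x /=; apply: le_lt_trans; rewrite lerD2l.
  by rewrite lef_pV2 ?posrE// ler_nat.
- rewrite -subset0 => x h; have [Hx _] := h 0%N I.
  have d0 : 0 < phi x ord0 i - c by rewrite subr_gt0.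
  have [k _ /(_ k (leqnn _)) hk] := near_infty_natSinv_lt (PosNum d0).
  by have [_] := h k I; apply => /=; rewrite -ltrBrDl.
pose G (v : 'rV[R]_n.+1) := Num.min 1 (Num.max 0 (k.+1%:R * (v ord0 i - c))).
have cG : continuous G.
  apply: fcontinuous_min; first exact: fcontinuous_cst.
  apply: fcontinuous_max; first exact: fcontinuous_cst.
  apply: fcontinuousM; first exact: fcontinuous_cst.
  by apply: fcontinuousB; [exact: coord_continuous|exact: fcontinuous_cst].
exists (G \o phi); split.
- exact: measurable_continuous_comp.
- exact: approx_L1_continuous.
apply: le_trans hk; apply: L1dist_indic_le => //.
  exact: measurable_continuous_comp.
move=> x; rewrite /= !indicE /G /C /H in_setD.
have k0 : 0 < k.+1%:R :> R by [].
set t := phi x ord0 i.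
have -> : x \in [set x | c < phi x ord0 i] = (c < t) by apply/idP/idP; rewrite ?inE.
have -> : x \in [set x | c + k.+1%:R^-1 < phi x ord0 i] = (c + k.+1%:R^-1 < t).
  by apply/idP/idP; rewrite ?inE.
case: (ltP c t) => h1 /=; last first.
  have : k.+1%:R * (t - c) <= 0 by rewrite pmulr_rle0// subr_le0.
  move=> h; rewrite (max_idPl h) (min_idPr ler01) subrr normr0//.
have h3 : 0 <= k.+1%:R * (t - c) by rewrite mulr_ge0// subr_ge0 ltW.
rewrite (max_idPr h3).
case: (ltP _ t) => h2 /=.
  have : 1 <= k.+1%:R * (t - c).
    by rewrite -ler_pdivrMl// mulr1 lerBrDl ltW.
  by move=> h; rewrite (min_idPl h) subrr normr0.
rewrite ler_norml; case: (leP 1 (k.+1%:R * (t - c))) => h; apply/andP; split; rewrite /=; lra.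
Qed.

Lemma approx_set_sigma_algebra : sigma_algebra setT approx_set.
Proof.
split.
- by rewrite -(@bigcup0 _ _ setT (fun _ : nat => set0))//; apply: approx_set_bigcup => k;
    split => //; rewrite indic0; apply: (@approx_L1_continuous (cst 0)); exact: cst_continuous.
- by move=> A; rewrite setTD; exact: approx_setC.
- exact: approx_set_bigcup.
Qed.

End Approximation.

Section ApproximationBounded.
Context {R : realType} {d} {T : measurableType d} {n : nat}.
Variables (mu : {measure set T -> \bar R}) (phi : T -> 'rV[R]_n.+1).
Hypothesis mphi : forall i, measurable_fun setT (fun x => phi x ord0 i).
Hypothesis box_fin : forall r : R, (mu (box phi r) < +oo)%E.
Hypothesis approx_indic : forall B, measurable B -> approx_L1 mu phi \1_B.

(** Binary expansion of [W]: on [B] the first digit is 1, and [2 W - 1_B] takes its values in [0,1]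
    again. After [m] digits the error is at most [2^-m]. *)
Let approx_dyadic (m : nat) (W : T -> R) : measurable_fun setT W ->
  (forall x, 0 <= W x <= 1) -> exists W', [/\ measurable_fun setT W',
    approx_L1 mu phi W' & forall x, `|W x - W' x| <= 2^-1 ^+ m].
Proof.
elim: m W => [|m IH] W mW W01.
  exists (cst 0); split => //.
    by apply: (@approx_L1_continuous _ _ _ _ mu phi (cst 0)); exact: cst_continuous.
  by move=> x; rewrite expr0 subr0 ger0_norm; case/andP: (W01 x).
pose B := W @^-1` `[2^-1, +oo[%classic.
have mB : measurable B by rewrite -[B]setTI; exact: mW.
have inB x : (x \in B) = (2^-1 <= W x).
  by apply/idP/idP; rewrite inE /B/= in_itv/= andbT.
have [||W' [mW' aW' hW']] := IH (fun x => 2 * W x - \1_B x).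
- by apply: measurable_funB => //; exact: measurable_funM.
- move=> x; rewrite indicE inB; have /andP[? ?] := W01 x; case: (leP 2^-1 (W x)) => h; rewrite /= ?mulr0n ?mulr1n; lra.
exists (fun x => (fun a b => 2^-1 * (a + b)) (W' x) (\1_B x)); split.
- by apply: measurable_funM => //; exact: measurable_funD.
- apply: (@approx_L1_lip2 _ _ _ _ mu phi mphi (fun a b => 2^-1 * (a + b)) W' \1_B 1) => //.
  + move=> G H cG cH; apply: fcontinuousM; first exact: fcontinuous_cst.
    exact: fcontinuousD.
  + move=> a b a' b'; rewrite (_ : _ - _ = 2^-1 * ((a - a') + (b - b'))); last by ring.
    rewrite normrM ger0_norm ?invr_ge0//; apply: ler_pM; rewrite ?invr_ge0//.
      by rewrite invf_le1// ler1n.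
    exact: ler_normD.
  + by apply: measurable_funM => //; exact: measurable_funD.
  exact: approx_indic.
move=> x; rewrite (_ : _ - _ = 2^-1 * ((2 * W x - \1_B x) - W' x)); last first.
  by rewrite /=; field.
by rewrite normrM ger0_norm ?invr_ge0// exprS ler_wpM2l// invr_ge0.
Qed.

Let approx_unit (W : T -> R) : measurable_fun setT W ->
  (forall x, 0 <= W x <= 1) -> approx_L1 mu phi W.
Proof.
move=> mW W01; apply: approx_L1_closed => // r e e0.
have mb := measurable_phibox mphi r.
have fb : mu (box phi r) \is a fin_num by rewrite ge0_fin_numE.
pose b := fine (mu (box phi r)).
have b0 : 0 <= b by rewrite fine_ge0.
have : (fun m => 2^-1 ^+ m : R) @ \oo --> 0.
  by apply: cvg_expr; rewrite ger0_norm ?invr_ge0// invf_lt1// ltr1n.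
have ee : 0 < e / (b + 1) by rewrite divr_gt0// ltr_wpDl.
move=> /cvgrPdist_le/(_ _ ee) [m _ /(_ m (leqnn m))].
rewrite sub0r normrN ger0_norm ?exprn_ge0 ?invr_ge0// => hm.
have [W' [mW' aW' hW']] := approx_dyadic m mW W01.
exists W'; split => //.
apply: (@le_trans _ _ (\int[mu]_(x in box phi r) (e / (b + 1))%:E)%E).
  apply: ge0_le_integral => //.
  - by apply/measurable_EFinP/measurableT_comp => //; exact/measurable_funTS/measurable_funB.
  - by move=> x _; rewrite lee_fin (le_trans (hW' x)).
rewrite integral_cst//= -(fineK fb) -EFinM lee_fin -/b.
by rewrite mulrAC ler_pdivrMr ?ltr_wpDl// ler_pM2l// lerDl.
Qed.

Lemma approx_L1_bounded (W : T -> R) (M : R) : measurable_fun setT W ->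
  (forall x, `|W x| <= M) -> approx_L1 mu phi W.
Proof.
move=> mW WM.
pose K := `|M| + 1.
have K0 : 0 < K by rewrite ltr_wpDl.
have WK x : - K <= W x <= K.
  by rewrite -ler_norml (le_trans (WM x))// /K (le_trans (ler_norm _))// lerDl.
pose U x := (W x + K) / (2 * K).
have mU : measurable_fun setT U by apply: measurable_funM => //; exact: measurable_funD.
have aU : approx_L1 mu phi U.
  apply: approx_unit => // x; have /andP[h1 h2] := WK x.
  rewrite /U; apply/andP; split; first by apply: divr_ge0; lra.
  by rewrite ler_pdivrMr ?mulr_gt0//; lra.
have WE x : W x = (fun a _ : R => 2 * K * a - K) (U x) (U x).
  by rewrite /U/=; field; rewrite gt_eqF.
rewrite (_ : W = fun x => (fun a _ : R => 2 * K * a - K) (U x) (U x)); last exact/funext.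
apply: (@approx_L1_lip2 _ _ _ _ mu phi mphi (fun a _ => 2 * K * a - K) U U (2 * K)) => //.
- move=> G H cG cH; apply: fcontinuousB; last exact: fcontinuous_cst.
  by apply: fcontinuousM => //; exact: fcontinuous_cst.
- by rewrite mulr_gt0.
- move=> a b a' b'; rewrite (_ : _ - _ = 2 * K * (a - a')); last by ring.
  have K2 : 0 <= 2 * K by lra.
  by rewrite normrM (ger0_norm K2); apply: ler_wpM2l => //; rewrite lerDl.
- by apply: measurable_funB => //; exact: measurable_funM.
Qed.
End ApproximationBounded.

(** * Induction over Borel sets of the iterated product *)

Lemma sigma_algebra_preimage_ind {U V : Type} (f : U -> V) (P : set (set U)) :
  sigma_algebra setT P -> sigma_algebra setT [set E | P (f @^-1` E)].
Proof.
move=> [P0 PC' PU]; split => /=.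
- by rewrite preimage_set0.
- by move=> E /PC'; rewrite !setTD preimage_setC.
- by move=> E hE; rewrite preimage_bigcup; exact: PU.
Qed.

Lemma measurable_prod_ind d1 d2 (T1 : measurableType d1) (T2 : measurableType d2)
    (P : set (set (T1 * T2))) : sigma_algebra setT P ->
  (forall A, measurable A -> P (fst @^-1` A)) ->
  (forall B, measurable B -> P (snd @^-1` B)) -> forall C, measurable C -> P C.
Proof.
move=> sP P1 P2; rewrite measurable_prod_measurableType; apply: smallest_sub => //.
have [P0 PC' PU] := sP.
have PN E : P E -> P (~` E) by move=> /PC'; rewrite setTD.
have PI C D : P C -> P D -> P (C `&` D).
  move=> PC PD; rewrite -(setCK (C `&` D)) setCI -bigcup2E.
  by apply: (PN _); apply: (PU _) => -[|[|k]] /=; [exact: PN|exact: PN|exact: P0].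
by move=> _ [A mA [B mB <-]]; apply: PI; [exact: P1|exact: P2].
Qed.

Lemma measurable_R_ind (R : realType) (P : set (set R)) : sigma_algebra setT P ->
  (forall c : R, P [set x | c < x]) -> forall A, measurable A -> P A.
Proof.
move=> sP hP A; rewrite [measurable]RGenOInfty.measurableE => mA.
apply: mA; split => //= _ [c ->].
by have := hP c; congr (P _); apply/seteqP; split => x /=; rewrite in_itv/= andbT.
Qed.

(** Half-spaces generate the Borel sets; together with [approx_set_sigma_algebra] and
    [approx_halfspace] this makes every Borel set approximable. *)
Lemma RnT_sigma_ind (R : realType) (n : nat) (P : set (set (projT2 (RnT R n)))) :
  sigma_algebra setT P -> (forall i (c : R), P [set x | c < ofRn x ord0 i]) ->
  forall A, measurable A -> P A.
Proof.
elim: n P => [|n IH] P sP hP.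
  apply: measurable_R_ind => // c.
  by have := hP ord0 c; congr (P _); apply/seteqP; split => x /=; rewrite mxE.
apply: (@measurable_prod_ind _ _ (projT2 (RnT R n)) (measurableTypeR R) P sP).
  apply: (IH [set E | P (fst @^-1` E)]); first exact: sigma_algebra_preimage_ind.
  move=> i c; have := hP (widen_ord (leqnSn _) i) c; congr (P _).
  have hi : inord i = i by rewrite inord_val.
  by apply/seteqP; split => x; rewrite /= mxE/= -ltnS ltn_ord hi.
apply: (measurable_R_ind (P := [set E | P (snd @^-1` E)])).
  exact: sigma_algebra_preimage_ind.
move=> c; have := hP ord_max c; congr (P _).
by apply/seteqP; split => x; rewrite /= mxE/= ltnn.
Qed.

(** * The completed Lebesgue measure *)

Section CompletedLebesgue.
Context {R : realType} {n : nat}.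
Local Notation Xs := (projT2 (RnT R n)).
Local Notation CT := (caratheodory_type ((@lebn R n)^*)%mu).
Local Notation mu := (@lebRn R n).
Local Notation phi := (@ofRn R n : CT -> 'rV[R]_n.+1).

Lemma measurable_caratheodoryT (A : set Xs) : measurable A -> measurable (A : set CT).
Proof. by move=> mA; apply: sub_caratheodory; exact: sub_gen_smallest. Qed.

Lemma measurable_fun_idCT : measurable_fun setT (id : CT -> Xs).
Proof. by move=> _ A mA; rewrite setTI; exact: measurable_caratheodoryT. Qed.

Lemma lebRnE (A : set Xs) : measurable A -> mu (A : set CT) = lebn R n A.
Proof. exact: measurable_mu_extE. Qed.

Lemma lebRn_sigma_finite : sigma_finite setT mu.
Proof.
have [F hF1 hF2] := @lebn_sigma_finite R n; exists F => // i.
have [h1 h2] := hF2 i; split; first exact: measurable_caratheodoryT.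
by rewrite (lebRnE h1).
Qed.

Lemma integral_lebRnE (F : Xs -> \bar R) : measurable_fun setT F ->
  (forall x, 0 <= F x)%E -> (\int[mu]_x F x = \int[lebn R n]_x F x)%E.
Proof.
move=> mF F0.
pose mi := isMeasurableFun.Build _ _ _ _ _ measurable_fun_idCT.
pose h : {mfun CT >-> Xs} := HB.pack (id : CT -> Xs) mi.
rewrite -[LHS](@ge0_integral_pushforward _ _ CT Xs _ h measurable_fun_idCT mu setT)//.
apply: (@eq_measure_integral _ _ _ setT (lebn R n) (pushforward mu h)) => A mA _.
exact: (lebRnE mA).
Qed.

Lemma measurable_phiCT i : measurable_fun setT (fun x : CT => phi x ord0 i).
Proof. exact: (measurableT_comp (measurable_ofRn i) measurable_fun_idCT). Qed.

Lemma lebn_boxE (r : R) : 0 <= r -> mu (box phi r) = ((r *+ 2) ^+ n.+1)%:E.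
Proof.
move=> r0; rewrite /box (_ : [set _ | _] = [set x | forall i, `|ofRn x ord0 i| <= r]).
  rewrite -lebn_box//; by rewrite -(lebRnE (@measurable_box R n r)).
by apply/seteqP; split => x /= /rV_norm_leP.
Qed.

Lemma box_finCT (r : R) : (mu (box phi r) < +oo)%E.
Proof.
apply: (@le_lt_trans _ _ (mu (box phi `|r|))); last by rewrite lebn_boxE// ltry.
apply: le_measure; rewrite ?inE; try exact: measurable_phibox measurable_phiCT _.
by move=> x /= /le_trans; apply; exact: ler_norm.
Qed.

(** For continuous [G] the integrand is Borel, so the integral can be computed with [lebn], where
    invariance under translation has been proved factor by factor. *)
Lemma integral_translationCT (h : 'rV[R]_n.+1) (G : 'rV[R]_n.+1 -> R) :
  continuous G -> (forall v, 0 <= G v) ->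
  (\int[mu]_x (G (phi x + h))%:E = \int[mu]_x (G (phi x))%:E)%E.
Proof.
move=> cG G0.
have mG : measurable_fun setT (fun x : Xs => (G (ofRn x))%:E).
  by apply/measurable_EFinP; apply: measurable_continuous_comp => // i; exact: measurable_ofRn.
rewrite (integral_lebRnE mG)//; last by move=> x; rewrite lee_fin.
rewrite -(@integral_translation R n (toRn h) _ mG); last by move=> x; rewrite lee_fin.
rewrite -(@integral_lebRnE (fun x => (G (ofRn (addRn x (toRn h))))%:E)).
- by apply: eq_integral => x _; rewrite ofRnD ofRnK.
- exact: (measurableT_comp mG (measurable_addRn (toRn h))).
- by move=> x; rewrite lee_fin.
Qed.

(** A set of the completed sigma-algebra is reached from Borel sets through the outer measure: its
    part in a box has finite measure, hence is covered by a Borel set with excess at most [e]. *)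
Lemma approx_indicCT (B : set CT) : measurable B -> approx_L1 mu phi \1_B.
Proof.
have mphi := measurable_phiCT; have bf := box_finCT.
have aX (A : set Xs) : measurable A -> approx_set mu phi (A : set CT).
  move=> mA; apply: (@RnT_sigma_ind R n (approx_set mu phi)) => //.
    exact: (approx_set_sigma_algebra mphi bf).
  by move=> i c; exact: (approx_halfspace mphi bf).
move=> mB; apply: (approx_L1_closed mphi) => // r e e0.
have mbox : measurable (box phi r) by exact: measurable_phibox.
pose C := B `&` box phi r.
have mC : measurable C by exact: measurableI.
have fC : mu C \is a fin_num.
  rewrite ge0_fin_numE//; apply: le_lt_trans (bf r).
  by apply: le_measure; rewrite ?inE//; exact: subIsetr.
have [_ [F [mF CF] <-]] := @lb_ereal_inf_adherent _ _ _ e0 fC.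
move=> hF; pose A : set Xs := \bigcup_k F k.
have mA : measurable A by exact: bigcupT_measurable.
have mA' : measurable (A : set CT) by exact: measurable_caratheodoryT.
exists \1_(A : set CT); split => //; first exact: (aX A mA).2.
have -> : L1dist mu phi r \1_B \1_(A : set CT) = L1dist mu phi r \1_C \1_(A : set CT).
  apply: eq_integral => x xr; rewrite !indicE (_ : (x \in C) = (x \in B))//.
  by apply/idP/idP; rewrite !inE /C => //; [case|move=> ?; split => //; exact/set_mem].
have mAC : measurable ((A : set CT) `\` C) by exact: measurableD.
apply: (@le_trans _ _ (mu ((A : set CT) `\` C))).
  apply: (@le_trans _ _ (mu (((A : set CT) `\` C) `&` box phi r))).
    apply: (@L1dist_indic_le R _ CT n mu phi mphi r \1_C \1_(A : set CT) ((A : set CT) `\` C)) => // x; rewrite !indicE in_setD.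
    case: (boolP (x \in C)) => xC; last first.
      by rewrite sub0r normrN andbT; case: (_ \in _); rewrite ?normr1 ?normr0.
    by rewrite (_ : x \in _ = true) ?subrr ?normr0//; apply/mem_set/CF/set_mem.
  by apply: le_measure; [rewrite inE; exact: measurableI|rewrite inE|exact: subIsetl].
have hA : (mu (A : set CT) <= mu C + e%:E)%E.
  rewrite (lebRnE mA); apply: le_trans (ltW hF).
  exact: (measure_sigma_subadditive (lebn R n)).
have E := measureDI mu mA' mC.
have AC : (A : set CT) `&` C = C by apply/setIidPr.
rewrite AC in E; move: hA; rewrite [X in (X <= _)%E -> _]E.
by rewrite addeC leeD2lE.
Qed.
End CompletedLebesgue.

Lemma near_dist_le {R : realType} {M : normedModType R} (x : M) (e : R) : 0 < e ->
  \forall y \near x, `|y - x| <= e.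
Proof. by move=> e0; near=> y; rewrite distrC; near: y; exact: cvgr_dist_le. Unshelve. all: by end_near. Qed.

Lemma locally_lipschitz_continuous {R : realType} {M : normedModType R} (f : M -> R) (C : R) :
  0 <= C -> (forall x y, `|y - x| <= 1 -> `|f y - f x| <= C * `|y - x|) -> continuous f.
Proof.
move=> C0 hf x; apply/cvgrPdist_le => e e0.
have C10 : 0 < C + 1 by rewrite ltr_wpDl.
have H1 := near_dist_le x ltr01; have H2 := near_dist_le x (divr_gt0 e0 C10).
apply: (filterS _ (filterI H1 H2)) => y [h1 he].
rewrite distrC; apply: le_trans (hf _ _ h1) _.
apply: (@le_trans _ _ ((C + 1) * `|y - x|)); first by rewrite ler_wpM2r// lerDl.
by rewrite mulrC -ler_pdivlMr.
Qed.

(** * Functions with Lipschitz gradient *)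

Section C11.
Context {R : realType} {n : nat}.
Local Notation V := 'rV[R]_n.+1.
Implicit Types (F : V -> R) (DF : V -> V).

Lemma dotvD (c h h' : V) : dotv c (h + h') = dotv c h + dotv c h'.
Proof. by rewrite /dotv -big_split; apply: eq_bigr => i _; rewrite mxE mulrDr. Qed.

Lemma dotvDl (c c' h : V) : dotv (c + c') h = dotv c h + dotv c' h.
Proof. by rewrite /dotv -big_split; apply: eq_bigr => i _; rewrite mxE mulrDl. Qed.

Lemma dotvZ (c h : V) (k : R) : dotv c (k *: h) = k * dotv c h.
Proof. by rewrite /dotv big_distrr/=; apply: eq_bigr => i _; rewrite mxE; ring. Qed.

Lemma dotvZl (c h : V) (k : R) : dotv (k *: c) h = k * dotv c h.
Proof. by rewrite /dotv big_distrr/=; apply: eq_bigr => i _; rewrite mxE; ring. Qed.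

Lemma dotvC (c h : V) : dotv c h = dotv h c.
Proof. by rewrite /dotv; apply: eq_bigr => i _; rewrite mulrC. Qed.

Lemma dotv_delta (c : V) i : dotv c (delta_mx ord0 i) = c ord0 i.
Proof.
rewrite /dotv (bigD1 i)//= mxE !eqxx mulr1 big1 ?addr0// => j ji.
by rewrite mxE eqxx (negbTE ji) mulr0.
Qed.

Lemma dotv_bound (c h : V) (C : R) : (forall i, `|c ord0 i| <= C) ->
  `|dotv c h| <= n.+1%:R * C * `|h|.
Proof.
move=> hC; rewrite /dotv; apply: le_trans (ler_norm_sum _ _ _) _.
have -> : n.+1%:R * C * `|h| = \sum_(i < n.+1) C * `|h|.
  by rewrite sumr_const card_ord -[RHS]mulr_natl mulrA.
by apply: ler_sum => i _; rewrite normrM ler_pM// rV_coord_le.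
Qed.

Lemma sqnorm_coord (h : V) i : (h ord0 i) ^+ 2 <= dotv h h.
Proof.
rewrite /dotv (bigD1 i)//= -expr2 lerDl; apply: sumr_ge0 => j _.
by rewrite -expr2 sqr_ge0.
Qed.

Lemma sqnorm_ge0 (h : V) : 0 <= dotv h h.
Proof. by apply: le_trans (sqnorm_coord h ord0); rewrite sqr_ge0. Qed.

Lemma norm_sqnorm (h : V) (r : R) : 0 <= r -> dotv h h <= r ^+ 2 -> `|h| <= r.
Proof.
move=> r0 hr; apply/rV_norm_leP => i; rewrite -[leRHS]ger0_norm// -ler_sqr ?nnegrE//.
by rewrite !real_normK ?num_real// (le_trans (sqnorm_coord h i)).
Qed.

Lemma dotv_norm (c h : V) : `|dotv c h| <= n.+1%:R * `|c| * `|h|.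
Proof. by apply: dotv_bound => i; exact: rV_coord_le. Qed.

(* [F] is bounded with bounded Lipschitz gradient [DF]; the bounds are uniform,
   which makes the class stable under convolution without differentiating under
   the integral sign. *)
Definition C11 F DF := exists C : R, 0 <= C /\ forall x,
  [/\ `|F x| <= C, forall i, `|DF x ord0 i| <= C &
   forall h, `|h| <= 1 -> `|F (x + h) - F x - dotv (DF x) h| <= C * `|h| ^+ 2 /\
     forall i, `|DF (x + h) ord0 i - DF x ord0 i| <= C * `|h|].

Lemma C11_differentiable F DF : C11 F DF ->
  forall x, differentiable F x /\ forall i, pderiv F i x = DF x ord0 i.
Proof.
move=> [C [C0 hC]] x.
pose df : V -> R := dotv (DF x).
have lf : linear df by move=> k u v; rewrite /df dotvD dotvZ.
pose dm := @GRing.isLinear.Build R V R^o _ df lf.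
pose dl : {linear V -> R^o} := HB.pack df dm.
have cdl : continuous dl.
  move=> y; rewrite /dl/= /df /dotv.
  apply: (@fcontinuous_sum R V _ _ (fun i (y : V) => DF x ord0 i * y ord0 i)) => i.
  by apply: fcontinuousM; [exact: fcontinuous_cst|exact: coord_continuous].
have E : F \o shift x = cst (F x) + dl +o_ (0 : V) id.
  apply/eqaddoP => e e0.
  have C10 : 0 < C + 1 by rewrite ltr_wpDl.
  have H : nbhs (0 : V) [set h : V | `|h| <= 1 /\ `|h| <= e / (C + 1)].
    have H1 : \forall h \near (0 : V), `|h| <= 1 by exact: nbhs0_le.
    have H2 : \forall h \near (0 : V), `|h| <= e / (C + 1) by apply: nbhs0_le; rewrite divr_gt0.
    exact: (filterI H1 H2).
  apply: (filterS _ H).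
  move=> h [h1 he].
  rewrite -[X in `|X|]/(F (h + x) - (F x + df h)).
  have [_ _ /(_ h h1) [hh _]] := hC x.
  rewrite opprD addrA [h + x]addrC; apply: le_trans hh _; rewrite /=.
  rewrite expr2 mulrA ler_wpM2r//.
  apply: (@le_trans _ _ ((C + 1) * `|h|)); first by rewrite ler_wpM2r// lerDl.
  by rewrite mulrC -ler_pdivlMr// ltr_wpDl.
have D := diff_unique cdl E.
have dF : differentiable F x by apply/diff_locallyP; rewrite D.
split=> // i; rewrite /pderiv deriveE// D /= /df; exact: dotv_delta.
Qed.

Lemma C11_continuous F DF : C11 F DF -> continuous F.
Proof. by move=> /C11_differentiable h x; apply: differentiable_continuous; have [] := h x. Qed.

Lemma C11_grad F DF x : C11 F DF -> grad F x = DF x.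
Proof. by move=> /C11_differentiable/(_ x)[_ h]; apply/rowP => i; rewrite mxE h. Qed.

Lemma C11_grad_continuous F DF i : C11 F DF -> continuous (fun x => DF x ord0 i).
Proof.
move=> [C [C0 hC]]; apply: (locally_lipschitz_continuous C0) => x y h1.
by have [_ _ /(_ _ h1)[_ /(_ i)]] := hC x; rewrite [x + _]addrC subrK.
Qed.

(** Since [F] is bounded, [h] needs its bounds only on bounded sets, so powers are allowed. The
    remainder of the composite is the remainder of [h] at [F x] plus [h' (F x)] times the remainder
    of [F]. *)
Lemma C11_comp (h h' : R -> R) F DF :
  (forall B, 0 <= B -> exists2 K, 0 <= K & forall s t, `|s| <= B -> `|t| <= B ->
     [/\ `|h t| <= K, `|h' t| <= K, `|h s - h t - h' t * (s - t)| <= K * (s - t) ^+ 2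
       & `|h' s - h' t| <= K * `|s - t|]) ->
  C11 F DF -> C11 (fun x => h (F x)) (fun x => h' (F x) *: DF x).
Proof.
move=> hh [C [C0 hC]]; have [K K0 hK] := hh C C0.
(* A Lipschitz constant of [F] for increments of norm at most 1: the gradient contributes [(n+1) C],
   the quadratic remainder [C]. *)
pose L := n.+1%:R * C + C.
have L0 : 0 <= L by rewrite addr_ge0// mulr_ge0.
have Lip x z : `|z| <= 1 -> `|F (x + z) - F x| <= L * `|z|.
  move=> z1; have [_ hD /(_ z z1)[h1 _]] := hC x.
  rewrite -(subrK (dotv (DF x) z) (F (x + z) - F x)).
  apply: le_trans (ler_normD _ _) _; rewrite /L mulrDl addrC lerD//.
    exact: dotv_bound.
  apply: le_trans h1 _; rewrite expr2 mulrA -[leRHS]mulr1 ler_wpM2l ?mulr_ge0//.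
exists (K + K * C + K * L ^+ 2 + (K * L * C + K * C)); split.
  by rewrite !addr_ge0// !mulr_ge0// exprn_ge0.
move=> x; have [F1 D1 hx] := hC x.
have [a1 a2 _ _] := hK _ _ F1 F1.
have P1 : 0 <= K * C by rewrite mulr_ge0.
have P2 : 0 <= K * L ^+ 2 by rewrite mulr_ge0// exprn_ge0.
have P3 : 0 <= K * L * C by rewrite !mulr_ge0.
split.
- by apply: le_trans a1 _; lra.
- move=> i; rewrite mxE normrM.
  have : `|h' (F x)| * `|DF x ord0 i| <= K * C by rewrite ler_pM.
  by move=> /le_trans; apply; lra.
move=> z z1; have [r1 r2] := hx z z1; have [Fz Dz _] := hC (x + z).
have [b1 b2 b3 b4] := hK _ _ Fz F1; have Lz := Lip x z z1.
have z2 : 0 <= `|z| ^+ 2 by rewrite exprn_ge0.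
split.
  rewrite dotvZl.
  rewrite (_ : _ - _ - _ = (h (F (x + z)) - h (F x) - h' (F x) * (F (x + z) - F x))
    + h' (F x) * (F (x + z) - F x - dotv (DF x) z)); last by ring.
  apply: le_trans (ler_normD _ _) _; rewrite normrM.
  have q1 : `|h' (F x)| * `|F (x + z) - F x - dotv (DF x) z| <= K * (C * `|z| ^+ 2).
    by rewrite ler_pM.
  have q2 : K * (F (x + z) - F x) ^+ 2 <= K * (L * `|z|) ^+ 2.
    rewrite ler_wpM2l// -real_normK ?num_real// lerXn2r ?nnegrE ?mulr_ge0//.
  apply: (le_trans (lerD (le_trans b3 q2) q1)).
  have -> : K * (L * `|z|) ^+ 2 + K * (C * `|z| ^+ 2) = (K * L ^+ 2 + K * C) * `|z| ^+ 2 by ring.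
  by rewrite ler_wpM2r//; lra.
move=> i; rewrite !mxE.
rewrite (_ : _ - _ = (h' (F (x + z)) - h' (F x)) * DF (x + z) ord0 i +
   h' (F x) * (DF (x + z) ord0 i - DF x ord0 i)); last by ring.
apply: le_trans (ler_normD _ _) _; rewrite !normrM.
have q1 : `|h' (F (x + z)) - h' (F x)| * `|DF (x + z) ord0 i| <= (K * (L * `|z|)) * C.
  by rewrite ler_pM// (le_trans b4)// ler_wpM2l.
have q2 : `|h' (F x)| * `|DF (x + z) ord0 i - DF x ord0 i| <= K * (C * `|z|).
  by rewrite ler_pM.
apply: (le_trans (lerD q1 q2)).
have -> : K * (L * `|z|) * C + K * (C * `|z|) = (K * L * C + K * C) * `|z| by ring.
by rewrite ler_wpM2r//; lra.
Qed.

End C11.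

(** * Powers of the positive part and the smoothing kernel *)

Section PositivePart.
Context {R : realType}.

Definition pospart (t : R) : R := Num.max 0 t.

Lemma pospart_ge0 t : 0 <= pospart t.
Proof. by rewrite /pospart le_max lexx. Qed.

Lemma pospartP (t : R) : t <= 0 /\ pospart t = 0 \/ 0 < t /\ pospart t = t.
Proof. by rewrite /pospart; case: (leP t 0) => h; [left|right]. Qed.

Lemma pospart_lip (s t : R) : `|pospart s - pospart t| <= `|s - t|.
Proof.
rewrite -[leRHS]ger0_norm// ler_norml ger0_norm//.
have h1 := ler_norm (s - t); have h2 := ler_norm (- (s - t)); rewrite normrN in h2.
have h3 := normr_ge0 (s - t).
have [[? ->]|[? ->]] := pospartP s; have [[? ->]|[? ->]] := pospartP t; apply/andP; split; lra.
Qed.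

Lemma pospart_le (t A : R) : 0 <= A -> `|t| <= A -> pospart t <= A.
Proof.
by move=> A0; rewrite ler_norml => /andP[? ?]; have [[? ->]|[? ->]] := pospartP t.
Qed.

Lemma pospart_sqr_remainder (s t : R) :
  `|pospart s ^+ 2 - pospart t ^+ 2 - 2 * pospart t * (s - t)| <= (s - t) ^+ 2.
Proof.
rewrite ler_norml; have hs := sqr_ge0 s; have ht := sqr_ge0 t; have hst := sqr_ge0 (s - t).
have E : (s - t) ^+ 2 = s ^+ 2 - 2 * (s * t) + t ^+ 2 by ring.
have [[s0 ->]|[s0 ->]] := pospartP s; have [[t0 ->]|[t0 ->]] := pospartP t.
- by rewrite !expr0n/= mulr0 mul0r !subr0 oppr_le0 hst.
- have h : s * t <= 0 by rewrite mulr_le0_ge0// ltW.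
  have -> : 0 ^+ 2 - t ^+ 2 - 2 * t * (s - t) = t ^+ 2 - 2 * (s * t) by ring.
  by apply/andP; split; lra.
- have h : s * t <= 0 by rewrite mulr_ge0_le0// ltW.
  by rewrite !expr0n/= mulr0 mul0r !subr0; apply/andP; split; lra.
- have -> : s ^+ 2 - t ^+ 2 - 2 * t * (s - t) = (s - t) ^+ 2 by ring.
  by apply/andP; split; lra.
Qed.

Lemma pospart_cube_remainder (A s t : R) : 0 <= A -> `|s| <= A -> `|t| <= A ->
  `|pospart s ^+ 3 - pospart t ^+ 3 - 3 * pospart t ^+ 2 * (s - t)| <= 3 * A * (s - t) ^+ 2.
Proof.
move=> A0; rewrite !ler_norml => /andP[s1 s2] /andP[t1 t2].
have d0 := sqr_ge0 (s - t).
have [[hs ->]|[hs ->]] := pospartP s; have [[ht ->]|[ht ->]] := pospartP t.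
- rewrite !expr0n /= mulr0 mul0r !subr0; apply/andP; split; nra.
- have q : 0 <= (A - t) * (s - t) ^+ 2 by rewrite mulr_ge0//; lra.
  have e1 : 0 <= t * (s ^+ 2) by rewrite mulr_ge0 ?sqr_ge0//; lra.
  have e2 : 0 <= t ^+ 2 * (- s) by rewrite mulr_ge0 ?sqr_ge0//; lra.
  have e3 : 0 <= t ^+ 3 by rewrite exprn_ge0//; lra.
  apply/andP; split; nra.
- have q : 0 <= (A - s) * (s - t) ^+ 2 by rewrite mulr_ge0//; lra.
  have e1 : 0 <= s * (t ^+ 2) by rewrite mulr_ge0 ?sqr_ge0//; lra.
  have e2 : 0 <= s ^+ 2 * (- t) by rewrite mulr_ge0 ?sqr_ge0//; lra.
  have e3 : 0 <= s ^+ 3 by rewrite exprn_ge0//; lra.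
  apply/andP; split; nra.
- have q : 0 <= (A - s) * (s - t) ^+ 2 by rewrite mulr_ge0//; lra.
  have q' : 0 <= (A - t) * (s - t) ^+ 2 by rewrite mulr_ge0//; lra.
  have q2 : 0 <= s * (s - t) ^+ 2 by rewrite mulr_ge0//; lra.
  have q3 : 0 <= t * (s - t) ^+ 2 by rewrite mulr_ge0//; lra.
  have -> : s ^+ 3 - t ^+ 3 - 3 * t ^+ 2 * (s - t) = s * (s - t) ^+ 2 + 2 * (t * (s - t) ^+ 2) by ring.
  have E1 : (A - s) * (s - t) ^+ 2 = A * (s - t) ^+ 2 - s * (s - t) ^+ 2 by ring.
  have E2 : (A - t) * (s - t) ^+ 2 = A * (s - t) ^+ 2 - t * (s - t) ^+ 2 by ring.
  apply/andP; split; lra.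
Qed.

Let shift_bound (k B t : R) : `|t| <= B -> `|t - k| <= B + `|k|.
Proof. by move=> h; apply: le_trans (ler_normB _ _) _; rewrite lerD2r. Qed.

(** Phrased as the hypothesis of [C11_comp]. The square enters the Poincare and Faber-Krahn
    inequalities; the cube, treated next, gives the test function. *)
Lemma pospart_sqr_C11 (k B : R) : 0 <= B -> exists2 K, 0 <= K & forall s t, `|s| <= B -> `|t| <= B ->
     [/\ `|pospart (t - k) ^+ 2| <= K, `|2 * pospart (t - k)| <= K,
       `|pospart (s - k) ^+ 2 - pospart (t - k) ^+ 2 - 2 * pospart (t - k) * (s - t)| <= K * (s - t) ^+ 2
       & `|2 * pospart (s - k) - 2 * pospart (t - k)| <= K * `|s - t|].
Proof.
move=> B0; pose A := B + `|k|.
have A0 : 0 <= A by rewrite addr_ge0.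
exists (A ^+ 2 + 2 * A + 2); first by rewrite !addr_ge0 ?exprn_ge0 ?mulr_ge0.
move=> s t /(shift_bound k) hs /(shift_bound k) ht.
have p0 := pospart_ge0 (t - k); have pA := pospart_le A0 ht.
have A20 : 0 <= A ^+ 2 by rewrite exprn_ge0.
have p2 : pospart (t - k) ^+ 2 <= A ^+ 2 by rewrite lerXn2r ?nnegrE.
have E : s - t = (s - k) - (t - k) by ring.
split.
- by rewrite ger0_norm ?exprn_ge0//; lra.
- by rewrite ger0_norm ?mulr_ge0//; lra.
- rewrite E; apply: le_trans (pospart_sqr_remainder _ _) _.
  by rewrite ler_peMl ?sqr_ge0//; lra.
- rewrite -mulrBr normrM ger0_norm// E; apply: ler_pM => //; last exact: pospart_lip.
  lra.
Qed.

Lemma pospart_cube_C11 (k B : R) : 0 <= B -> exists2 K, 0 <= K & forall s t, `|s| <= B -> `|t| <= B ->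
     [/\ `|pospart (t - k) ^+ 3| <= K, `|3 * pospart (t - k) ^+ 2| <= K,
       `|pospart (s - k) ^+ 3 - pospart (t - k) ^+ 3 - 3 * pospart (t - k) ^+ 2 * (s - t)| <= K * (s - t) ^+ 2
       & `|3 * pospart (s - k) ^+ 2 - 3 * pospart (t - k) ^+ 2| <= K * `|s - t|].
Proof.
move=> B0; pose A := B + `|k|.
have A0 : 0 <= A by rewrite addr_ge0.
have A20 : 0 <= A ^+ 2 by rewrite exprn_ge0.
have A30 : 0 <= A ^+ 3 by rewrite exprn_ge0.
exists (A ^+ 3 + 3 * A ^+ 2 + 6 * A); first by rewrite !addr_ge0 ?mulr_ge0.
move=> s t /(shift_bound k) hs /(shift_bound k) ht.
have p0 := pospart_ge0 (t - k); have pA := pospart_le A0 ht.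
have q0 := pospart_ge0 (s - k); have qA := pospart_le A0 hs.
have p2 : pospart (t - k) ^+ 2 <= A ^+ 2 by rewrite lerXn2r ?nnegrE.
have p3 : pospart (t - k) ^+ 3 <= A ^+ 3 by rewrite lerXn2r ?nnegrE.
have E : s - t = (s - k) - (t - k) by ring.
split.
- by rewrite ger0_norm ?exprn_ge0//; lra.
- by rewrite ger0_norm ?mulr_ge0 ?exprn_ge0//; lra.
- rewrite E; apply: le_trans (pospart_cube_remainder A0 hs ht) _.
  by rewrite ler_wpM2r ?sqr_ge0//; lra.
- set a := pospart (s - k); set b := pospart (t - k).
  have -> : 3 * a ^+ 2 - 3 * b ^+ 2 = (3 * (a + b)) * (a - b) by ring.
  rewrite normrM E; apply: ler_pM => //; last exact: pospart_lip.
  by rewrite ger0_norm ?mulr_ge0 ?addr_ge0// /a /b; lra.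
Qed.

End PositivePart.

Section Kernel.
Context {R : realType} {n : nat}.
Local Notation V := 'rV[R]_n.+1.

(** An unnormalised kernel whose support lies in the Euclidean ball of radius [e], hence in the box
    of that radius, as [|v|] is the maximum norm. A squared positive part is just smooth enough for
    [C11]; [Dbump] is its gradient. *)
Definition bump (e : R) (v : V) : R := pospart (e ^+ 2 - dotv v v) ^+ 2.
Definition Dbump (e : R) (v : V) : V := (-4 * pospart (e ^+ 2 - dotv v v)) *: v.

Lemma bump_ge0 e v : 0 <= bump e v.
Proof. by rewrite exprn_ge0// pospart_ge0. Qed.

Lemma bumpN e v : bump e (- v) = bump e v.
Proof.
rewrite /bump (_ : dotv (- v) (- v) = dotv v v)// /dotv.
by apply: eq_bigr => i _; rewrite !mxE mulrNN.
Qed.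

Lemma DbumpN e v : Dbump e (- v) = - Dbump e v.
Proof.
rewrite /Dbump (_ : dotv (- v) (- v) = dotv v v) ?scalerN// /dotv.
by apply: eq_bigr => i _; rewrite !mxE mulrNN.
Qed.

Lemma pospart_bump0 (e : R) (v : V) : 0 <= e -> e < `|v| -> pospart (e ^+ 2 - dotv v v) = 0.
Proof.
move=> e0 ev; have [[_ ->]//|[h _]] := pospartP (e ^+ 2 - dotv v v).
have hv : dotv v v <= e ^+ 2 by rewrite -subr_ge0 ltW.
by have := norm_sqnorm e0 hv; rewrite leNgt ev.
Qed.

Lemma bump0 (e : R) (v : V) : 0 <= e -> e < `|v| -> bump e v = 0.
Proof. by move=> e0 ev; rewrite /bump pospart_bump0// expr0n. Qed.

Lemma Dbump0 (e : R) (v : V) : 0 <= e -> e < `|v| -> Dbump e v = 0.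
Proof. by move=> e0 ev; rewrite /Dbump pospart_bump0// mulr0 scale0r. Qed.

Lemma pospart_bump_le (e : R) (v : V) : 0 <= e <= 1 -> pospart (e ^+ 2 - dotv v v) <= 1.
Proof.
move=> /andP[e0 e1]; have := sqnorm_ge0 v; have : e ^+ 2 <= 1 by rewrite exprn_ile1.
by have [[? ->]|[? ->]] := pospartP (e ^+ 2 - dotv v v); lra.
Qed.

Lemma bump_le1 (e : R) (v : V) : 0 <= e <= 1 -> bump e v <= 1.
Proof. by move=> e01; rewrite /bump exprn_ile1 ?pospart_ge0// pospart_bump_le. Qed.

Lemma bump_C11 (e : R) : 0 < e <= 1 -> C11 (bump e) (Dbump e).
Proof.
move=> /andP[e0 e1]; have e01 : 0 <= e <= 1 by rewrite ltW.
pose N : R := n.+1%:R.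
have N1 : 1 <= N by rewrite ler1n.
have N12 : N <= N ^+ 2 by rewrite expr2 ler_peMl//; lra.
(* A generous constant: the estimates below give at most [27 N^2] for the remainder and [44 N^2] for
   the increment of the gradient. *)
exists (100 * N ^+ 2); split; first by rewrite mulr_ge0// exprn_ge0//; lra.
have grad_small x i : `|Dbump e x ord0 i| <= 4.
  case: (leP `|x| e) => xe; last by rewrite Dbump0 ?ltW// mxE normr0.
  rewrite mxE normrM normrM normrN (ger0_norm (ler0n _ 4)) (ger0_norm (pospart_ge0 _)).
  have := pospart_bump_le x e01; have := pospart_ge0 (e ^+ 2 - dotv x x).
  have := rV_coord_le x i; have := normr_ge0 (x ord0 i).
  move=> a1 a2 a3 a4; rewrite -mulrA -[leRHS]mulr1 ler_wpM2l//.
  rewrite -[leRHS]mulr1 ler_pM//; lra.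
move=> x; split.
- rewrite ger0_norm ?bump_ge0//; have := bump_le1 x e01; lra.
- by move=> i; apply: le_trans (grad_small x i) _; lra.
move=> h h1.
have hh0 : 0 <= `|h| ^+ 2 by rewrite exprn_ge0.
have h20 : `|h| ^+ 2 <= `|h| by rewrite expr2 ler_piMl.
have Nh : 0 <= N ^+ 2 * `|h| by rewrite mulr_ge0// exprn_ge0//; lra.
have Nhh : 0 <= N ^+ 2 * `|h| ^+ 2 by rewrite mulr_ge0// exprn_ge0//; lra.
(* If [2 < |x|], both [x] and [x + h] lie outside the support, since [e] and [|h|] are at most 1.
   Otherwise [|x| <= 2] bounds the change of the squared norm linearly in [|h|]. *)
case: (leP `|x| 2) => x2; last first.
  have ex : e < `|x| by lra.
  have exh : e < `|x + h|.
    have : `|x| <= `|x + h| + `|h| by rewrite -{1}(addrK h x) ler_normB.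
    lra.
  have z : dotv (0 : V) h = 0 by rewrite /dotv big1// => i _; rewrite mxE mul0r.
  have e0' := ltW e0.
  rewrite (bump0 e0' ex) (bump0 e0' exh) (Dbump0 e0' ex) (Dbump0 e0' exh) z.
  split; first by rewrite !subr0 normr0 -mulrA mulr_ge0.
  by move=> i; rewrite mxE subr0 normr0 -mulrA mulr_ge0.
pose a := dotv x h; pose b := dotv h h.
have ab : e ^+ 2 - dotv (x + h) (x + h) = e ^+ 2 - dotv x x - 2 * a - b.
  by rewrite dotvD !dotvDl (dotvC h x) /a /b; ring.
have a_le : `|a| <= 2 * (N * `|h|).
  apply: le_trans (dotv_norm x h) _; rewrite -/N mulrAC mulrC ler_wpM2r//.
  by rewrite mulr_ge0//; lra.
have b_le : `|b| <= N * `|h| ^+ 2 by apply: le_trans (dotv_norm h h) _; rewrite -mulrA -expr2.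
have b0 : 0 <= b by exact: sqnorm_ge0.
rewrite ger0_norm// in b_le.
have Nhh1 : N * `|h| ^+ 2 <= N * `|h| by rewrite ler_wpM2l//; lra.
have d_le : `|- 2 * a - b| <= 5 * (N * `|h|).
  move: a_le; rewrite !ler_norml => /andP[? ?]; apply/andP; split; lra.
have d2_le : (- 2 * a - b) ^+ 2 <= 25 * (N ^+ 2 * `|h| ^+ 2).
  rewrite -real_normK ?num_real//.
  have -> : 25 * (N ^+ 2 * `|h| ^+ 2) = (5 * (N * `|h|)) ^+ 2 by ring.
  by rewrite lerXn2r ?nnegrE// (le_trans _ d_le).
have p0 := pospart_ge0 (e ^+ 2 - dotv x x).
have p1 := pospart_bump_le x e01.
have q0 := pospart_ge0 (e ^+ 2 - dotv (x + h) (x + h)).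
have q1 := pospart_bump_le (x + h) e01.
have NN : N * `|h| ^+ 2 <= N ^+ 2 * `|h| ^+ 2 by rewrite ler_wpM2r.
have Nh1 : N * `|h| <= N ^+ 2 * `|h| by rewrite ler_wpM2r.
have h0 : `|h| <= N * `|h| by rewrite ler_peMl.
set s := e ^+ 2 - dotv x x in p0 p1 ab *.
set s' := e ^+ 2 - dotv (x + h) (x + h) in q0 q1 ab *.
have ds : s' - s = - 2 * a - b by rewrite ab; ring.
split.
  rewrite /bump /Dbump -/s -/s' dotvZl -/a.
  have -> : pospart s' ^+ 2 - pospart s ^+ 2 - -4 * pospart s * a =
    (pospart s' ^+ 2 - pospart s ^+ 2 - 2 * pospart s * (s' - s)) - 2 * (pospart s * b).
    by rewrite ds; ring.
  apply: le_trans (ler_normB _ _) _.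
  have r1 := pospart_sqr_remainder s' s; rewrite ds in r1.
  have r2 : `|2 * (pospart s * b)| <= 2 * (N * `|h| ^+ 2).
    rewrite ger0_norm ?mulr_ge0// ler_wpM2l// -[leRHS]mul1r ler_pM//.
  rewrite ds; apply: (le_trans (lerD (le_trans r1 d2_le) r2)); lra.
move=> i; rewrite /Dbump !mxE -/s -/s'.
have -> : -4 * pospart s' * (x ord0 i + h ord0 i) - -4 * pospart s * x ord0 i =
  - (4 * ((pospart s' - pospart s) * x ord0 i + pospart s' * h ord0 i)) by ring.
rewrite normrN normrM ger0_norm//.
have xi : `|x ord0 i| <= 2 by apply: le_trans (rV_coord_le x i) _.
have r1 : `|(pospart s' - pospart s) * x ord0 i| <= 5 * (N * `|h|) * 2.
  by rewrite normrM ler_pM// (le_trans (pospart_lip _ _))// ds.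
have r2 : `|pospart s' * h ord0 i| <= 1 * `|h|.
  by rewrite normrM ler_pM// ?rV_coord_le// ger0_norm.
have := ler_normD ((pospart s' - pospart s) * x ord0 i) (pospart s' * h ord0 i).
rewrite -mulrA; lra.
Qed.

End Kernel.

(** * Convolution and mollification *)

Section BoundedSupport.
Context {R : realType} {d} {T : measurableType d} {n : nat}.
Local Notation V := 'rV[R]_n.+1.
Variables (mu : {measure set T -> \bar R}) (phi : T -> V).
Hypothesis mphi : forall i, measurable_fun setT (fun x => phi x ord0 i).
Hypothesis box_fin : forall r : R, (mu (box phi r) < +oo)%E.

Definition bounded_support (M r : R) (W : T -> R) :=
  [/\ measurable_fun setT W, forall x, `|W x| <= M & forall x, r < `|phi x| -> W x = 0].

Definition vol (r : R) : R := fine (mu (box phi r)).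

Lemma vol_ge0 r : 0 <= vol r.
Proof. exact: fine_ge0. Qed.

Lemma volE r : mu (box phi r) = (vol r)%:E.
Proof. by rewrite /vol fineK// ge0_fin_numE. Qed.

Lemma integral_box (F : T -> \bar R) r : (forall x, r < `|phi x| -> F x = 0%E) ->
  (\int[mu]_x F x = \int[mu]_(x in box phi r) F x)%E.
Proof.
move=> F0; rewrite [RHS]integral_mkcond; apply: eq_integral => x _.
rewrite patchE; case: ifPn => // /negP xr; apply: F0.
by rewrite ltNge; apply/negP => h; apply: xr; apply/mem_set.
Qed.

Lemma bounded_support_integrable M r W : bounded_support M r W ->
  mu.-integrable setT (fun x => (W x)%:E).
Proof.
move=> [mW WM W0]; have mb := measurable_phibox mphi r.
have : mu.-integrable (box phi r) (fun x => (W x)%:E).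
  apply: measurable_bounded_integrable => //; first exact: measurable_funTS.
  exists M; split; first exact: num_real.
  by move=> y My x _; apply: le_trans (WM x) (ltW My).
move=> h; have := (integrable_mkcond (fun x => (W x)%:E) mb).1 h.
congr (mu.-integrable _ _); apply/funext => x; rewrite patchE; case: ifPn => // /negP xr.
by rewrite W0// ltNge; apply/negP => hx; apply: xr; apply/mem_set.
Qed.

Lemma bounded_support_int_le M r (W : T -> R) : 0 <= M -> bounded_support M r W ->
  `|\int[mu]_x W x| <= M * vol r.
Proof.
move=> M0 hW; have [mW WM W0] := hW; have mb := measurable_phibox mphi r.
apply: le_trans (le_normr_Rintegral measurableT (bounded_support_integrable hW)) _.
rewrite -lee_fin /Rintegral fineK; last first.
  have /integrable_abse/integrable_fin_num := bounded_support_integrable hW; exact.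
rewrite (@integral_box _ r); last by move=> x /W0 ->; rewrite normr0.
apply: (@le_trans _ _ (\int[mu]_(x in box phi r) M%:E)%E).
  apply: ge0_le_integral => //.
  - by apply/measurable_EFinP/measurableT_comp => //; exact: measurable_funTS.
  - by move=> x _; rewrite lee_fin.
by rewrite integral_cst//= volE.
Qed.

Lemma bounded_supportM (M r K : R) (W k : T -> R) : bounded_support M r W -> 0 <= K ->
  measurable_fun setT k -> (forall x, `|k x| <= K) -> bounded_support (K * M) r (fun x => k x * W x).
Proof.
move=> [mW WM W0] K0 mk kK; split; first exact: measurable_funM.
- by move=> x; rewrite normrM ler_pM.
- by move=> x /W0 ->; rewrite mulr0.
Qed.

Lemma Rintegral_sum_ord m (F : 'I_m -> T -> R) :
  (forall i, mu.-integrable setT (fun x => (F i x)%:E)) ->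
  \int[mu]_x (\sum_(i < m) F i x) = \sum_(i < m) \int[mu]_x F i x.
Proof.
move=> iF; rewrite /Rintegral.
under eq_integral => x _ do rewrite -sumEFin.
rewrite integral_sum//.
rewrite sum_fine// => i _; exact: integrable_fin_num.
Qed.

Definition conv (K : V -> R) (W : T -> R) (x : V) : R := \int[mu]_y (K (x - phi y) * W y).

Lemma conv_kernel_support M r (K : V -> R) (C : R) W x : continuous K ->
  (forall v, `|K v| <= C) -> bounded_support M r W ->
  bounded_support (C * M) r (fun y => K (x - phi y) * W y).
Proof.
move=> cK KC hW; apply: bounded_supportM => //.
  exact: le_trans (normr_ge0 _) (KC 0).
apply: (measurable_continuous_comp measurableT cK) => i.
under eq_fun do rewrite !mxE.
by apply: measurable_funB.
Qed.

Lemma conv_C11 M r (K : V -> R) (DK : V -> V) W : 0 <= M -> C11 K DK ->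
  bounded_support M r W ->
  C11 (conv K W) (fun x => \row_i conv (fun v => DK v ord0 i) W x).
Proof.
move=> M0 cK hW; have [C [C0 hC]] := cK.
have cK0 := C11_continuous cK; have cDK i := @C11_grad_continuous _ _ _ _ i cK.
have KC v : `|K v| <= C by have [] := hC v.
have DKC v i : `|DK v ord0 i| <= C by have [_ ->] := hC v.
have sK x := conv_kernel_support x cK0 KC hW.
have sD x i := conv_kernel_support x (cDK i) (DKC ^~ i) hW.
have CM0 : 0 <= C * M * vol r by rewrite !mulr_ge0// vol_ge0.
have CM : 0 <= C * M by rewrite mulr_ge0.
exists (C * M * vol r); split => // x; split.
- exact: (bounded_support_int_le CM (sK x)).
- by move=> i; rewrite mxE; exact: (bounded_support_int_le CM (sD x i)).
move=> h h1.
have [h2 h3] : 0 <= C * `|h| ^+ 2 /\ 0 <= C * `|h| by rewrite !mulr_ge0// exprn_ge0.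
split; last first.
  move=> i; rewrite !mxE /conv -RintegralB//; [|exact: bounded_support_integrable (sD _ i)..].
  rewrite (_ : C * M * vol r * `|h| = C * `|h| * M * vol r); last by ring.
  apply: bounded_support_int_le; first by rewrite mulr_ge0.
  have [_ _ W0] := hW; split.
  - by apply: measurable_funB; [have [] := sD (x + h) i|have [] := sD x i].
  - move=> y; rewrite -mulrBl normrM ler_pM//; last by have [_ ->] := hW.
    have [_ _ /(_ _ h1)[_ /(_ i)]] := hC (x - phi y).
    by rewrite addrAC.
  - by move=> y /W0 ->; rewrite !mulr0 subrr.
rewrite (_ : dotv _ h = \int[mu]_y (dotv (DK (x - phi y)) h * W y)); last first.
  rewrite /dotv.
  under [RHS]eq_Rintegral => y _ do rewrite mulr_suml.
  rewrite Rintegral_sum_ord => [|i].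
    apply: eq_bigr => i _; rewrite mxE -RintegralZr//.
      by apply: eq_Rintegral => y _; rewrite mulrAC.
    exact: bounded_support_integrable (sD x i).
  have := integrableZr measurableT (h ord0 i) (bounded_support_integrable (sD x i)).
  by congr (mu.-integrable _ _); apply/funext => y /=; rewrite -EFinM mulrAC.
have sd : bounded_support (n.+1%:R * C * `|h| * M) r (fun y => dotv (DK (x - phi y)) h * W y).
  apply: bounded_supportM => //.
  - by rewrite !mulr_ge0.
  - have cDh : continuous (fun v => dotv (DK v) h).
      apply: fcontinuous_sum => i; apply: fcontinuousM; first exact: cDK.
      exact: fcontinuous_cst.
    apply: (measurable_continuous_comp measurableT cDh) => i.
    by under eq_fun do rewrite !mxE; apply: measurable_funB.
  - by move=> y; apply: dotv_bound => i; exact: DKC.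
rewrite /conv -RintegralB//; [|exact: bounded_support_integrable (sK _)..].
have sB : bounded_support (C * M + C * M) r (fun y => K (x + h - phi y) * W y - K (x - phi y) * W y).
  have [m1 b1 z1] := sK (x + h); have [m2 b2 z2] := sK x.
  split; first exact: measurable_funB.
    by move=> y; apply: le_trans (ler_normB _ _) _; rewrite lerD.
  by move=> y yr; rewrite z1// z2// subrr.
rewrite -RintegralB//; [|exact: bounded_support_integrable sB|exact: bounded_support_integrable sd].
rewrite (_ : C * M * vol r * `|h| ^+ 2 = C * `|h| ^+ 2 * M * vol r); last by ring.
apply: bounded_support_int_le; first by rewrite mulr_ge0.
have [_ _ W0] := hW; split.
- by apply: measurable_funB; [have [] := sB|have [] := sd].
- move=> y; rewrite -!mulrBl normrM ler_pM//; last by have [_ ->] := hW.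
  have [_ _ /(_ _ h1)[+ _]] := hC (x - phi y).
  by rewrite (addrAC x (- phi y) h).
- by move=> y /W0 ->; rewrite !mulr0 !subr0.
Qed.

End BoundedSupport.

(** Only [x] is confined to the compact set; [y] may leave it, as happens when the kernel is centred
    near the edge of a box. *)
Lemma compact_uniform_continuity {R : realType} {M : normedModType R} (A : set M)
    (G : M -> R) (w : R) : compact A -> continuous G -> 0 < w ->
  exists2 e0 : R, 0 < e0 & forall x y, A x -> `|y - x| <= e0 -> `|G y - G x| <= w.
Proof.
move=> cA cG w0.
have w20 : 0 < w / 2 by rewrite divr_gt0.
have cov : near_covering A by exact/compact_near_coveringP.
pose P (e : R) (x : M) := forall y, `|y - x| <= e -> `|G y - G x| <= w.
have H : \forall e \near (0 : R)^'+, A `<=` P e.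
  apply: cov => x Ax.
  have [t /= t0 ht] : exists2 t : R, 0 < t & forall y, `|y - x| <= t -> `|G x - G y| <= w / 2.
    have /cvgrPdist_le/(_ _ w20) := cG x.
    rewrite -nbhs_nearE => /nbhs_normP[t /= t0 ht].
    exists (t / 2); first by rewrite divr_gt0.
    move=> y hy; apply: ht => /=; by rewrite distrC (le_lt_trans hy)// ltr_pdivrMr// ltr_pMr// ltr1n.
  have t20 : 0 < t / 2 by rewrite divr_gt0.
  near=> x' e => y hy.
  have hx' : `|x' - x| <= t / 2 by near: x'; exact: near_dist_le.
  have he : e <= t / 2 by near: e; exact: nbhs_right_le.
  rewrite -(subrK (G x) (G y)) -addrA; apply: le_trans (ler_normD _ _) _.
  rewrite (splitr w) lerD//.
    rewrite distrC; apply: ht.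
    rewrite -(subrK x' y) -addrA (splitr t); apply: le_trans (ler_normD _ _) _.
    by rewrite lerD// (le_trans hy).
  by apply: ht; apply: le_trans hx' _; rewrite ler_pdivrMr// ler_pMr// ler1n.
near (0 : R)^'+ => e; exists e; first by near: e; exact: nbhs_right_gt.
have : A `<=` P e by near: e.
by move=> AP x y /AP; exact.
Unshelve. all: by end_near. Qed.

Section Mollification.
Context {R : realType} {d} {T : measurableType d} {n : nat}.
Local Notation V := 'rV[R]_n.+1.
Variables (mu : {sigma_finite_measure set T -> \bar R}) (phi : T -> V).
Hypothesis mphi : forall i, measurable_fun setT (fun x => phi x ord0 i).
Hypothesis box_fin : forall r : R, (mu (box phi r) < +oo)%E.
Hypothesis box_pos : forall r : R, 0 < r -> (0 < mu (box phi r))%E.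
Hypothesis trans : forall (h : V) (G : V -> R), continuous G -> (forall v, 0 <= G v) ->
  (\int[mu]_x (G (phi x + h))%:E = \int[mu]_x (G (phi x))%:E)%E.

Lemma measurable_phiB (G : V -> R) : continuous G ->
  measurable_fun setT (fun z : T * T => G (phi z.1 - phi z.2)).
Proof.
move=> cG; apply: (measurable_continuous_comp measurableT cG) => i.
under eq_fun do rewrite !mxE.
apply: measurable_funB.
  exact: (measurableT_comp (mphi i) measurable_fst).
exact: (measurableT_comp (mphi i) measurable_snd).
Qed.

Lemma measurable_phiD (G : V -> R) : continuous G ->
  measurable_fun setT (fun z : T * T => G (phi z.1 + phi z.2)).
Proof.
move=> cG; apply: (measurable_continuous_comp measurableT cG) => i.
under eq_fun do rewrite !mxE.
apply: measurable_funD.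
  exact: (measurableT_comp (mphi i) measurable_fst).
exact: (measurableT_comp (mphi i) measurable_snd).
Qed.

Definition kmass (e : R) : R := \int[mu]_y bump e (phi y).

Section Fixed_radius.
Variables (e : R) (e01 : 0 < e <= 1).
Let cb : C11 (@bump R n e) (Dbump e) := bump_C11 e01.
Let cbump : continuous (@bump R n e) := C11_continuous cb.
Let e0 : 0 <= e. Proof. by case/andP: e01 => /ltW. Qed.
Let e01' : 0 <= e <= 1. Proof. by case/andP: e01 => _ ->; rewrite e0. Qed.

Lemma measurable_bump : measurable_fun setT (fun y => bump e (phi y)).
Proof. exact: (measurable_continuous_comp measurableT cbump). Qed.

Lemma bump_support : bounded_support phi 1 e (fun y => bump e (phi y)).
Proof.
split; first exact: measurable_bump.
  by move=> y; rewrite ger0_norm ?bump_ge0// bump_le1.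
by move=> y; exact: bump0.
Qed.

Lemma kmassE : (\int[mu]_y (bump e (phi y))%:E = (kmass e)%:E)%E.
Proof.
rewrite /kmass /Rintegral fineK//; apply: integrable_fin_num => //.
exact: (bounded_support_integrable mphi box_fin bump_support).
Qed.

Lemma kmass_left v : (\int[mu]_y (bump e (v - phi y))%:E = (kmass e)%:E)%E.
Proof.
rewrite -kmassE -(trans (- v) cbump (bump_ge0 e)); apply: eq_integral => y _.
by rewrite -bumpN opprB.
Qed.

Lemma kmass_right v : (\int[mu]_y (bump e (phi y - v))%:E = (kmass e)%:E)%E.
Proof. by rewrite -kmassE -(trans (- v) cbump (bump_ge0 e)). Qed.

Lemma kmass_gt0 : 0 < kmass e.
Proof.
have [e_gt0 e1] := andP e01.
pose N : R := n.+1%:R.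
have N1 : 1 <= N by rewrite ler1n.
(* On the box of radius [t] the squared Euclidean norm is at most [N t^2 <= e^2 / 2], so the kernel
   is at least [(e^2 / 2)^2] there. *)
pose t := e / (2 * N).
have t0 : 0 < t by rewrite divr_gt0// mulr_gt0//; lra.
have ht x : box phi t x -> (e ^+ 2 / 2) ^+ 2 <= bump e (phi x).
  move=> /= hx; rewrite /bump lerXn2r ?nnegrE ?pospart_ge0 ?divr_ge0 ?exprn_ge0//.
  have h1 : dotv (phi x) (phi x) <= e ^+ 2 / 2.
    apply: le_trans (ler_norm _) _; apply: le_trans (dotv_norm _ _) _.
    rewrite -/N -mulrA -expr2.
    have : `|phi x| ^+ 2 <= t ^+ 2 by rewrite lerXn2r ?nnegrE// ltW.
    move=> h; apply: (@le_trans _ _ (N * t ^+ 2)); first by rewrite ler_wpM2l//; lra.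
    rewrite /t (_ : N * _ = e ^+ 2 / 2 * (1 / (2 * N))); last by field; lra.
    rewrite ler_piMr ?divr_ge0 ?exprn_ge0// ler_pdivrMr ?mulr_gt0//; lra.
  have [[? _]|[? ->]] := pospartP (e ^+ 2 - dotv (phi x) (phi x)); last lra.
  have : 0 < e ^+ 2 by rewrite exprn_gt0.
  lra.
rewrite -lte_fin -kmassE.
have mb := measurable_phibox mphi t.
apply: (@lt_le_trans _ _ (\int[mu]_(x in box phi t) ((e ^+ 2 / 2) ^+ 2)%:E)%E).
  by rewrite integral_cst//= mule_gt0 ?box_pos// lte_fin exprn_gt0// divr_gt0// exprn_gt0.
apply: (@le_trans _ _ (\int[mu]_(x in box phi t) (bump e (phi x))%:E)%E).
  apply: ge0_le_integral => //.
  - by move=> x _; rewrite lee_fin exprn_ge0// divr_ge0// exprn_ge0.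
  - by apply/measurable_EFinP/measurable_funTS/measurable_bump.
apply: ge0_subset_integral => //; first by apply/measurable_EFinP/measurable_bump.
by move=> x _; rewrite lee_fin bump_ge0.
Qed.

Definition mollify (W : T -> R) (v : V) : R := conv mu phi (bump e) W v / kmass e.

(** [mollify W v - c] is a weighted mean of [W - c]. With [c] a value of [W] this estimates the
    error of the mollification, with [c = 0] its size. *)
Lemma mollify_dist_le M r W v c : bounded_support phi M r W ->
  ((`|mollify W v - c|)%:E <=
   ((kmass e)^-1)%:E * \int[mu]_y (bump e (v - phi y) * `|W y - c|)%:E)%E.
Proof.
move=> hW; have k0 := kmass_gt0.
have bv : mu.-integrable setT (fun y => (bump e (v - phi y))%:E).
  have hb : measurable_fun setT (fun y => bump e (v - phi y)).
    apply: (measurable_continuous_comp measurableT cbump) => i.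
    by under eq_fun do rewrite !mxE; apply: measurable_funB.
  apply/integrableP; split; first exact/measurable_EFinP.
  under eq_integral => y _ do rewrite gee0_abs ?lee_fin ?bump_ge0//.
  by rewrite kmass_left ltry.
have bW : mu.-integrable setT (fun y => (bump e (v - phi y) * W y)%:E).
  have b1 (u : V) : `|bump e u| <= 1 by rewrite ger0_norm ?bump_ge0// bump_le1.
  exact: (bounded_support_integrable mphi box_fin (conv_kernel_support mphi v cbump b1 hW)).
have bc : mu.-integrable setT (fun y => (bump e (v - phi y) * c)%:E).
  have := integrableZr measurableT c bv.
  by congr (mu.-integrable _ _); apply/funext => y.
have -> : mollify W v - c = (kmass e)^-1 * \int[mu]_y (bump e (v - phi y) * (W y - c)).
  under eq_Rintegral => y _ do rewrite mulrBr.
  rewrite RintegralB// RintegralZr// [X in _ - X * c](_ : _ = kmass e).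
    by rewrite /mollify /conv; field; rewrite gt_eqF.
  by apply: EFin_inj; rewrite /Rintegral fineK ?kmass_left.
have bWc : mu.-integrable setT (fun y => (bump e (v - phi y) * (W y - c))%:E).
  have := integrableB measurableT bW bc.
  by congr (mu.-integrable _ _); apply/funext => y /=; rewrite -EFinB mulrBr.
have ki : 0 <= (kmass e)^-1 by rewrite invr_ge0 ltW.
rewrite normrM (ger0_norm ki) EFinM; apply: lee_wpmul2l; first by rewrite lee_fin.
rewrite EFin_normr_Rintegral//.
apply: le_trans (le_abse_integral _ measurableT (measurable_int _ bWc)) _.
rewrite le_eqVlt; apply/orP; left; apply/eqP; apply: eq_integral => y _.
by rewrite /= normrM ger0_norm ?bump_ge0.
Qed.

End Fixed_radius.

Lemma box_compact (r : R) : compact [set v : V | `|v| <= r].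
Proof.
have := @rV_compact R n.+1 (fun=> `[- r, r]%classic) (fun=> @segment_compact R (- r) r).
congr compact; apply/seteqP; split => v /=.
  by move=> h; apply/rV_norm_leP => i; have := h i; rewrite in_itv/= -ler_norml.
by move=> /rV_norm_leP h i; rewrite in_itv/= -ler_norml.
Qed.

(** Tonelli, followed by translation invariance in the first variable, where the kernel has total
    mass [kmass e]. *)
Lemma integral_bump_conv (e : R) (H : T -> R) : 0 < e <= 1 -> measurable_fun setT H ->
  (forall y, 0 <= H y) ->
  measurable_fun setT (fun x => \int[mu]_y (bump e (phi x - phi y) * H y)%:E)%E /\
  (\int[mu]_x \int[mu]_y (bump e (phi x - phi y) * H y)%:E =
   (kmass e)%:E * \int[mu]_y (H y)%:E)%E.
Proof.
move=> e01 mH H0; have cbump := C11_continuous (@bump_C11 R n e e01).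
pose f (z : T * T) := (bump e (phi z.1 - phi z.2) * H z.2)%:E.
have mf : measurable_fun setT f.
  apply/measurable_EFinP/measurable_funM; first exact: measurable_phiB.
  exact: (measurableT_comp mH measurable_snd).
have f0 z : (0 <= f z)%E by rewrite lee_fin mulr_ge0// bump_ge0.
split; first exact: (@measurable_fun_fubini_tonelli_F _ _ _ _ _ mu f mf).
rewrite [LHS](@fubini_tonelli _ _ _ _ _ mu mu f mf f0) -ge0_integralZl//; last 3 first.
- exact/measurable_EFinP.
- by move=> y _; rewrite lee_fin.
- by rewrite lee_fin ltW// kmass_gt0.
apply: eq_integral => y _; rewrite /f/=.
under eq_integral => x _ do rewrite EFinM.
rewrite ge0_integralZr//.
- by rewrite kmass_right.
- apply/measurable_EFinP/(measurable_continuous_comp measurableT cbump) => i.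
  by under eq_fun do rewrite !mxE; apply: measurable_funB.
- by move=> x _; rewrite lee_fin bump_ge0.
- by rewrite lee_fin.
Qed.

(** Through a continuous [G] close to [W], the error at [x] splits into a mean of [|W - G|], the
    oscillation of [G] and the value of [|W - G|] at [x]; each contributes at most [eta / 4] over
    the box. *)
Lemma mollify_L1 M r0 W : bounded_support phi M r0 W -> approx_L1 mu phi W ->
  forall r eta, 0 < eta -> exists e0, 0 < e0 <= 1 /\ forall e, 0 < e <= e0 ->
    (L1dist mu phi r (mollify e W \o phi) W <= eta%:E)%E.
Proof.
move=> hW aW r eta eta0; have [mW _ _] := hW.
have eta40 : 0 < eta / 4 by rewrite divr_gt0.
(* The kernel has radius at most 1, so means centred in the box of radius [r] only see the box of
   radius [r + 1]. *)
have [G cG hG] := aW (r + 1) _ eta40.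
have v0 := vol_ge0 mu phi r.
have v10 : 0 < vol mu phi r + 1 by rewrite ltr_wpDl.
have w0 : 0 < eta / 4 / (vol mu phi r + 1) by rewrite divr_gt0.
set w := _ / _ in w0.
have [t t0 ht] := compact_uniform_continuity (@box_compact r) cG w0.
exists (Num.min 1 t); split; first by rewrite lt_min ltr01 t0 ge_min lexx.
move=> e /andP[e0]; rewrite le_min => /andP[e1 et].
have e01 : 0 < e <= 1 by rewrite e0.
have cbump := C11_continuous (@bump_C11 R n e e01).
have k0 := kmass_gt0 e01.
have ki : 0 <= (kmass e)^-1 by rewrite invr_ge0 ltW.
have mbr := measurable_phibox mphi r; have mbr1 := measurable_phibox mphi (r + 1).
have mG : measurable_fun setT (G \o phi) by exact: measurable_continuous_comp.
pose H y := `|W y - G (phi y)| * \1_(box phi (r + 1)) y.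
have mH : measurable_fun setT H.
  apply: measurable_funM; last exact: measurable_indic.
  by apply: measurableT_comp => //; exact: measurable_funB.
have H0 y : 0 <= H y by rewrite mulr_ge0.
have [mJ EJ] := integral_bump_conv e01 mH H0.
set J := fun x => _ in mJ EJ.
have J0 x : (0 <= J x)%E by apply: integral_ge0 => y _; rewrite lee_fin mulr_ge0// bump_ge0.
have mWG : measurable_fun setT (fun x => `|W x - G (phi x)|).
  by apply: measurableT_comp => //; exact: measurable_funB.
have mb x : measurable_fun setT (fun y => bump e (phi x - phi y)).
  apply: (measurable_continuous_comp measurableT cbump) => i.
  by under eq_fun do rewrite !mxE; apply: measurable_funB.
have HL : (\int[mu]_y (H y)%:E <= (eta / 4)%:E)%E.
  apply: le_trans hG; rewrite (@integral_box _ _ _ _ mu phi _ (r + 1)); last first.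
    move=> x hx; rewrite /H indicE (_ : x \in _ = false) ?mulr0//.
    by apply/negbTE/negP => /set_mem; rewrite /box/= leNgt hx.
  apply: ge0_le_integral => //.
  - by move=> y _; rewrite lee_fin.
  - exact/measurable_EFinP/measurable_funTS.
  - exact/measurable_EFinP/measurable_funTS.
  move=> y _; rewrite lee_fin /H -[leRHS]mulr1 ler_wpM2l// indicE.
have pointwise x : box phi r x -> ((`|mollify e W (phi x) - W x|)%:E <=
    ((kmass e)^-1)%:E * J x + (w%:E + (`|W x - G (phi x)|)%:E))%E.
  move=> xr; apply: le_trans (mollify_dist_le e01 _ _ hW) _.
  apply: (@le_trans _ _ (((kmass e)^-1)%:E * (J x + (kmass e)%:E * (w + `|W x - G (phi x)|)%:E))%E).
    apply: lee_wpmul2l; first by rewrite lee_fin.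
    rewrite -(kmass_left e01 (phi x)) -ge0_integralZr//; last 3 first.
    - exact/measurable_EFinP.
    - by move=> y _; rewrite lee_fin bump_ge0.
    - by rewrite lee_fin addr_ge0// ltW.
    rewrite -ge0_integralD//; last 4 first.
    - by move=> y _; rewrite lee_fin mulr_ge0// bump_ge0.
    - by apply/measurable_EFinP; exact: measurable_funM.
    - by move=> y _; rewrite -EFinM lee_fin mulr_ge0 ?bump_ge0// addr_ge0// ltW.
    - by apply/measurable_EFinP; exact: measurable_funM.
    apply: ge0_le_integral => //.
    - by move=> y _; rewrite lee_fin mulr_ge0// bump_ge0.
    - apply/measurable_EFinP/measurable_funM => //.
      by apply: measurableT_comp => //; exact: measurable_funB.
    - by apply: emeasurable_funD; apply/measurable_EFinP; exact: measurable_funM.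
    move=> y _; rewrite -EFinM -EFinD lee_fin -mulrDr.
    case: (leP `|phi x - phi y| e) => hxy; last by rewrite (bump0 (ltW e0) hxy) !mul0r.
    rewrite ler_wpM2l ?bump_ge0//.
    have yr : `|phi y| <= r + 1.
      rewrite -(subrK (phi x) (phi y)) addrC; apply: le_trans (ler_normD _ _) _.
      by rewrite lerD// distrC (le_trans hxy).
    rewrite /H indicE mem_set// mulr1.
    have hGG : `|G (phi y) - G (phi x)| <= w by apply: ht => //; rewrite distrC (le_trans hxy).
    rewrite (_ : W y - W x = (W y - G (phi y)) + ((G (phi y) - G (phi x)) - (W x - G (phi x)))); last by ring.
    apply: le_trans (ler_normD _ _) _; rewrite lerD2l.
    by apply: le_trans (ler_normB _ _) _; rewrite lerD2r.
  rewrite ge0_muleDr//; last by rewrite mule_ge0// lee_fin ?addr_ge0// ltW.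
  by rewrite -!EFinM -EFinD mulKf ?gt_eqF.
rewrite /L1dist.
apply: (@le_trans _ _ (\int[mu]_(x in box phi r)
   (((kmass e)^-1)%:E * J x + (w%:E + (`|W x - G (phi x)|)%:E)))%E).
  apply: ge0_le_integral => //.
  - apply/measurable_EFinP/measurableT_comp => //; apply: measurable_funTS.
    apply: measurable_funB => //; apply: measurable_continuous_comp => //.
    have cm : continuous (fun v => conv mu phi (bump e) W v * (kmass e)^-1).
      apply: fcontinuousM; last exact: fcontinuous_cst.
      have M0 : 0 <= M by have [_ WM _] := hW; apply: le_trans (normr_ge0 _) (WM point).
      exact: (C11_continuous (conv_C11 mphi box_fin M0 (bump_C11 e01) hW)).
    exact: cm.
  - apply: emeasurable_funD; first by apply: emeasurable_funM => //; exact: measurable_funTS.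
    by apply: emeasurable_funD => //; exact/measurable_EFinP/measurable_funTS.
rewrite ge0_integralD//; last 4 first.
- by move=> x _; rewrite mule_ge0// lee_fin.
- by apply: emeasurable_funM => //; exact: measurable_funTS.
- by move=> x _; rewrite -EFinD lee_fin addr_ge0// ltW.
- by apply: emeasurable_funD => //; exact/measurable_EFinP/measurable_funTS.
rewrite ge0_integralD//; last 2 first.
- by move=> x _; rewrite lee_fin ltW.
- exact/measurable_EFinP/measurable_funTS.
rewrite ge0_integralZl//; last exact: measurable_funTS.
apply: (@le_trans _ _ ((eta / 4)%:E + ((eta / 4)%:E + (eta / 4)%:E))%E); last first.
  by rewrite -!EFinD lee_fin; lra.
apply: leeD; last apply: leeD.
- apply: (@le_trans _ _ (((kmass e)^-1)%:E * ((kmass e)%:E * \int[mu]_y (H y)%:E))%E).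
    apply: lee_wpmul2l; first by rewrite lee_fin.
    rewrite -EJ; apply: ge0_subset_integral => //.
  by rewrite muleA -EFinM mulVf ?gt_eqF// mul1e.
- rewrite integral_cst//= (volE box_fin) -EFinM lee_fin /w mulrAC ler_pdivrMr//.
  by rewrite ler_pM2l// lerDl.
apply: le_trans hG; apply: ge0_subset_integral => //.
- exact/measurable_EFinP/measurable_funTS.
- by move=> x /= /le_trans; apply; rewrite lerDl.
Qed.

End Mollification.

Lemma C11Z {R : realType} {n : nat} (c : R) (F : 'rV[R]_n.+1 -> R) DF : C11 F DF ->
  C11 (fun x => c * F x) (fun x => c *: DF x).
Proof.
apply: (@C11_comp _ _ (fun t => c * t) (fun _ => c)) => B B0.
exists (`|c| * (B + 1)); first by rewrite mulr_ge0// addr_ge0.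
move=> s t hs ht; split.
- by rewrite normrM ler_wpM2l// (le_trans ht)// lerDl.
- by rewrite ler_peMr// lerDr.
- by rewrite -mulrBr subrr normr0 mulr_ge0 ?sqr_ge0// mulr_ge0// addr_ge0.
- by rewrite subrr normr0 mulr_ge0// mulr_ge0// addr_ge0.
Qed.

(** * Almost everywhere convergence of mollifications *)

Section AlmostEverywhere.
Context {R : realType} {d} {T : measurableType d} {n : nat}.
Local Notation V := 'rV[R]_n.+1.
Variables (mu : {sigma_finite_measure set T -> \bar R}) (phi : T -> V).
Hypothesis mphi : forall i, measurable_fun setT (fun x => phi x ord0 i).
Hypothesis box_fin : forall r : R, (mu (box phi r) < +oo)%E.
Hypothesis box_pos : forall r : R, 0 < r -> (0 < mu (box phi r))%E.
Hypothesis trans : forall (h : V) (G : V -> R), continuous G -> (forall v, 0 <= G v) ->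
  (\int[mu]_x (G (phi x + h))%:E = \int[mu]_x (G (phi x))%:E)%E.

Lemma L1_summable_ae_cvg (r : R) (u : nat -> T -> R) (W : T -> R) :
  (forall j, measurable_fun setT (u j)) -> measurable_fun setT W ->
  (forall j, (L1dist mu phi r (u j) W <= (2^-1 ^+ j)%:E)%E) ->
  {ae mu, forall x, box phi r x -> (fun j => u j x) @ \oo --> W x}.
Proof.
move=> mu_ mW hL; have mb := measurable_phibox mphi r.
pose f j x := `|u j x - W x|%:E.
have mf j : measurable_fun (box phi r) (f j).
  by apply/measurable_EFinP/measurableT_comp => //; exact/measurable_funTS/measurable_funB.
have f0 j x : box phi r x -> (0 <= f j x)%E by rewrite lee_fin.
have IF := integral_nneseries mu mb mf f0.
pose S x := (\sum_(j <oo) f j x)%E.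
have mS : measurable_fun (box phi r) S.
  have := @ge0_emeasurable_sum _ _ R (box phi r) f xpredT (fun j x h _ => f0 j x h) (fun j _ => mf j).
  by congr (measurable_fun _ _); apply/funext => x; apply: eq_eseriesl.
have S0 x : (0 <= S x)%E by apply: nneseries_ge0 => j _ _; rewrite /f lee_fin.
have iS : mu.-integrable (box phi r) S.
  apply/integrableP; split => //.
  under eq_integral => x _ do rewrite gee0_abs//.
  rewrite IF; apply: (@le_lt_trans _ _ (\sum_(j <oo) (2^-1 ^+ j)%:E)%E).
    by apply: lee_nneseries => [j *|j *]; [apply: integral_ge0 => x xr; exact: f0|exact: hL].
  apply: (@le_lt_trans _ _ 2%:E); last exact: ltry.
  apply: lime_le.
    by apply: is_cvg_nneseries => j _ _; rewrite lee_fin exprn_ge0// invr_ge0.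
  apply: nearW => k; rewrite sumEFin lee_fin.
  have -> : \sum_(0 <= i < k) 2^-1 ^+ i = 2 - 2 * 2^-1 ^+ k :> R.
    elim: k => [|k IH]; first by rewrite big_geq// expr0 mulr1 subrr.
    by rewrite big_nat_recr//= IH exprS; field.
  by rewrite gerBl mulr_ge0// exprn_ge0// invr_ge0.
have := integrable_ae mb iS; apply: filterS => x Sfin xr.
have {}Sfin := Sfin xr.
have cs : cvgn (series (fun j => `|u j x - W x|)).
  apply: nondecreasing_is_cvgn.
    by apply/nondecreasing_seqP => k; rewrite /series/= big_nat_recr//= lerDl.
  exists (fine (S x)) => _ [k _ <-].
  rewrite -lee_fin fineK// /series/= -sumEFin.
  by apply: (nneseries_lim_ge k) => j _ _; rewrite lee_fin.
have /cvgr0Pnorm_le h := cvg_series_cvg_0 cs.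
apply/cvgrPdist_le => e e0; have := h e e0; apply: filterS => k.
by rewrite normr_id distrC.
Qed.

Lemma mollify_C11 (e M r : R) W : 0 < e <= 1 -> bounded_support phi M r W ->
  C11 (mollify mu phi e W)
    (fun v => (kmass mu phi e)^-1 *: \row_i conv mu phi (fun z => Dbump e z ord0 i) W v).
Proof.
move=> e01 hW; have M0 : 0 <= M.
  by have [_ WM _] := hW; apply: le_trans (normr_ge0 _) (WM point).
have := C11Z (kmass mu phi e)^-1 (conv_C11 mphi box_fin M0 (bump_C11 e01) hW).
by congr (C11 _ _); apply/funext => v; rewrite mulrC.
Qed.

Lemma measurable_mollify (e M r : R) W : 0 < e <= 1 -> bounded_support phi M r W ->
  measurable_fun setT (mollify mu phi e W \o phi).
Proof.
move=> e01 hW; apply: measurable_continuous_comp => //.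
exact: C11_continuous (mollify_C11 e01 hW).
Qed.

Lemma mollify_bound (e M r : R) W v : 0 < e <= 1 -> bounded_support phi M r W ->
  `|mollify mu phi e W v| <= M.
Proof.
move=> e01 hW; have k0 := kmass_gt0 mphi box_fin box_pos e01.
have [mW WM _] := hW.
have M0 : 0 <= M by apply: le_trans (normr_ge0 _) (WM point).
have := mollify_dist_le mphi box_fin box_pos trans e01 v 0 hW.
rewrite subr0 -lee_fin => /le_trans; apply.
apply: (@le_trans _ _ ((kmass mu phi e)^-1%:E * (M%:E * (kmass mu phi e)%:E))%E); last first.
  by rewrite -!EFinM lee_fin mulrCA mulVf ?mulr1// gt_eqF.
apply: lee_wpmul2l; first by rewrite lee_fin invr_ge0 ltW.
have cbump := C11_continuous (@bump_C11 R n e e01).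
have mb : measurable_fun setT (fun y => bump e (v - phi y)).
  apply: (measurable_continuous_comp measurableT cbump) => i.
  by under eq_fun do rewrite !mxE; apply: measurable_funB.
rewrite -(kmass_left mphi box_fin trans e01 v) -ge0_integralZl//; last 2 first.
- exact/measurable_EFinP.
- by move=> y _; rewrite lee_fin bump_ge0.
apply: ge0_le_integral => //.
- by move=> y _; rewrite lee_fin mulr_ge0// bump_ge0.
- apply/measurable_EFinP/measurable_funM => //.
  by apply: measurableT_comp => //; exact: measurable_funB.
- by apply/measurable_EFinP/measurable_funM.
- by move=> y _; rewrite -EFinM lee_fin subr0 mulrC ler_wpM2r// bump_ge0.
Qed.

Lemma mollify_eq0 (e : R) W v : 0 <= e -> (forall y, `|v - phi y| <= e -> W y = 0) ->
  mollify mu phi e W v = 0.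
Proof.
move=> e0 h; rewrite /mollify /conv (_ : Rintegral _ _ _ = 0) ?mul0r//.
rewrite /Rintegral integral0_eq// => y _.
case: (leP `|v - phi y| e) => hy; first by rewrite h// mulr0.
by rewrite bump0// mul0r.
Qed.

Lemma mollify_le (e M r : R) W v c : 0 < e <= 1 -> bounded_support phi M r W ->
  (forall y, `|v - phi y| <= e -> W y <= c) -> mollify mu phi e W v <= c.
Proof.
move=> e01 hW h; have k0 := kmass_gt0 mphi box_fin box_pos e01.
have cbump := C11_continuous (@bump_C11 R n e e01).
have [e0 e1] := andP e01.
have b1 (u : V) : `|bump e u| <= 1 by rewrite ger0_norm ?bump_ge0// bump_le1// ltW.
have i1 := bounded_support_integrable mphi box_fin (conv_kernel_support mphi v cbump b1 hW).
have mb : measurable_fun setT (fun y => bump e (v - phi y)).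
  apply: (measurable_continuous_comp measurableT cbump) => i.
  by under eq_fun do rewrite !mxE; apply: measurable_funB.
have bv : mu.-integrable setT (fun y => (bump e (v - phi y))%:E).
  apply/integrableP; split; first exact/measurable_EFinP.
  under eq_integral => y _ do rewrite gee0_abs ?lee_fin ?bump_ge0//.
  by rewrite kmass_left// ltry.
have i2 : mu.-integrable setT (fun y => (bump e (v - phi y) * c)%:E).
  have := integrableZr measurableT c bv.
  by congr (mu.-integrable _ _); apply/funext => y.
rewrite /mollify ler_pdivrMr//.
have -> : c * kmass mu phi e = \int[mu]_y (bump e (v - phi y) * c).
  rewrite RintegralZr// mulrC; congr (_ * _).
  by apply/esym/EFin_inj; rewrite /Rintegral fineK kmass_left.
apply: le_Rintegral => // y _.
case: (leP `|v - phi y| e) => hy; first by rewrite ler_wpM2l ?bump_ge0// h.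
by rewrite (bump0 (ltW e0) hy) !mul0r.
Qed.

(** A function and all components of its gradient must be mollified with one common sequence of
    radii: [e j] is the minimum over the finite family of radii that achieve the error [2^-j]. *)
Lemma mollify_ae_cvg m (M r0 emax : R) (W : 'I_m -> T -> R) : 0 < emax ->
  (forall i, bounded_support phi M r0 (W i)) -> (forall i, approx_L1 mu phi (W i)) ->
  exists e : nat -> R, (forall j, 0 < e j <= 1 /\ e j <= emax) /\
    {ae mu, forall x i, (fun j => mollify mu phi (e j) (W i) (phi x)) @ \oo --> W i x}.
Proof.
move=> em0 hW aW; pose r := r0 + 2.
have H j : exists e, (0 < e <= 1 /\ e <= emax) /\
    forall i, (L1dist mu phi r (mollify mu phi e (W i) \o phi) (W i) <= (2^-1 ^+ j)%:E)%E.
  have ej : 0 < 2^-1 ^+ j :> R by rewrite exprn_gt0// invr_gt0.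
  have [e0 he0] := choice (fun i => mollify_L1 mphi box_fin box_pos trans (hW i) (aW i) r ej).
  exists (\big[Num.min/Num.min 1 emax]_i e0 i).
  have e1 : \big[Num.min/Num.min 1 emax]_i e0 i <= Num.min 1 emax by exact: bigmin_le_id.
  have ep : 0 < \big[Num.min/Num.min 1 emax]_i e0 i.
    elim/big_ind : _ => [|x y x0 y0|i _]; first by rewrite lt_min ltr01.
      by rewrite lt_min x0.
    by have [/andP[]] := he0 i.
  split.
    by rewrite ep; move: e1; rewrite le_min => /andP[-> ->].
  move=> i; have [_] := he0 i; apply; rewrite ep/=; exact: bigmin_le_cond.
have [e he] := choice H; exists e; split; first by move=> j; have [] := he j.
have ae i : {ae mu, forall x, box phi r x ->
    (fun j => mollify mu phi (e j) (W i) (phi x)) @ \oo --> W i x}.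
  apply: (@L1_summable_ae_cvg r (fun j => mollify mu phi (e j) (W i) \o phi)).
  - by move=> j; have [[e01 _] _] := he j; exact: measurable_mollify e01 (hW i).
  - by have [] := hW i.
  - by move=> j; have [_ ->] := he j.
have : {ae mu, forall x, forall i : 'I_m, box phi r x ->
    (fun j => mollify mu phi (e j) (W i) (phi x)) @ \oo --> W i x}.
  exact: filter_forall.
(* Outside the box of radius [r0 + 2] both the function and its mollifications vanish, since the
   kernels have radius at most 1. *)
apply: filterS => x h i; case: (leP `|phi x| r) => hx; first exact: h.
have [_ _ W0] := hW i.
rewrite W0; last by apply: lt_trans hx; rewrite /r ltrDl.
rewrite (_ : (fun j => _) = cst 0); first exact: cvg_cst.
apply/funext => j; have [[/andP[e0 e1] _] _] := he j.
apply: mollify_eq0; first exact: ltW.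
move=> y hy; apply: W0.
have : `|phi x| <= `|phi x - phi y| + `|phi y|.
  by rewrite -{1}(subrK (phi y) (phi x)) ler_normD.
move: hx; rewrite /r; lra.
Qed.

End AlmostEverywhere.

Lemma fcontinuous_shift {R : realType} {M : normedModType R} (h : M) (G : M -> R) :
  continuous G -> continuous (fun v => G (v + h)).
Proof.
move=> cG v; apply: (continuous_comp (f := fun v => v + h) (g := G)); last exact: cG.
exact: (cvgD cvg_id (cvg_cst h)).
Qed.

Lemma sum_sqr_le {R : realType} (m : nat) (a : 'I_m -> R) :
  (\sum_(i < m) a i) ^+ 2 <= m%:R * \sum_(i < m) a i ^+ 2.
Proof.
elim: m a => [|m IH] a; first by rewrite !big_ord0 expr0n mulr0.
rewrite !big_ord_recr/=; set A := \sum_(i < m) _; set S := \sum_(i < m) _; set b := a ord_max.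
have h : A ^+ 2 <= m%:R * S by exact: IH.
have S0 : 0 <= S by apply: sumr_ge0 => i _; exact: sqr_ge0.
case: m => [|m] in a A S b IH h S0 *.
  by rewrite /A /S !big_ord0 !add0r mul1r.
have m0 : 0 < m.+1%:R :> R by [].
rewrite -(ler_pM2l m0) -subr_ge0 [m.+2%:R]mulrS.
have sq := sqr_ge0 (A - m.+1%:R * b).
have h2 : 0 <= (m.+1%:R + 1) * (m.+1%:R * S - A ^+ 2) by apply: mulr_ge0; [rewrite addr_ge0|rewrite subr_ge0].
have -> : m.+1%:R * ((1 + m.+1%:R) * (S + b ^+ 2)) - m.+1%:R * (A + b) ^+ 2 =
  (m.+1%:R + 1) * (m.+1%:R * S - A ^+ 2) + (A - m.+1%:R * b) ^+ 2 by ring.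
exact: addr_ge0.
Qed.

(** A Cauchy-Schwarz inequality with [h] measured in the maximum norm, whence the dimension. *)
Lemma dotv_sqr_le {R : realType} {n : nat} (c h : 'rV[R]_n.+1) :
  dotv c h ^+ 2 <= n.+1%:R * `|h| ^+ 2 * dotv c c.
Proof.
apply: le_trans (sum_sqr_le _) _; rewrite -mulrA ler_wpM2l// /dotv mulr_sumr.
apply: ler_sum => i _; rewrite exprMn mulrC -expr2 ler_wpM2r ?sqr_ge0//.
by rewrite -real_normK ?num_real// lerXn2r ?nnegrE// rV_coord_le.
Qed.

(** * Poincare and Faber-Krahn inequalities *)

Section FaberKrahn.
Context {R : realType} {d} {T : measurableType d} {n : nat}.
Local Notation V := 'rV[R]_n.+1.
Variables (mu : {sigma_finite_measure set T -> \bar R}) (phi : T -> V).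
Hypothesis mphi : forall i, measurable_fun setT (fun x => phi x ord0 i).
Hypothesis box_fin : forall r : R, (mu (box phi r) < +oo)%E.
Hypothesis box_pos : forall r : R, 0 < r -> (0 < mu (box phi r))%E.
Hypothesis trans : forall (h : V) (G : V -> R), continuous G -> (forall v, 0 <= G v) ->
  (\int[mu]_x (G (phi x + h))%:E = \int[mu]_x (G (phi x))%:E)%E.

Definition compact_C11 (r0 : R) (G : V -> R) (DG : V -> V) :=
  C11 G DG /\ forall v, r0 < `|v| -> G v = 0 /\ DG v = 0.

Definition energy (DG : V -> V) : \bar R := (\int[mu]_x (dotv (DG (phi x)) (DG (phi x)))%:E)%E.

Section Fixed_function.
Variables (r0 : R) (G : V -> R) (DG : V -> V) (hG : compact_C11 r0 G DG).
Let cG : continuous G := C11_continuous hG.1.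
Let cDG i : continuous (fun v => DG v ord0 i) := @C11_grad_continuous _ _ _ _ i hG.1.

Let mcont (F : V -> R) : continuous F -> measurable_fun setT (fun x => (F (phi x))%:E).
Proof. by move=> cF; apply/measurable_EFinP; exact: measurable_continuous_comp. Qed.

Let cshift (h : V) : continuous (fun v : V => G (v + h)).
Proof. exact: fcontinuous_shift. Qed.

Let cdiff (h : V) : continuous (fun v : V => (G (v + h) - G v) ^+ 2).
Proof. by under eq_fun do rewrite expr2; apply: fcontinuousM; exact: fcontinuousB. Qed.

Let cdot (h : V) : continuous (fun v => dotv (DG v) h ^+ 2).
Proof.
have c : continuous (fun v => dotv (DG v) h).
  apply: fcontinuous_sum => i; apply: fcontinuousM; first exact: cDG.
  exact: fcontinuous_cst.
by under eq_fun do rewrite expr2; exact: fcontinuousM.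
Qed.

Let cG2 : continuous (fun v : V => G v ^+ 2).
Proof. by under eq_fun do rewrite expr2; exact: (fcontinuousM cG cG). Qed.

Let cenergy : continuous (fun v => dotv (DG v) (DG v)).
Proof. by apply: fcontinuous_sum => i; apply: fcontinuousM; exact: cDG. Qed.

(* Splitting [h] into [m] equal steps reduces the bound to the first-order
   expansion of [G]; the error term is of order [m^-2]. *)
Lemma translation_energy (h : V) :
  (\int[mu]_x ((G (phi x + h) - G (phi x)) ^+ 2)%:E <=
   (2 * n.+1%:R * `|h| ^+ 2)%:E * energy DG)%E.
Proof.
have [[C [C0 hC]] h0] := hG.
pose D := (\int[mu]_x (dotv (DG (phi x)) h ^+ 2)%:E)%E.
suff : (\int[mu]_x ((G (phi x + h) - G (phi x)) ^+ 2)%:E <= 2%:E * D)%E.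
  move=> /le_trans; apply.
  rewrite -mulrA EFinM -muleA; apply: lee_wpmul2l; first by rewrite lee_fin.
  rewrite /D /energy -ge0_integralZl//; last 2 first.
  - exact: (mcont cenergy).
  - by move=> x _; rewrite lee_fin sqnorm_ge0.
  apply: ge0_le_integral => //.
  - by move=> x _; rewrite lee_fin sqr_ge0.
  - exact: (mcont (@cdot h)).
  - by apply: emeasurable_funM => //; exact: (mcont cenergy).
  by move=> x _; rewrite -EFinM lee_fin dotv_sqr_le.
apply/lee_addgt0Pr => e e0.
pose K := 2 * C ^+ 2 * `|h| ^+ 4 * vol mu phi (r0 + 1).
have K0 : 0 <= K by rewrite !mulr_ge0 ?exprn_ge0// vol_ge0.
(* [m + 1 >= |h|] makes each step [z] at most 1 long, where the expansion in [C11] is available;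
   [m + 1 >= K / e] makes the total error [K / (m+1)^2] at most [e]. *)
have [m hm] : exists m : nat, `|h| + K / e <= m.+1%:R.
  exists (Num.bound (`|h| + K / e)); apply: (@le_trans _ _ (Num.bound (`|h| + K / e))%:R).
    by apply/ltW/archi_boundP; rewrite addr_ge0// divr_ge0// ltW.
  by rewrite ler_nat.
have m0 : 0 < m.+1%:R :> R by [].
have m1 : 1 <= m.+1%:R :> R by rewrite ler1n.
have hm1 : `|h| <= m.+1%:R by apply: le_trans hm; rewrite lerDl divr_ge0// ltW.
have hm2 : K / m.+1%:R ^+ 2 <= e.
  rewrite ler_pdivrMr ?exprn_gt0// mulrC -ler_pdivrMr//.
  apply: (@le_trans _ _ m.+1%:R); last by rewrite expr2 ler_peMl// ltW.
  by apply: le_trans hm; rewrite lerDr.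
pose z := m.+1%:R^-1 *: h.
have nz : `|z| = `|h| / m.+1%:R by rewrite normrZ ger0_norm ?invr_ge0// mulrC.
have z1 : `|z| <= 1 by rewrite nz ler_pdivrMr// mul1r.
pose I := (\int[mu]_x ((G (phi x + z) - G (phi x)) ^+ 2)%:E)%E.
have I0 : (0 <= I)%E by apply: integral_ge0 => x _; rewrite lee_fin sqr_ge0.
have step1 : (\int[mu]_x ((G (phi x + h) - G (phi x)) ^+ 2)%:E <= (m.+1%:R ^+ 2)%:E * I)%E.
  apply: (@le_trans _ _ (\int[mu]_x (m.+1%:R%:E *
      \sum_(i < m.+1) ((G (phi x + i%:R *: z + z) - G (phi x + i%:R *: z)) ^+ 2)%:E))%E).
    have ms : measurable_fun setT (fun x => (\sum_(i < m.+1)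
        ((G (phi x + i%:R *: z + z) - G (phi x + i%:R *: z)) ^+ 2)%:E)%E).
      apply: emeasurable_sum => i.
      apply: (mcont (F := fun v : V => (G (v + i%:R *: z + z) - G (v + i%:R *: z)) ^+ 2)).
      under eq_fun do rewrite -addrA expr2.
      by apply: fcontinuousM; apply: fcontinuousB; exact: cshift.
    apply: ge0_le_integral => //.
    - by move=> x _; rewrite lee_fin sqr_ge0.
    - exact: (mcont (@cdiff h)).
    - exact: emeasurable_funM.
    move=> x _; rewrite sumEFin -EFinM lee_fin.
    have -> : G (phi x + h) - G (phi x) =
        \sum_(i < m.+1) (G (phi x + i%:R *: z + z) - G (phi x + i%:R *: z)).
      rewrite (_ : h = m.+1%:R *: z); last by rewrite scalerA mulfV ?gt_eqF// scale1r.
      have Ei (i : nat) : phi x + i%:R *: z + z = phi x + i.+1%:R *: z.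
        by rewrite -addrA -natr1 scalerDl scale1r.
      under [RHS]eq_bigr => i _ do rewrite Ei.
      rewrite -(big_mkord xpredT (fun i => G (phi x + i.+1%:R *: z) - G (phi x + i%:R *: z))).
      by rewrite (telescope_sumr (fun i => G (phi x + i%:R *: z)))// scale0r addr0.
    exact: sum_sqr_le.
  rewrite ge0_integralZl//; last 2 first.
  - apply: emeasurable_sum => i.
    apply: (mcont (F := fun v : V => (G (v + i%:R *: z + z) - G (v + i%:R *: z)) ^+ 2)).
    under eq_fun do rewrite -addrA expr2.
    by apply: fcontinuousM; apply: fcontinuousB; exact: cshift.
  - by move=> x _; apply: sume_ge0 => i _; rewrite lee_fin sqr_ge0.
  rewrite ge0_integral_sum//; last 2 first.
  - move=> i; apply: (mcont (F := fun v : V => (G (v + i%:R *: z + z) - G (v + i%:R *: z)) ^+ 2)).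
    under eq_fun do rewrite -addrA expr2.
    by apply: fcontinuousM; apply: fcontinuousB; exact: cshift.
  - by move=> i x _; rewrite lee_fin sqr_ge0.
  (* By translation invariance all the steps have the same integral [I]. *)
  rewrite (eq_bigr (fun=> I)); last first.
    move=> i _; exact: (trans (i%:R *: z) (@cdiff z) (fun v => sqr_ge0 _)).
  rewrite expr2 EFinM -muleA; apply: lee_wpmul2l; first by rewrite lee_fin.
  elim: (m.+1) => [|k IH]; first by rewrite big_ord0 mul0e.
  by rewrite big_ord_recr/= -natr1 EFinD ge0_muleDl// mul1e leeD2r.
have step2 : (I <= (2 / m.+1%:R ^+ 2)%:E * D + (K / m.+1%:R ^+ 4)%:E)%E.
  apply: (@le_trans _ _ (\int[mu]_x ((2 / m.+1%:R ^+ 2)%:E * (dotv (DG (phi x)) h ^+ 2)%:E +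
      (2 * C ^+ 2 * `|z| ^+ 4 * \1_(box phi (r0 + 1)) x)%:E))%E).
    apply: ge0_le_integral => //.
    - by move=> x _; rewrite lee_fin sqr_ge0.
    - exact: (mcont (@cdiff z)).
    - apply: emeasurable_funD.
        by apply: emeasurable_funM => //; exact: (mcont (@cdot h)).
      apply/measurable_EFinP/measurable_funM => //; apply: measurable_indic.
      exact: measurable_phibox.
    move=> x _; rewrite -EFinM -EFinD lee_fin.
    case: (leP `|phi x| (r0 + 1)) => hx.
      rewrite indicE mem_set// mulr1.
      have [_ _ /(_ z z1)[hz _]] := hC (phi x).
      set A := dotv (DG (phi x)) z in hz.
      have -> : dotv (DG (phi x)) h = m.+1%:R * A.
        by rewrite /A dotvZ mulrA mulfV ?gt_eqF// mul1r.
      set B := G (phi x + z) - G (phi x) in hz *.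
      have hB : (B - A) ^+ 2 <= C ^+ 2 * `|z| ^+ 4.
        rewrite -real_normK ?num_real// (_ : C ^+ 2 * _ = (C * `|z| ^+ 2) ^+ 2); last by ring.
        by rewrite lerXn2r ?nnegrE// mulr_ge0// exprn_ge0.
      rewrite (_ : 2 / m.+1%:R ^+ 2 * (m.+1%:R * A) ^+ 2 = 2 * A ^+ 2); last first.
        by field; rewrite gt_eqF.
      (* This amounts to [B^2 <= 2 A^2 + 2 (B - A)^2], the origin of the factor 2 in the
         statement. *)
      have := sqr_ge0 (B - 2 * A).
      rewrite (_ : (B - 2 * A) ^+ 2 = 2 * A ^+ 2 + 2 * (B - A) ^+ 2 - B ^+ 2); last by ring.
      lra.
    have [-> _] : G (phi x) = 0 /\ DG (phi x) = 0 by apply: h0; lra.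
    have [-> _] : G (phi x + z) = 0 /\ DG (phi x + z) = 0.
      apply: h0; have : `|phi x| <= `|phi x + z| + `|z| by rewrite -{1}(addrK z (phi x)) ler_normB.
      lra.
    rewrite subrr expr0n addr_ge0//; first by rewrite mulr_ge0 ?sqr_ge0// divr_ge0// exprn_ge0.
    by rewrite !mulr_ge0// exprn_ge0.
  rewrite ge0_integralD//; last 4 first.
  - by move=> x _; rewrite -EFinM lee_fin mulr_ge0 ?sqr_ge0// divr_ge0// exprn_ge0.
  - by apply: emeasurable_funM => //; exact: (mcont (@cdot h)).
  - by move=> x _; rewrite lee_fin !mulr_ge0// exprn_ge0.
  - apply/measurable_EFinP/measurable_funM => //; apply: measurable_indic.
    exact: measurable_phibox.
  apply: leeD.
    rewrite ge0_integralZl//; first exact: (mcont (@cdot h)).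
    by move=> x _; rewrite lee_fin sqr_ge0.
  under eq_integral do rewrite EFinM.
  rewrite ge0_integralZl//; last 2 first.
  - by apply/measurable_EFinP/measurable_indic; exact: measurable_phibox.
  - by rewrite lee_fin !mulr_ge0// exprn_ge0.
  rewrite integral_indic//; last exact: measurable_phibox.
  rewrite setIT (volE box_fin) -EFinM lee_fin nz le_eqVlt; apply/orP; left; apply/eqP.
  by rewrite /K; field; rewrite gt_eqF.
apply: (le_trans step1).
apply: (@le_trans _ _ ((m.+1%:R ^+ 2)%:E * ((2 / m.+1%:R ^+ 2)%:E * D + (K / m.+1%:R ^+ 4)%:E))%E).
  by apply: lee_wpmul2l; rewrite ?lee_fin ?exprn_ge0.
have D0 : (0 <= D)%E by apply: integral_ge0 => x _; rewrite lee_fin sqr_ge0.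
rewrite ge0_muleDr//; last 2 first.
- by rewrite mule_ge0// lee_fin divr_ge0// exprn_ge0.
- by rewrite lee_fin divr_ge0// exprn_ge0.
rewrite muleA -!EFinM; apply: leeD.
  by rewrite mulrCA mulfV ?mulr1// expf_neq0// gt_eqF.
rewrite lee_fin; apply: le_trans hm2.
by rewrite le_eqVlt; apply/orP; left; apply/eqP; field; rewrite gt_eqF.
Qed.

Lemma energy_ge0 : (0 <= energy DG)%E.
Proof. by apply: integral_ge0 => x _; rewrite lee_fin sqnorm_ge0. Qed.

(* A translation moving the support off itself turns the translation bound
   into the Poincare inequality. *)
Lemma poincare : 0 <= r0 ->
  (\int[mu]_x (G (phi x) ^+ 2)%:E <=
   (2 * n.+1%:R * (2 * r0 + 1) ^+ 2)%:E * energy DG)%E.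
Proof.
move=> r00; have [_ h0] := hG.
pose h : V := const_mx (2 * r0 + 1).
have nh : `|h| = 2 * r0 + 1.
  have t0 : 0 <= 2 * r0 + 1 by lra.
  apply/eqP; rewrite eq_le; apply/andP; split.
    by apply/rV_norm_leP => i; rewrite mxE ger0_norm.
  by have := rV_coord_le h ord0; rewrite mxE ger0_norm.
have := translation_energy h; rewrite nh; apply: le_trans.
apply: ge0_le_integral => //.
- by move=> x _; rewrite lee_fin sqr_ge0.
- exact: (mcont cG2).
- exact: (mcont (@cdiff h)).
move=> x _; rewrite lee_fin.
case: (leP `|phi x| r0) => hx; last first.
  by have [-> _] := h0 _ hx; rewrite expr0n sqr_ge0.
have [-> _] : G (phi x + h) = 0 /\ DG (phi x + h) = 0.
  apply: h0; have : `|h| <= `|phi x + h| + `|phi x|.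
    by rewrite -{1}(addKr (phi x) h) addrC ler_normB.
  rewrite nh; lra.
by rewrite sub0r sqrrN.
Qed.

(** [kmass e] times the square of [G] at [x] is the kernel integral over [y] of that square, which
    is at most twice the square of the increment from [y] to [x] plus twice the square at [y]. The
    first part comes from translations by at most [e], so it is small with [e]. In the second the
    kernel is at most 1, so Poincare bounds it for every [x], and integration over [A] brings the
    factor [mu A]. *)
Lemma localized_poincare (A : set T) (e : R) : 0 <= r0 -> measurable A -> 0 < e <= 1 ->
  ((kmass mu phi e)%:E * \int[mu]_(x in A) (G (phi x) ^+ 2)%:E <=
   (kmass mu phi e * (4 * n.+1%:R * e ^+ 2))%:E * energy DG +
   2%:E * mu A * ((2 * n.+1%:R * (2 * r0 + 1) ^+ 2)%:E * energy DG))%E.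
Proof.
move=> r00 mA e01; have [e0 e1] := andP e01.
have cbump := C11_continuous (@bump_C11 R n e e01).
have k0 := kmass_gt0 mphi box_fin box_pos e01.
have mG2 : measurable_fun setT (fun x => (G (phi x) ^+ 2)%:E) by exact: (mcont cG2).
have e01' : 0 <= e <= 1 by rewrite (ltW e0).
have mb2 : measurable_fun setT (fun z : T * T => bump e (phi z.1 - phi z.2)).
  exact: measurable_phiB.
have mG_1 : measurable_fun setT (fun z : T * T => G (phi z.1)).
  by apply: (measurableT_comp (measurable_continuous_comp measurableT cG mphi)); exact: measurable_fst.
have mG_2 : measurable_fun setT (fun z : T * T => G (phi z.2)).
  by apply: (measurableT_comp (measurable_continuous_comp measurableT cG mphi)); exact: measurable_snd.
pose q (z : T * T) := (bump e (phi z.1 - phi z.2) * (G (phi z.1) - G (phi z.2)) ^+ 2)%:E.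
have mq : measurable_fun setT q.
  apply/measurable_EFinP/measurable_funM => //; apply: measurable_funX; exact: measurable_funB.
have q0 z : (0 <= q z)%E by rewrite lee_fin mulr_ge0 ?bump_ge0// sqr_ge0.
have mx (x : T) : measurable_fun setT (fun y => bump e (phi x - phi y)).
  apply: (measurable_continuous_comp measurableT cbump) => i.
  by under eq_fun do rewrite !mxE; apply: measurable_funB.
have mQ : measurable_fun setT (fun x => \int[mu]_y q (x, y))%E.
  exact: (@measurable_fun_fubini_tonelli_F _ _ _ _ _ mu q mq).
have Q0 x : (0 <= \int[mu]_y q (x, y))%E by apply: integral_ge0.
have first_term : (\int[mu]_x \int[mu]_y q (x, y) <=
    (kmass mu phi e * (2 * n.+1%:R * e ^+ 2))%:E * energy DG)%E.
  pose q' (z : T * T) := (bump e (phi z.2) * (G (phi z.1 + phi z.2) - G (phi z.1)) ^+ 2)%:E.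
  have mq' : measurable_fun setT q'.
    apply/measurable_EFinP/measurable_funM.
      by apply: (measurableT_comp (measurable_continuous_comp measurableT cbump mphi)); exact: measurable_snd.
    by apply: measurable_funX; apply: measurable_funB => //; exact: (measurable_phiD mphi cG).
  have q'0 z : (0 <= q' z)%E by rewrite lee_fin mulr_ge0 ?bump_ge0// sqr_ge0.
  have -> : (\int[mu]_x \int[mu]_y q (x, y) = \int[mu]_x \int[mu]_y q' (x, y))%E.
    apply: eq_integral => x _.
    pose F (v : V) := bump e (v - phi x) * (G v - G (phi x)) ^+ 2.
    have cF : continuous F.
      apply: fcontinuousM.
        exact: (fcontinuous_shift (h := - phi x) cbump).
      under eq_fun do rewrite expr2.
      by apply: fcontinuousM; apply: fcontinuousB => //; exact: fcontinuous_cst.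
    have F0 v : 0 <= F v by rewrite mulr_ge0 ?bump_ge0// sqr_ge0.
    transitivity (\int[mu]_y (F (phi y))%:E)%E.
      apply: eq_integral => y _; rewrite /q /F/= -bumpN opprB; congr (_%:E); ring.
    (* The substitution of [x + y] for [y], available because the integrand is a continuous function
       of [phi y]. *)
    rewrite -(trans (phi x) cF F0); apply: eq_integral => y _.
    by rewrite /q' /F/= addrK (addrC (phi x)).
  rewrite (fubini_tonelli q' mq' q'0).
  apply: (@le_trans _ _ (\int[mu]_y ((bump e (phi y))%:E * ((2 * n.+1%:R * e ^+ 2)%:E * energy DG)))%E).
    have mB := measurable_bump mphi e01.
    apply: ge0_le_integral => //.
    - by move=> y _; exact: integral_ge0.
    - exact: (@measurable_fun_fubini_tonelli_G _ _ _ _ _ mu q' mq').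
    - by apply: emeasurable_funM => //; exact/measurable_EFinP.
    move=> y _; rewrite /q'/=.
    under eq_integral => x _ do rewrite EFinM.
    rewrite ge0_integralZl//; last 3 first.
    - exact: (mcont (@cdiff (phi y))).
    - by move=> x _; rewrite lee_fin sqr_ge0.
    - by rewrite lee_fin bump_ge0.
    case: (leP `|phi y| e) => hy; last by rewrite (bump0 (ltW e0) hy) !mul0e.
    apply: lee_wpmul2l; first by rewrite lee_fin bump_ge0.
    apply: (le_trans (translation_energy (phi y))).
    apply: lee_wpmul2r; first exact: energy_ge0.
    by rewrite lee_fin ler_wpM2l// lerXn2r ?nnegrE// ltW.
  rewrite ge0_integralZr//.
  - by rewrite kmassE// muleA EFinM.
  - by apply/measurable_EFinP; exact: measurable_bump.
  - by move=> y _; rewrite lee_fin bump_ge0.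
  - by rewrite mule_ge0 ?energy_ge0// lee_fin mulr_ge0// exprn_ge0// ltW.
have P := poincare r00.
have P0 : (0 <= \int[mu]_x (G (phi x) ^+ 2)%:E)%E by apply: integral_ge0 => x _; rewrite lee_fin sqr_ge0.
rewrite -ge0_integralZl//; last 3 first.
- exact: measurable_funTS.
- by move=> x _; rewrite lee_fin sqr_ge0.
- by rewrite lee_fin ltW.
apply: (@le_trans _ _ (\int[mu]_(x in A) (2%:E * \int[mu]_y q (x, y) + 2%:E * \int[mu]_y (G (phi y) ^+ 2)%:E))%E).
  apply: ge0_le_integral => //.
  - by move=> x _; rewrite -EFinM lee_fin mulr_ge0 ?sqr_ge0// ltW.
  - by apply: emeasurable_funM => //; exact: measurable_funTS.
  - apply: emeasurable_funD => //; apply: emeasurable_funM => //; exact: measurable_funTS.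
  move=> x _; rewrite -(kmass_left mphi box_fin trans e01 (phi x)) -ge0_integralZr//; last 3 first.
  - exact/measurable_EFinP.
  - by move=> y _; rewrite lee_fin bump_ge0.
  - by rewrite lee_fin sqr_ge0.
  have mqx : measurable_fun setT (fun y => q (x, y)) by exact: (measurableT_comp mq (measurable_pair1 x)).
  rewrite -ge0_integralZl// -ge0_integralZl//; last by move=> y _; rewrite lee_fin sqr_ge0.
  rewrite -ge0_integralD//; last 4 first.
  - by move=> y _; rewrite mule_ge0.
  - exact: emeasurable_funM.
  - by move=> y _; rewrite mule_ge0// lee_fin sqr_ge0.
  - exact: emeasurable_funM.
  apply: ge0_le_integral => //.
  - by move=> y _; rewrite -EFinM lee_fin mulr_ge0 ?sqr_ge0// bump_ge0.
  - by apply: emeasurable_funM => //; exact/measurable_EFinP.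
  - by apply: emeasurable_funD; exact: emeasurable_funM.
  move=> y _; rewrite /q/= -!EFinM -EFinD lee_fin.
  set b := bump e _; set s := G (phi x); set t := G (phi y).
  have b0 : 0 <= b by exact: bump_ge0.
  have b1 : b <= 1 by exact: bump_le1.
  have h1 : b * s ^+ 2 <= 2 * (b * (s - t) ^+ 2) + 2 * (b * t ^+ 2).
    rewrite -subr_ge0 (_ : _ - _ = b * (s - 2 * t) ^+ 2); last by ring.
    by rewrite mulr_ge0// sqr_ge0.
  have h2 : b * t ^+ 2 <= t ^+ 2 by rewrite ler_piMl// sqr_ge0.
  lra.
rewrite ge0_integralD//; last 3 first.
- by move=> x _; rewrite mule_ge0.
- by apply: emeasurable_funM => //; exact: measurable_funTS.
- by move=> x _; rewrite mule_ge0.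
apply: leeD.
  rewrite ge0_integralZl//; last exact: measurable_funTS.
  have -> : ((kmass mu phi e * (4 * n.+1%:R * e ^+ 2))%:E * energy DG =
      2%:E * ((kmass mu phi e * (2 * n.+1%:R * e ^+ 2))%:E * energy DG))%E.
    by rewrite muleA -EFinM; congr (_%:E * _)%E; ring.
  apply: lee_wpmul2l => //; apply: le_trans first_term.
  exact: ge0_subset_integral.
by rewrite integral_cst// muleAC; apply: lee_wpmul2l.
Qed.

End Fixed_function.

(** A qualitative form: on sets of small measure the constant is as small as desired. The radius [e]
    is fixed first, so that the translation part takes at most half of [eta]; [theta] then makes the
    part with [mu A] at most the other half. *)
Lemma faber_krahn (r0 eta : R) : 0 <= r0 -> 0 < eta -> exists2 theta : R, 0 < theta &
  forall (A : set T) G DG, measurable A -> (mu A <= theta%:E)%E -> compact_C11 r0 G DG ->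
  (\int[mu]_(x in A) (G (phi x) ^+ 2)%:E <= eta%:E * energy DG)%E.
Proof.
move=> r00 eta0; pose N : R := n.+1%:R.
have N1 : 1 <= N by rewrite ler1n.
pose e := Num.min 1 (eta / (8 * N)).
have e0 : 0 < e by rewrite lt_min ltr01 divr_gt0// mulr_gt0//; lra.
have e1 : e <= 1 by rewrite ge_min lexx.
have e01 : 0 < e <= 1 by rewrite e0.
have e2 : 4 * N * e ^+ 2 <= eta / 2.
  have h : e <= eta / (8 * N) by rewrite ge_min lexx orbT.
  have : 4 * N * e ^+ 2 <= 4 * N * e by rewrite ler_wpM2l ?expr2 ?ler_piMl// ?ltW//; lra.
  move/le_trans; apply; rewrite ler_pdivlMr ?mulr_gt0// in h; lra.
have k0 := kmass_gt0 mphi box_fin box_pos e01.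
set k := kmass mu phi e in k0.
pose L := 2 * N * (2 * r0 + 1) ^+ 2.
have L0 : 0 < L by rewrite !mulr_gt0// ?exprn_gt0//; lra.
exists (k * eta / (4 * L)).
  by apply: divr_gt0; apply: mulr_gt0.
move=> A G DG mA hA hG.
have E0 := energy_ge0 DG.
have := localized_poincare hG r00 mA e01; rewrite -/k -/N -/L => H.
have H2 : (k%:E * \int[mu]_(x in A) (G (phi x) ^+ 2)%:E <= k%:E * (eta%:E * energy DG))%E.
  apply: (le_trans H).
  apply: (@le_trans _ _ ((k * (eta / 2))%:E * energy DG + (k * (eta / 2))%:E * energy DG)%E).
    apply: leeD; first by apply: lee_wpmul2r => //; rewrite lee_fin ler_wpM2l// ltW.
    rewrite muleA; apply: lee_wpmul2r => //.
    apply: (@le_trans _ _ (2%:E * (k * eta / (4 * L))%:E * L%:E)%E).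
      by apply: lee_wpmul2r; [rewrite lee_fin ltW|apply: lee_wpmul2l].
    by rewrite -!EFinM lee_fin le_eqVlt; apply/orP; left; apply/eqP; field; rewrite gt_eqF.
  have ke : 0 <= k * (eta / 2) by rewrite mulr_ge0 ?divr_ge0// ltW.
  rewrite -ge0_muleDl ?lee_fin// -EFinD muleA -EFinM.
  by have -> : k * (eta / 2) + k * (eta / 2) = k * eta by field.
by rewrite lee_pmul2l// ?lte_fin in H2.
Qed.
End FaberKrahn.

Lemma fcvg_sum {R : realType} I (s : seq I) (f : I -> nat -> R) (l : I -> R) :
  (forall i, f i @ \oo --> l i) ->
  (fun j => \sum_(i <- s) f i j) @ \oo --> \sum_(i <- s) l i.
Proof.
move=> fl; elim: s => [|i s IH].
  by rewrite big_nil; under eq_fun do rewrite big_nil; exact: cvg_cst.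
by rewrite big_cons; under eq_fun do rewrite big_cons; apply: cvgD.
Qed.

Lemma integral_eq0_null {R : realType} {d} {T : measurableType d} (mu : {measure set T -> \bar R})
    (D : set T) (F : T -> R) : measurable D -> measurable_fun setT F -> (forall x, 0 <= F x) ->
  (\int[mu]_(x in D) (F x)%:E = 0)%E -> mu (D `&` [set x | 0 < F x]) = 0%E.
Proof.
move=> mDD mF F0 IF.
have mF' : measurable_fun D (fun x => (F x)%:E) by apply/measurable_EFinP/measurable_funTS.
have [+ _] := ae_eq_integral_abs mu mDD mF'.
under eq_integral => x _ do rewrite gee0_abs ?lee_fin//.
move=> /(_ IF) H; apply: measure_negligible.
  apply: measurableI => //.
  rewrite (_ : [set _ | _] = setT `&` F @^-1` `]0, +oo[%classic); first exact: mF.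
  by rewrite setTI; apply/seteqP; split => x /=; rewrite in_itv/= andbT.
apply: negligibleS H => x [Dx /= Fx] /(_ Dx) []; by move/eqP; rewrite gt_eqF.
Qed.

(** * Vanishing of superlevel sets *)

Section LevelSets.
Context {R : realType} {d} {T : measurableType d} {n : nat}.
Local Notation V := 'rV[R]_n.+1.
Variables (mu : {sigma_finite_measure set T -> \bar R}) (phi : T -> V).
Hypothesis mphi : forall i, measurable_fun setT (fun x => phi x ord0 i).
Hypothesis box_fin : forall r : R, (mu (box phi r) < +oo)%E.
Hypothesis box_pos : forall r : R, 0 < r -> (0 < mu (box phi r))%E.
Hypothesis trans : forall (h : V) (G : V -> R), continuous G -> (forall v, 0 <= G v) ->
  (\int[mu]_x (G (phi x + h))%:E = \int[mu]_x (G (phi x))%:E)%E.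

Lemma bounded_cvg_integral (A : set T) (B r : R) (f : nat -> T -> R) (F : T -> R) :
  measurable A -> (forall j, bounded_support phi B r (f j)) -> measurable_fun setT F ->
  {ae mu, forall x, (fun j => f j x) @ \oo --> F x} ->
  (fun j => \int[mu]_(x in A) (f j x)%:E)%E @ \oo --> (\int[mu]_(x in A) (F x)%:E)%E.
Proof.
move=> mA hf mF fF.
have mb := measurable_phibox mphi r.
have iB : mu.-integrable A (fun x => (B * \1_(box phi r) x)%:E).
  apply: (@integrableS _ _ _ mu setT) => //.
  apply: (@bounded_support_integrable _ _ _ _ mu phi mphi box_fin `|B| r); split.
  - by apply: measurable_funM => //; exact: measurable_indic.
  - by move=> x; rewrite normrM ler_piMr// indicE ger0_norm// lern1 leq_b1.
  - move=> x hx; rewrite indicE (_ : x \in _ = false) ?mulr0//.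
    by apply/negbTE/negP => /set_mem; rewrite /box/= leNgt hx.
have [|||| _ _] := @dominated_convergence _ _ _ mu A mA (fun j x => (f j x)%:E)
  (fun x => (F x)%:E) (fun x => (B * \1_(box phi r) x)%:E) _ _ _ iB _.
- by move=> j; apply/measurable_EFinP/measurable_funTS; have [] := hf j.
- exact/measurable_EFinP/measurable_funTS.
- by apply: filterS fF => x h _; apply/fine_cvgP; split; [exact: nearW|exact: h].
- apply: aeW => x j _; have [_ fB f0] := hf j; rewrite /= lee_fin indicE.
  case: (leP `|phi x| r) => hx; first by rewrite mem_set// mulr1.
  by rewrite f0// normr0 mulr_ge0// (le_trans _ (fB x)).
exact.
Qed.

Variables (M r0 kappa c0 C1 : R) (W : T -> R) (D : 'I_n.+1 -> T -> R).
Variables (w : nat -> V -> R) (Dw : nat -> V -> V).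
Hypotheses (kappa0 : 0 < kappa) (c00 : 0 < c0) (C10 : 0 < C1) (r00 : 0 <= r0).
Hypothesis hW : bounded_support phi M r0 W.
Hypothesis hD : forall i, bounded_support phi M r0 (D i).
Hypothesis cw : forall j, C11 (w j) (Dw j).
Hypothesis wM : forall j v, `|w j v| <= M.
Hypothesis wout : forall j v, r0 < `|v| -> w j v <= kappa.
Hypothesis DwM : forall j v i, kappa < w j v -> `|Dw j v ord0 i| <= M.
Hypothesis wW : {ae mu, forall x, (fun j => w j (phi x)) @ \oo --> W x}.
Hypothesis DwD : {ae mu, forall x, kappa < W x -> forall i,
  (fun j => Dw j (phi x) ord0 i) @ \oo --> D i x}.

Definition sqgrad x : R := \sum_i D i x ^+ 2.

Hypothesis caccioppoli : forall k, kappa <= k ->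
  (\int[mu]_x (3 * c0 * (pospart (W x - k) ^+ 2 * sqgrad x))%:E <=
   \int[mu]_x (C1 * (pospart (W x - k) ^+ 3 * Num.sqrt (sqgrad x)))%:E)%E.

Let M0 : 0 <= M. Proof. exact: le_trans (normr_ge0 _) (wM 0 0). Qed.
Let mW : measurable_fun setT W. Proof. by have [] := hW. Qed.
Let mD i : measurable_fun setT (D i). Proof. by have [] := hD i. Qed.

Lemma sqgrad_ge0 x : 0 <= sqgrad x.
Proof. by apply: sumr_ge0 => i _; exact: sqr_ge0. Qed.

Lemma measurable_sqgrad : measurable_fun setT sqgrad.
Proof. by apply: measurable_sum => i; exact: measurable_funX. Qed.

Lemma sqgrad_le x : sqgrad x <= n.+1%:R * M ^+ 2.
Proof.
have -> : n.+1%:R * M ^+ 2 = \sum_(i < n.+1) M ^+ 2 by rewrite sumr_const card_ord mulr_natl.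
apply: ler_sum => i _; rewrite -real_normK ?num_real// lerXn2r ?nnegrE//.
by have [_ ->] := hD i.
Qed.

Lemma measurable_pospart (F : T -> R) : measurable_fun setT F ->
  measurable_fun setT (fun x => pospart (F x)).
Proof. by move=> mF; apply: measurable_maxr => //; exact: measurable_cst. Qed.

Lemma pospart_bound k t : `|t| <= M -> kappa <= k -> pospart (t - k) <= M.
Proof.
move=> tM hk; have [[_ ->]//|[_ ->]] := pospartP (t - k).
rewrite lerBlDr (le_trans (ler_norm t))// (le_trans tM)// lerDl.
exact: le_trans (ltW kappa0) hk.
Qed.

(** The square of the truncated approximation, with its gradient. In the limit its energy is the
    integral of 4 phi^2 |Dw|^2 and its own square is phi^4, the two quantities to be compared. *)
Let G k j := fun v => pospart (w j v - k) ^+ 2.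
Let DG k j := fun v => (2 * pospart (w j v - k)) *: Dw j v.

Let cvg_pospart (u : nat -> R) l k : u @ \oo --> l ->
  (fun j => pospart (u j - k)) @ \oo --> pospart (l - k).
Proof.
move=> ul; apply/cvgrPdist_le => e e0.
have /cvgrPdist_le/(_ e e0) := ul; apply: filterS => j; apply: le_trans.
apply: (le_trans (pospart_lip _ _)).
by rewrite opprB addrA subrK.
Qed.

Let hG k j : kappa <= k -> compact_C11 r0 (G k j) (DG k j).
Proof.
move=> hk; split.
  exact: (C11_comp (h := fun t => pospart (t - k) ^+ 2) (@pospart_sqr_C11 R k) (cw j)).
move=> v /(wout j) hv; have z : pospart (w j v - k) = 0.
  by have [[_ ->]//|[]] := pospartP (w j v - k); lra.
by rewrite /G /DG z expr0n mulr0 scale0r.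
Qed.

Let energy_lim k : kappa <= k ->
  (fun j => energy mu phi (DG k j)) @ \oo -->
  (\int[mu]_x (4 * (pospart (W x - k) ^+ 2 * sqgrad x))%:E)%E.
Proof.
move=> hk.
have b j v i : `|DG k j v ord0 i| <= 2 * M * M.
  rewrite mxE; case: (leP (w j v) kappa) => hw.
    have -> : pospart (w j v - k) = 0 by have [[_ ->]//|[]] := pospartP (w j v - k); lra.
    by rewrite mulr0 mul0r normr0 !mulr_ge0.
  rewrite normrM ler_pM// ?DwM// ger0_norm ?mulr_ge0 ?pospart_ge0//.
  by rewrite ler_wpM2l// pospart_bound.
apply: (@bounded_cvg_integral setT (n.+1%:R * (2 * M * M) ^+ 2) r0
  (fun j x => dotv (DG k j (phi x)) (DG k j (phi x)))) => //.
- move=> j; split.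
  + apply: (measurable_continuous_comp measurableT (G := fun v => dotv (DG k j v) (DG k j v))) => //.
    have c i := @C11_grad_continuous _ _ _ _ i (hG j hk).1.
    by apply: fcontinuous_sum => i; apply: fcontinuousM; exact: c.
  + move=> x; rewrite ger0_norm ?sqnorm_ge0//.
    have -> : n.+1%:R * (2 * M * M) ^+ 2 = \sum_(i < n.+1) (2 * M * M) ^+ 2.
      by rewrite sumr_const card_ord mulr_natl.
    apply: ler_sum => i _; rewrite -expr2 -real_normK ?num_real// lerXn2r ?nnegrE//.
    by rewrite !mulr_ge0.
  + move=> x /((hG j hk).2)[_ ->]; rewrite /dotv big1// => i _.
    by rewrite mxE mul0r.
- apply: measurable_funM => //; apply: measurable_funM; last exact: measurable_sqgrad.
  by apply: measurable_funX; apply: measurable_pospart; exact: measurable_funB.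
apply: filterS2 wW DwD => x h1 h2.
have p := @cvg_pospart _ _ k h1.
have -> : 4 * (pospart (W x - k) ^+ 2 * sqgrad x) =
    \sum_i (2 * pospart (W x - k) * D i x) * (2 * pospart (W x - k) * D i x).
  by rewrite /sqgrad !mulr_sumr; apply: eq_bigr => i _; ring.
have ci i : (fun j => DG k j (phi x) ord0 i) @ \oo --> 2 * pospart (W x - k) * D i x.
  (* Where [W <= kappa] nothing is known about the limit of [Dw j]. There the factor [pospart] tends
     to 0, and [Dw j] is bounded whenever this factor is nonzero. *)
  case: (leP (W x) kappa) => hx.
    have z : pospart (W x - k) = 0 by have [[_ ->]//|[]] := pospartP (W x - k); lra.
    rewrite z mulr0 mul0r; apply/cvgr0Pnorm_le => e e0.
    have e20 : 0 < e / (2 * (M + 1)) by rewrite divr_gt0// mulr_gt0// ltr_wpDl.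
    have := p; rewrite z => /cvgr0Pnorm_le/(_ _ e20); apply: filterS => j hj.
    rewrite mxE; case: (leP (w j (phi x)) kappa) => hw.
      have -> : pospart (w j (phi x) - k) = 0.
        by have [[_ ->]//|[]] := pospartP (w j (phi x) - k); lra.
      by rewrite mulr0 mul0r normr0 ltW.
    rewrite normrM normrM (ger0_norm (ler0n _ 2)).
    apply: (@le_trans _ _ (2 * (e / (2 * (M + 1))) * (M + 1))).
      rewrite ler_pM// ?mulr_ge0// ?ler_wpM2l//.
      by apply: le_trans (DwM _ hw) _; rewrite lerDl.
    by rewrite le_eqVlt; apply/orP; left; apply/eqP; field; rewrite gt_eqF// ltr_wpDl.
  under eq_fun do rewrite mxE.
  by apply: cvgM; [apply: cvgM => //; exact: cvg_cst|exact: h2].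
by apply: fcvg_sum => i; apply: cvgM; exact: ci.
Qed.

Let sqr_lim k (A : set T) : measurable A -> kappa <= k ->
  (fun j => \int[mu]_(x in A) (G k j (phi x) ^+ 2)%:E)%E @ \oo -->
  (\int[mu]_(x in A) (pospart (W x - k) ^+ 4)%:E)%E.
Proof.
move=> mA hk.
apply: (@bounded_cvg_integral A (M ^+ 4) r0 (fun j x => G k j (phi x) ^+ 2)) => //.
- move=> j; have cG := C11_continuous (hG j hk).1; split.
  + by apply: measurable_funX; exact: measurable_continuous_comp.
  + move=> x; rewrite /G -exprM ger0_norm ?exprn_ge0 ?pospart_ge0//.
    by rewrite lerXn2r ?nnegrE ?pospart_ge0// pospart_bound.
  + by move=> x /((hG j hk).2)[-> _]; rewrite expr0n.
- by apply: measurable_funX; apply: measurable_pospart; exact: measurable_funB.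
apply: filterS wW => x h1; have p := @cvg_pospart _ _ k h1.
rewrite (_ : pospart (W x - k) ^+ 4 = (pospart (W x - k) * pospart (W x - k)) *
   (pospart (W x - k) * pospart (W x - k))); last by ring.
pose q j := pospart (w j (phi x) - k).
rewrite (_ : (fun j => _) = (fun j => (q j * q j) * (q j * q j))); last first.
  by apply/funext => j; rewrite /G -/(q j); ring.
by apply: cvgM; exact: cvgM.
Qed.

Let Phi k x := pospart (W x - k).

Let mPhi k : measurable_fun setT (Phi k).
Proof. by apply: measurable_pospart; exact: measurable_funB. Qed.

Let Phi_bound k x : kappa <= k -> Phi k x <= M.
Proof. by move=> hk; apply: pospart_bound => //; have [_ ->] := hW. Qed.

Let Phi_out k x : kappa <= k -> r0 < `|phi x| -> Phi k x = 0.
Proof.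
move=> hk hx; have [_ _ W0] := hW; rewrite /Phi W0// sub0r.
have k0 : 0 < k by exact: lt_le_trans hk.
by have [[_ ->]//|[]] := pospartP (- k); lra.
Qed.

Let X k : \bar R := (\int[mu]_x (Phi k x ^+ 2 * sqgrad x)%:E)%E.

Let mX k : measurable_fun setT (fun x => Phi k x ^+ 2 * sqgrad x).
Proof. by apply: measurable_funM; [exact: measurable_funX|exact: measurable_sqgrad]. Qed.

Let X0 k x : 0 <= Phi k x ^+ 2 * sqgrad x.
Proof. by rewrite mulr_ge0 ?sqgrad_ge0// exprn_ge0// pospart_ge0. Qed.

Let X_fin k : kappa <= k -> X k \is a fin_num.
Proof.
move=> hk; apply: integrable_fin_num => //.
apply: (@bounded_support_integrable _ _ _ _ mu phi mphi box_fin (M ^+ 2 * (n.+1%:R * M ^+ 2)) r0).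
split; first exact: mX.
  move=> x; rewrite ger0_norm//; apply: ler_pM => //; rewrite ?exprn_ge0 ?pospart_ge0 ?sqgrad_ge0//.
    by rewrite lerXn2r ?nnegrE ?pospart_ge0// Phi_bound.
  exact: sqgrad_le.
by move=> x hx; rewrite Phi_out// expr0n mul0r.
Qed.

(** Transfers an energy inequality from the approximations to [W]; the 4 comes from the gradient 2
    phi Dw of phi^2. *)
Let limit_ineq k (A : set T) (c : R) : measurable A -> kappa <= k ->
  (forall j, (\int[mu]_(x in A) (G k j (phi x) ^+ 2)%:E <= c%:E * energy mu phi (DG k j))%E) ->
  (\int[mu]_(x in A) (Phi k x ^+ 4)%:E <= (c * 4)%:E * X k)%E.
Proof.
move=> mA hk h; have L1 := @sqr_lim k A mA hk; have L2 := @energy_lim k hk.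
have -> : ((c * 4)%:E * X k = c%:E * \int[mu]_x (4 * (Phi k x ^+ 2 * sqgrad x))%:E)%E.
  under eq_integral do rewrite EFinM.
  rewrite ge0_integralZl//; first by rewrite muleA EFinM.
  - by apply/measurable_EFinP; exact: mX.
  - by move=> x _; rewrite lee_fin.
have fc : c%:E \is a fin_num by [].
have L3 := cvgeZl fc L2.
rewrite -(cvg_lim _ L1)// -(cvg_lim _ L3)//; apply: lee_lim.
- by apply/cvg_ex; eexists; exact: L1.
- by apply/cvg_ex; eexists; exact: L3.
- exact: nearW.
Qed.

Lemma poincare_limit k : kappa <= k ->
  exists L, (\int[mu]_x (Phi k x ^+ 4)%:E <= L%:E * X k)%E.
Proof.
move=> hk; exists (2 * n.+1%:R * (2 * r0 + 1) ^+ 2 * 4); apply: limit_ineq => // j.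
exact: (poincare mphi box_fin trans (hG j hk)).
Qed.

Lemma faber_krahn_limit (eta : R) : 0 < eta -> exists2 theta : R, 0 < theta &
  forall (A : set T) k, measurable A -> (mu A <= theta%:E)%E -> kappa <= k ->
  (\int[mu]_(x in A) (Phi k x ^+ 4)%:E <= eta%:E * X k)%E.
Proof.
move=> eta0; have eta40 : 0 < eta / 4 by rewrite divr_gt0.
have [theta t0 ht] := faber_krahn mphi box_fin box_pos trans r00 eta40.
exists theta => // A k mA At hk.
have := @limit_ineq k A (eta / 4) mA hk (fun j => ht A _ _ mA At (hG j hk)).
by rewrite mulfVK.
Qed.

Let measurable_level k : measurable [set x | k < W x].
Proof.
rewrite (_ : [set _ | _] = setT `&` W @^-1` `]k, +oo[%classic); first exact: mW.
by rewrite setTI; apply/seteqP; split => x /=; rewrite in_itv/= andbT.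
Qed.

(* Testing with levels [k] increasing to the essential supremum [m]: the
   gradient vanishes on [W = m], so the sets [k < W] where it does not vanish
   shrink to a null set. *)
Lemma level_set_null : mu [set x | kappa < W x] = 0%E.
Proof.
apply/eqP/negPn/negP => hneq.
(* The levels exceeded on a set of positive measure. Their supremum [m] is the essential supremum of
   [W]; [below] and [above] are the two properties that characterise it. *)
pose S := [set k : R | kappa <= k /\ mu [set x | k < W x] != 0%E].
have S0 : S kappa by [].
have subW k : M < k -> [set x | k < W x] = set0.
  move=> Mk; rewrite -subset0 => x /=; have [_ /(_ x) hWx _] := hW.
  by move=> kx; move: (le_lt_trans (le_trans (ler_norm _) hWx) (lt_trans Mk kx)); rewrite ltxx.
have Sub : ubound S M.
  move=> k [_]; apply: contraR; rewrite -ltNge => /subW ->; by rewrite measure0.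
have hS : has_sup S by split; [exists kappa|exists M].
pose m := sup S.
have km : kappa <= m by apply: ub_le_sup => //; exists M.
have below k : kappa <= k -> k < m -> mu [set x | k < W x] != 0%E.
  move=> hk /(sup_gt hS.1) [k' [_ hk'] kk'].
  apply: contra_neq hk' => h0; apply/eqP; rewrite eq_le measure_ge0 andbT -h0.
  by apply: le_measure; rewrite ?inE// => x /=; apply: lt_trans.
have above : mu [set x | m < W x] = 0%E.
  pose F (j : nat) := [set x | m + j.+1%:R^-1 < W x].
  have F0 j : mu (F j) = 0%E.
    apply/eqP/negPn/negP => h.
    have : S (m + j.+1%:R^-1) by split => //; apply: le_trans km _; rewrite lerDl.
    move/(ub_le_sup hS.2); rewrite -/m gerDl; apply/negP; by rewrite -ltNge.
  apply/eqP; rewrite eq_le measure_ge0 andbT.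
  have -> : [set x | m < W x] = \bigcup_j F j.
    apply/seteqP; split => [x /= hx|x [j _] /=]; last by apply: lt_trans; rewrite ltrDl.
    have d0 : 0 < W x - m by rewrite subr_gt0.
    have [j _ /(_ j (leqnn _)) hj] := near_infty_natSinv_lt (PosNum d0).
    by exists j => //=; rewrite /F/= -ltrBrDl.
  apply: le_trans (measure_sigma_subadditive mu (F := F) _ _ _) _ => //.
  - by move=> j; exact: measurable_level.
  - by apply: bigcupT_measurable => j; exact: measurable_level.
  by rewrite eseries0// => j _ _; exact: F0.
have kltm : kappa < m.
  by rewrite lt_neqAle km andbT; apply: contra_neq hneq => ->.
have aeW_le : {ae mu, forall x, W x <= m}.
  exists [set x | m < W x]; split => // x /= /negP; by rewrite -ltNge.
have mS := measurable_sqgrad.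
have msS : measurable_fun setT (fun x => Num.sqrt (sqgrad x)).
  exact: (measurableT_comp (continuous_measurable_fun (@sqrt_continuous R)) mS).
pose K := n.+1%:R * M ^+ 2 + 1.
have sK x : Num.sqrt (sqgrad x) <= K.
  have h := sqgrad_le x; have g0 := sqgrad_ge0 x.
  have K1 : 1 <= K by rewrite /K lerDr mulr_ge0// exprn_ge0.
  rewrite -[leRHS]ger0_norm; last by lra.
  rewrite -sqrtr_sqr ler_wsqrtr// (le_trans h)//.
  apply: (@le_trans _ _ K); first by rewrite /K lerDl.
  by rewrite expr2 ler_peMl//; lra.
have K0 : 0 <= K by apply: le_trans (sK point).
have mb := measurable_phibox mphi r0.
pose E := [set x | W x = m].
have mE : measurable E.
  have -> : E = setT `&` W @^-1` [set m] by rewrite setTI.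
  exact: mW.
pose Z := (\int[mu]_(x in E) (sqgrad x)%:E)%E.
have Z0 : (0 <= Z)%E by apply: integral_ge0 => x _; rewrite lee_fin sqgrad_ge0.
(* On [E] the truncation equals [m - k], and almost everywhere it is at most [m - k]. The tested
   inequality thus carries [(m - k)^2] on the left and [(m - k)^3] on the right; after division the
   right-hand side vanishes as [k] tends to [m]. *)
have Zk k : kappa <= k -> k < m ->
    ((3 * c0)%:E * Z <= (C1 * K * vol mu phi r0 * (m - k))%:E)%E.
  move=> hk hkm; have mk0 : 0 < m - k by rewrite subr_gt0.
  have mk2 : 0 < (m - k) ^+ 2 by rewrite exprn_gt0.
  have H := caccioppoli hk.
  have l1 : (((m - k) ^+ 2)%:E * ((3 * c0)%:E * Z) <=
      \int[mu]_x (3 * c0 * (pospart (W x - k) ^+ 2 * sqgrad x))%:E)%E.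
    rewrite muleA -EFinM /Z -ge0_integralZl//; last 3 first.
    - by apply/measurable_EFinP; exact: measurable_funTS.
    - by move=> x _; rewrite lee_fin sqgrad_ge0.
    - by rewrite lee_fin !mulr_ge0 ?ltW.
    apply: (@le_trans _ _ (\int[mu]_(x in E) (3 * c0 * (pospart (W x - k) ^+ 2 * sqgrad x))%:E)%E).
      rewrite le_eqVlt; apply/orP; left; apply/eqP; apply: eq_integral => x /set_mem xE.
      have [[h _]|[_ ->]] := pospartP (W x - k); first by move: h; rewrite xE leNgt mk0.
      by rewrite xE -EFinM; congr (_%:E); ring.
    apply: ge0_subset_integral => //.
    - by apply/measurable_EFinP/measurable_funM => //; exact: mX.
    - by move=> x _; rewrite lee_fin mulr_ge0 ?X0// mulr_ge0// ltW.
  have l2 : (\int[mu]_x (C1 * (pospart (W x - k) ^+ 3 * Num.sqrt (sqgrad x)))%:E <=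
      ((m - k) ^+ 2)%:E * (C1 * K * vol mu phi r0 * (m - k))%:E)%E.
    apply: (@le_trans _ _ (\int[mu]_x ((C1 * (m - k) ^+ 3 * K) * \1_(box phi r0) x)%:E)%E).
      apply: ae_ge0_le_integral => //.
      - by move=> x _; rewrite lee_fin !mulr_ge0 ?exprn_ge0 ?pospart_ge0// ltW.
      - apply/measurable_EFinP/measurable_funM => //; apply: measurable_funM => //.
        by apply: measurable_funX; exact: mPhi.
      - by move=> x _; rewrite lee_fin !mulr_ge0 ?exprn_ge0// ltW.
      - by apply/measurable_EFinP/measurable_funM => //; exact: measurable_indic.
      apply: filterS aeW_le => x hx _; rewrite lee_fin.
      case: (leP `|phi x| r0) => hr; last first.
        rewrite -/(Phi k x) Phi_out// expr0n mul0r mulr0 !mulr_ge0 ?exprn_ge0// ltW//.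
      rewrite indicE mem_set// mulr1 -mulrA; apply: ler_wpM2l; first exact: ltW.
      apply: ler_pM => //; first by rewrite exprn_ge0 ?pospart_ge0.
      rewrite lerXn2r ?nnegrE ?pospart_ge0 ?(ltW mk0)//.
      by have [[_ ->]|[_ ->]] := pospartP (W x - k); lra.
    under eq_integral do rewrite EFinM.
    rewrite ge0_integralZl//; last 2 first.
    - by apply/measurable_EFinP/measurable_indic.
    - by rewrite lee_fin !mulr_ge0 ?exprn_ge0 ?(ltW C10) ?(ltW mk0).
    rewrite integral_indic// setIT (volE box_fin) -!EFinM lee_fin le_eqVlt; apply/orP; left.
    by apply/eqP; ring.
  have := le_trans l1 (le_trans H l2).
  by rewrite lee_pmul2l// ?lte_fin.
have Zeq0 : Z = 0%E.
  apply/eqP; rewrite eq_le Z0 andbT.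
  pose B := C1 * K * vol mu phi r0.
  have B0 : 0 <= B by rewrite !mulr_ge0 ?vol_ge0// ltW.
  apply/lee_addgt0Pr => e e0; rewrite add0e.
  have ce : 0 < 3 * c0 by rewrite mulr_gt0.
  (* The first entry keeps the level [m - t] at or above [kappa], the second makes [B t] at most
     [3 c0 e]; [B + 1] avoids a division by zero. *)
  pose t := Num.min (m - kappa) (3 * c0 * e / (B + 1)).
  have t0 : 0 < t.
    by rewrite lt_min subr_gt0 kltm/= divr_gt0 ?mulr_gt0// ltr_wpDl.
  have tk : t <= m - kappa by rewrite ge_min lexx.
  have te : t <= 3 * c0 * e / (B + 1) by rewrite ge_min lexx orbT.
  have := Zk (m - t) _ _; rewrite (_ : m - (m - t) = t); last by ring.
  have kt : kappa <= m - t by lra.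
  have mt : m - t < m by lra.
  move=> /(_ kt mt) H.
  rewrite -(@lee_pmul2l _ (3 * c0)%:E)//; apply: le_trans H _.
  rewrite -EFinM lee_fin; move: te; rewrite ler_pdivlMr ?ltr_wpDl// => te.
  apply: le_trans te; rewrite -/B mulrC ler_wpM2l ?(ltW t0)// lerDl//.
pose P := [set x | 0 < sqgrad x].
have mP : measurable P.
  rewrite (_ : P = setT `&` sqgrad @^-1` `]0, +oo[%classic); first exact: mS.
  by rewrite setTI; apply/seteqP; split => x /=; rewrite in_itv/= andbT.
have EP0 : mu (E `&` P) = 0%E by apply: integral_eq0_null => // x; exact: sqgrad_ge0.
(* Levels that start at [kappa] for [j = 0] and increase to [m]. *)
pose kk (j : nat) := m - (m - kappa) / j.+1%:R.
have dm0 : 0 < m - kappa by rewrite subr_gt0.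
have kk1 j : kappa <= kk j.
  have h : (m - kappa) / j.+1%:R <= m - kappa by rewrite ler_pdivrMr// ler_peMr ?ler1n// ltW.
  by rewrite /kk; move: h; set q := _ / _ => h; lra.
have kk2 j : kk j < m by rewrite /kk ltrBlDr ltrDl divr_gt0.
pose A j := [set x | kk j < W x] `&` P.
have mA j : measurable (A j) by apply: measurableI.
have AB j : A j `<=` box phi r0.
  move=> x [/= kx _]; rewrite /box/= leNgt; apply/negP => hx.
  by have [_ _ W0] := hW; have k1 := kk1 j; have k0 := kappa0; move: kx; rewrite W0// => kx; lra.
(* A point of every [A j] satisfies [m <= W x]: it lies in the null set where [m < W], or in [E]
   with nonzero gradient, and that set is null as well. *)
have A0 : mu (\bigcap_j A j) = 0%E.
  apply/eqP; rewrite eq_le measure_ge0 andbT.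
  have <- : mu ([set x | m < W x] `|` (E `&` P)) = 0%E.
    apply/eqP; rewrite eq_le measure_ge0 andbT.
    apply: le_trans (measureU2 _ _ _) _ => //; first exact: measurableI.
    rewrite [leLHS](_ : _ = 0 + 0)%E; first by rewrite adde0.
    by congr (_ + _)%E; [exact: above|exact: EP0].
  apply: le_measure; rewrite ?inE; first exact: bigcapT_measurable.
    by apply: measurableU => //; exact: measurableI.
  move=> x Ax; case: (ltgtP m (W x)) => h; [by left| |by right; split => //; have [] := Ax 0].
  have d0 : 0 < (m - W x) / (m - kappa) by rewrite divr_gt0// subr_gt0.
  have [j _ /(_ j (leqnn _)) hj] := near_infty_natSinv_lt (PosNum d0).
  have [+ _] := Ax j I; rewrite /= /kk; move: hj; rewrite /= ltr_pdivlMr// mulrC.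
  by set q := _ / _ => h1 h2; exfalso; lra.
have Acv : mu \o A @ \oo --> (0 : \bar R).
  rewrite -A0; apply: nonincreasing_cvg_mu => //.
  - apply: le_lt_trans (box_fin r0); apply: le_measure; rewrite ?inE//; exact: AB.
  - exact: bigcapT_measurable.
  move=> i j ij; apply/subsetPset => x [/= h1 h2]; split => //=.
  apply: le_lt_trans h1; rewrite /kk lerB// ler_pM2l// lef_pV2 ?posrE// ler_nat ltnS//.
(* Chosen so that [C1^2 / (4 c0) * eta = c0]: the phi^4 term of Young's inequality, estimated by
   Faber-Krahn, costs one more [c0 * X k]. *)
pose eta := 4 * c0 ^+ 2 / C1 ^+ 2.
have eta0 : 0 < eta by rewrite divr_gt0 ?mulr_gt0 ?exprn_gt0.
have [theta th0 hth] := faber_krahn_limit eta0.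
have [j hj] : exists j, (mu (A j) <= theta%:E)%E.
  have /fine_cvgP[h1 /cvgrPdist_lt/(_ _ th0) h2] := Acv.
  have [j _ /(_ j (leqnn _))/= [h3 h4]] := filterI h1 h2.
  exists j; rewrite -(fineK h3) lee_fin ltW//.
  by move: h4; rewrite sub0r normrN; apply: le_lt_trans; exact: ler_norm.
set k := kk j in hj; have hk : kappa <= k := kk1 j; have km2 : k < m := kk2 j.
have mPhi4 : measurable_fun setT (fun x => (C1 ^+ 2 / (4 * c0)) * Phi k x ^+ 4).
  by apply: measurable_funM => //; apply: measurable_funX; exact: mPhi.
have b0 : 0 <= C1 ^+ 2 / (4 * c0) by rewrite divr_ge0 ?exprn_ge0 ?mulr_ge0// ltW.
have Xk : X k \is a fin_num := X_fin hk.
have X00 : (0 <= X k)%E by apply: integral_ge0 => x _; rewrite lee_fin.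
(* Young's inequality is applied on [A j]; off [A j] the right-hand integrand vanishes, because phi
   or the gradient does. So phi^4 is integrated over [A j] alone, whose measure is small. *)
have XH : ((3 * c0)%:E * X k <= c0%:E * X k + c0%:E * X k)%E.
  have <- : (\int[mu]_x (3 * c0 * (pospart (W x - k) ^+ 2 * sqgrad x))%:E = (3 * c0)%:E * X k)%E.
    under eq_integral do rewrite EFinM.
    rewrite ge0_integralZl//; last by rewrite lee_fin mulr_ge0// ltW.
    + by apply/measurable_EFinP; exact: mX.
    + by move=> x _; rewrite lee_fin; exact: X0.
  apply: le_trans (caccioppoli hk) _.
  apply: (@le_trans _ _ (\int[mu]_x ((c0 * (Phi k x ^+ 2 * sqgrad x))%:E +
     ((fun x => (C1 ^+ 2 / (4 * c0) * Phi k x ^+ 4)%:E) \_ (A j)) x))%E).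
    apply: ge0_le_integral => //.
    - by move=> x _; rewrite lee_fin !mulr_ge0 ?exprn_ge0 ?pospart_ge0// ltW.
    - apply/measurable_EFinP/measurable_funM => //; apply: measurable_funM => //.
      by apply: measurable_funX; exact: mPhi.
    - apply: emeasurable_funD.
        by apply/measurable_EFinP/measurable_funM => //; exact: mX.
      apply/(measurable_restrictT _ (mA j))/measurable_funTS/measurable_EFinP; exact: mPhi4.
    move=> x _; rewrite patchE -/(Phi k x); case: ifPn => hx.
      rewrite -EFinD lee_fin; set s := Num.sqrt _.
      have -> : sqgrad x = s ^+ 2 by rewrite sqr_sqrtr// sqgrad_ge0.
      rewrite -subr_ge0.
      have -> : c0 * (Phi k x ^+ 2 * s ^+ 2) + C1 ^+ 2 / (4 * c0) * Phi k x ^+ 4 -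
        C1 * (Phi k x ^+ 3 * s) = (4 * c0)^-1 * (Phi k x * (2 * c0 * s - C1 * Phi k x)) ^+ 2.
        by field; rewrite gt_eqF.
      by rewrite mulr_ge0 ?sqr_ge0// invr_ge0 mulr_ge0// ltW.
    rewrite adde0 lee_fin.
    have [p0|->] : Phi k x = 0 \/ sqgrad x = 0.
        case: (ltP 0 (sqgrad x)) => hS'; last first.
          by right; apply/eqP; rewrite eq_le hS' sqgrad_ge0.
        left; rewrite /Phi; have [[_ ->]//|[h _]] := pospartP (W x - k).
        by move/negP: hx; case; apply/mem_set; split => //=; rewrite -/k -subr_gt0.
      by rewrite p0 !expr0n/= !mul0r !mulr0.
    by rewrite sqrtr0 !mulr0.
  rewrite ge0_integralD//; first last.
  - apply/(measurable_restrictT _ (mA j))/measurable_funTS/measurable_EFinP; exact: mPhi4.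
  - by move=> x _; rewrite patchE; case: ifP => // _; rewrite lee_fin mulr_ge0// exprn_ge0// pospart_ge0.
  - by apply/measurable_EFinP/measurable_funM => //; exact: mX.
  - by move=> x _; rewrite lee_fin mulr_ge0 ?X0// ltW.
  rewrite -integral_mkcond; apply: leeD.
    under eq_integral do rewrite EFinM.
    rewrite ge0_integralZl//; last by rewrite lee_fin ltW.
    + by apply/measurable_EFinP; exact: mX.
    + by move=> x _; rewrite lee_fin; exact: X0.
  under eq_integral do rewrite EFinM.
  rewrite ge0_integralZl//.
  - apply: (@le_trans _ _ ((C1 ^+ 2 / (4 * c0))%:E * (eta%:E * X k))%E).
      by apply: lee_wpmul2l; rewrite ?lee_fin//; exact: hth.
    rewrite muleA -EFinM (_ : C1 ^+ 2 / (4 * c0) * eta = c0)// /eta.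
    by field; rewrite !gt_eqF.
  - by apply/measurable_EFinP/measurable_funTS; apply: measurable_funX; exact: mPhi.
  - by move=> x _; rewrite lee_fin exprn_ge0// pospart_ge0.
have Xz : X k = 0%E.
  move: XH X00; rewrite -(fineK Xk) -!EFinM -EFinD !lee_fin => h1 h2.
  congr (_%:E); apply/eqP; rewrite eq_le h2 andbT.
  have h3 : c0 * fine (X k) <= 0 by move: h1; lra.
  by rewrite -(pmulr_rle0 _ c00).
(* With [X k = 0] the Poincare inequality makes phi^4 vanish almost everywhere, which contradicts
   [below] at the level [k < m]. *)
have [L] := poincare_limit hk; rewrite Xz mule0 => hL.
have : mu (setT `&` [set x | 0 < Phi k x ^+ 4]) = 0%E.
  apply: integral_eq0_null => //.
  - by apply: measurable_funX; exact: mPhi.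
  - by move=> x; rewrite exprn_ge0// pospart_ge0.
  apply/eqP; rewrite eq_le hL integral_ge0// => x _.
  by rewrite lee_fin exprn_ge0// pospart_ge0.
move=> h; have /eqP[] := below k hk km2; rewrite -h; congr (mu _).
rewrite setTI; apply/seteqP; split => x /=.
  move=> kx; apply: exprn_gt0; rewrite /Phi.
  by have [[h1 _]|[_ ->]] := pospartP (W x - k); lra.
move=> hx; rewrite ltNge; apply/negP => kx.
have z : Phi k x = 0 by rewrite /Phi; have [[_ ->]//|[h1 _]] := pospartP (W x - k); exfalso; lra.
by move: hx; rewrite z expr0n/= ltxx.
Qed.

End LevelSets.

(** * Structural estimates *)

Section PowerIncrement.
Context {R : realType}.

Lemma bernoulli_compl (m : nat) (r : R) : 0 <= r <= 1 -> 1 - r ^+ m <= m%:R * (1 - r).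
Proof.
move=> /andP[r0 r1]; elim: m => [|m IH]; first by rewrite expr0 subrr mul0r.
have h : r * (1 - r ^+ m) <= m%:R * (1 - r).
  apply: le_trans IH; rewrite ler_piMl// subr_ge0 exprn_ile1//.
by rewrite exprS -natr1 mulrDl mul1r; move: h; rewrite mulrBr mulr1; lra.
Qed.

(** For the ratio r = t / s in [0,1] one has r^m <= r^sigma, which replaces the real exponent by a
    natural one; Bernoulli's inequality then stands in for the mean value theorem. *)
Lemma powR_increment (sigma s t : R) (m : nat) : 0 < sigma -> sigma <= m%:R -> 0 <= t <= s -> 0 < s ->
  s `^ sigma - t `^ sigma <= m%:R * (s `^ sigma / s) * (s - t).
Proof.
move=> s0 sm /andP[t0 ts] sp.
pose r := t / s.
have r01 : 0 <= r <= 1 by rewrite divr_ge0 ?(ltW sp)//= ler_pdivrMr// mul1r.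
have tE : t = r * s by rewrite divfK// gt_eqF.
have [r0 r1] := andP r01.
have h : r ^+ m <= r `^ sigma.
  have [->|rn0] := eqVneq r 0.
    case: m sm => [|m] sm; first by move: (lt_le_trans s0 sm); rewrite ltxx.
    by rewrite expr0n/= powR_ge0.
  rewrite -powR_mulrn// /powR (negbTE rn0) ler_expR.
  by rewrite ler_wnM2r// ln_le0.
have := bernoulli_compl m r01.
have -> : m%:R * (s `^ sigma / s) * (s - t) = s `^ sigma * (m%:R * (1 - r)).
  by rewrite tE; field; rewrite gt_eqF.
have -> : s `^ sigma - t `^ sigma = s `^ sigma * (1 - r `^ sigma).
  by rewrite {1}tE powRM//; [ring|exact: ltW].
move=> hb; apply: ler_wpM2l; first exact: powR_ge0.
by apply: le_trans hb; rewrite lerB.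
Qed.

(** For [sigma < 1] the power is not Lipschitz at 0, and an additive error is the price; in
    [source_bound] the strict growth of [f] pays for it. *)
Lemma powR_increment_eps (sigma N e : R) : 0 < sigma -> 0 <= N -> 0 < e ->
  exists2 L, 0 <= L & forall s t, 0 <= s <= N -> 0 <= t <= N ->
    `|s `^ sigma - t `^ sigma| <= e + L * `|s - t|.
Proof.
move=> s0 N0 e0; have [m sm] : exists m : nat, sigma <= m%:R.
  by exists (Num.trunc sigma).+1; rewrite ltW// truncnS_gt.
(* The threshold satisfies h^sigma = e. If the larger argument [s] is at most [h], the increment is
   at most [e]; beyond [h] the slope s^sigma / s is at most N^sigma / h. *)
pose h := e `^ sigma^-1; have h0 : 0 < h by exact: powR_gt0.
have hE : h `^ sigma = e by rewrite /h -powRrM mulVf ?gt_eqF// powRr1// ltW.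
pose L := m%:R * (N `^ sigma / h).
have L0 : 0 <= L by rewrite mulr_ge0// divr_ge0 ?powR_ge0// ltW.
exists L => //.
suff H s t : 0 <= s <= N -> 0 <= t <= s -> `|s `^ sigma - t `^ sigma| <= e + L * `|s - t|.
  move=> s t hs ht; case: (leP t s) => ts.
    by apply: H => //; move: ht => /andP[-> _].
  rewrite distrC [`|s - t|]distrC; apply: H => //; move: hs => /andP[-> _]; exact: ltW.
move=> /andP[sge sN] /andP[t0 ts].
have mono x y : 0 <= x -> x <= y -> x `^ sigma <= y `^ sigma.
  move=> x0 xy; apply: ge0_ler_powR => //; rewrite ?nnegrE ?(ltW s0)//; exact: le_trans xy.
rewrite ger0_norm ?subr_ge0 ?mono// (ger0_norm (_ : 0 <= s - t)) ?subr_ge0//.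
case: (leP s h) => sh.
  apply: (@le_trans _ _ e); last by rewrite lerDl mulr_ge0// subr_ge0.
  by rewrite lerBlDr -hE (le_trans (mono _ _ sge sh))// lerDl powR_ge0.
have sp : 0 < s by exact: lt_trans sh.
apply: le_trans (powR_increment s0 sm _ sp) _; first by rewrite t0.
apply: (@le_trans _ _ (L * (s - t))); last by rewrite lerDr ltW.
apply: ler_wpM2r; rewrite ?subr_ge0// /L; apply: ler_wpM2l => //.
by apply: ler_pM; rewrite ?powR_ge0 ?invr_ge0 ?(ltW sp)// ?mono// lef_pV2 ?posrE// ltW.
Qed.

Lemma powR_increment_lip (sigma N : R) : 1 <= sigma -> 0 <= N ->
  exists2 L, 0 <= L & forall s t, 0 <= s <= N -> 0 <= t <= N ->
    `|s `^ sigma - t `^ sigma| <= L * `|s - t|.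
Proof.
move=> s1 N0; have s0 : 0 < sigma by exact: lt_le_trans s1.
have [m sm] : exists m : nat, sigma <= m%:R.
  by exists (Num.trunc sigma).+1; rewrite ltW// truncnS_gt.
pose L := m%:R * N `^ (sigma - 1).
have L0 : 0 <= L by rewrite mulr_ge0// powR_ge0.
exists L => //.
suff H s t : 0 <= s <= N -> 0 <= t <= s -> `|s `^ sigma - t `^ sigma| <= L * `|s - t|.
  move=> s t hs ht; case: (leP t s) => ts.
    by apply: H => //; move: ht => /andP[-> _].
  rewrite distrC [`|s - t|]distrC; apply: H => //; move: hs => /andP[-> _]; exact: ltW.
move=> /andP[sge sN] /andP[t0 ts].
have mono x y r : 0 <= r -> 0 <= x -> x <= y -> x `^ r <= y `^ r.
  by move=> r0 x0 xy; apply: ge0_ler_powR => //; rewrite ?nnegrE//; exact: le_trans xy.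
rewrite ger0_norm ?subr_ge0 ?mono ?(ltW s0)// (ger0_norm (_ : 0 <= s - t)) ?subr_ge0//.
move: sge; rewrite le_eqVlt => /orP[/eqP sz|sp].
  have -> : t = s by apply/eqP; rewrite eq_le ts -sz.
  by rewrite !subrr mulr0.
apply: le_trans (powR_increment s0 sm _ sp) _; first by rewrite t0.
apply: ler_wpM2r; rewrite ?subr_ge0// /L; apply: ler_wpM2l => //.
have sn0 : s != 0 by rewrite gt_eqF.
have -> : s `^ sigma / s = s `^ (sigma - 1) by rewrite powRB ?sn0 ?implybT// powRr1// ltW.
by apply: mono => //; rewrite ?subr_ge0// ltW.
Qed.

End PowerIncrement.

Section EuclideanNorm.
Context {R : realType} {n : nat}.
Local Notation V := 'rV[R]_n.+1.
Implicit Types x y : V.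

Lemma enorm_ge0 x : 0 <= enorm x.
Proof. exact: sqrtr_ge0. Qed.

Lemma sqr_enorm x : enorm x ^+ 2 = dotv x x.
Proof. by rewrite /enorm sqr_sqrtr// sqnorm_ge0. Qed.

Lemma coord_le_enorm x i : `|x ord0 i| <= enorm x.
Proof. by rewrite -sqrtr_sqr ler_wsqrtr// sqnorm_coord. Qed.

Lemma enorm_le x (M : R) : (forall i, `|x ord0 i| <= M) -> enorm x <= n.+1%:R * M.
Proof.
move=> h; have M0 : 0 <= M by exact: le_trans (normr_ge0 _) (h ord0).
have N1 : 1 <= n.+1%:R :> R by rewrite ler1n.
have NM0 : 0 <= n.+1%:R * M by rewrite mulr_ge0.
rewrite -[leRHS]ger0_norm// -sqrtr_sqr ler_wsqrtr//.
apply: (@le_trans _ _ (n.+1%:R * M ^+ 2)).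
  have -> : n.+1%:R * M ^+ 2 = \sum_(i < n.+1) M ^+ 2 by rewrite sumr_const card_ord mulr_natl.
  apply: ler_sum => i _; rewrite -expr2 -real_normK ?num_real// lerXn2r ?nnegrE//; exact: h.
by rewrite exprMn ler_wpM2r ?sqr_ge0// expr2 ler_peMl.
Qed.

(** The difference of the squares is bounded coordinate by coordinate; this costs the factor
    [n + 1], which disappears in the constant of [source_bound]. *)
Lemma enorm_diff_le x y : `|enorm x - enorm y| <= n.+1%:R * enorm (x - y).
Proof.
set A := enorm x; set B := enorm y.
have A0 : 0 <= A := enorm_ge0 x; have B0 : 0 <= B := enorm_ge0 y.
have ABE : (A - B) * (A + B) = \sum_i (x ord0 i - y ord0 i) * (x ord0 i + y ord0 i).
  rewrite -subr_sqr !sqr_enorm /dotv -sumrB; apply: eq_bigr => i _; ring.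
have [AB|AB] := eqVneq (A + B) 0.
  have -> : A = 0 by lra.
  have -> : B = 0 by lra.
  by rewrite subrr normr0 mulr_ge0// enorm_ge0.
have ABp : 0 < A + B by rewrite lt_neqAle eq_sym AB addr_ge0.
rewrite -(ler_pM2r ABp) -{1}(ger0_norm (ltW ABp)) -normrM ABE.
apply: le_trans (ler_norm_sum _ _ _) _.
have -> : n.+1%:R * enorm (x - y) * (A + B) = \sum_(i < n.+1) enorm (x - y) * (A + B).
  by rewrite sumr_const card_ord -[RHS]mulr_natl mulrA.
apply: ler_sum => i _; rewrite normrM; apply: ler_pM => //.
  by have := coord_le_enorm (x - y) i; rewrite !mxE.
by apply: le_trans (ler_normD _ _) _; rewrite lerD// coord_le_enorm.
Qed.

End EuclideanNorm.

(** * Compact subsets of the domain and measurable preimages *)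

Lemma compact_open_margin {R : realType} {M : normedModType R} (K O : set M) :
  compact K -> open O -> K `<=` O ->
  exists2 e : R, 0 < e & forall x y, K x -> `|y - x| <= e -> O y.
Proof.
move=> cK oO KO.
have cov : near_covering K by exact/compact_near_coveringP.
pose P (e : R) (x : M) := forall y, `|y - x| <= e -> O y.
have H : \forall e \near (0 : R)^'+, K `<=` P e.
  apply: cov => x Kx.
  have [t /= t0 ht] : exists2 t : R, 0 < t & forall y, `|y - x| <= t -> O y.
    have : nbhs x O by exact: open_nbhs_nbhs (conj oO (KO _ Kx)).
    move=> /nbhs_normP[t /= t0 ht]; exists (t / 2); first by rewrite divr_gt0.
    by move=> y hy; apply: ht => /=; rewrite distrC (le_lt_trans hy)// ltr_pdivrMr// ltr_pMr// ltr1n.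
  have t20 : 0 < t / 2 by rewrite divr_gt0.
  near=> x' e => y hy.
  have hx' : `|x' - x| <= t / 2 by near: x'; exact: near_dist_le.
  have he : e <= t / 2 by near: e; exact: nbhs_right_le.
  apply: ht; rewrite -(subrK x' y) -addrA (splitr t); apply: le_trans (ler_normD _ _) _.
  by rewrite lerD// (le_trans hy).
near (0 : R)^'+ => e; exists e; first by near: e; exact: nbhs_right_gt.
have : K `<=` P e by near: e.
by move=> KP x y /KP; exact.
Unshelve. all: by end_near. Qed.

Section CompactSets.
Context {R : realType} {n : nat}.
Local Notation V := 'rV[R]_n.+1.

Lemma bounded_subset_box (A : set V) : bounded_set A -> exists2 r : R, 0 <= r & A `<=` [set v | `|v| <= r].
Proof.
move=> [r [_ h]]; exists (Num.max 0 (r + 1)); first by rewrite le_max lexx.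
by move=> v Av /=; apply: (h _ _ v Av); rewrite lt_max ltrDl ltr01 orbT.
Qed.

Lemma compact_closure_bounded (A : set V) (r : R) : A `<=` [set v | `|v| <= r] -> compact (closure A).
Proof.
move=> Ar; apply: (subclosed_compact _ (@box_compact R n r)); first exact: closed_closure.
rewrite [X in _ `<=` X](closure_id _).1; first exact: closureS.
by apply: compact_closed; [exact: norm_hausdorff|exact: box_compact].
Qed.

(** Here the boundary condition enters: it keeps limit points of the superlevel set off the
    boundary, so the closure of that set, bounded with [O], is a compact subset of [O]. *)
Lemma bdry_superlevel_compact (O : set V) (u v : V -> R) (kappa : R) : bounded_set O ->
  bdry_le O u v -> 0 < kappa ->
  exists K, [/\ compact K, K `<=` O & forall x, O x -> kappa < u x - v x -> K x].
Proof.
move=> bO bd k0; pose B := [set x | O x /\ kappa < u x - v x].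
have [r _ hr] := bounded_subset_box bO.
exists (closure B); split.
- by apply: (@compact_closure_bounded _ r) => x [/hr].
- move=> y By; apply: contrapT => nOy.
  have cy : closure O y by apply: closureS By => x [].
  have [x [[Ox hx] /= /(_ Ox)]] := By _ (bd y cy nOy _ k0).
  by rewrite leNgt hx.
- by move=> x Ox hx; apply: subset_closure.
Qed.

(** Room for the mollification: kernels of radius at most [r] centred in [K] live in a compact
    subset of [O]. *)
Lemma compact_neighborhood (K O : set V) : compact K -> open O -> K `<=` O ->
  exists (r : R) (K1 : set V), [/\ 0 < r, compact K1, K1 `<=` O &
    forall x y, K x -> `|y - x| <= r -> K1 y].
Proof.
move=> cK oO KO.
have [e e0 KP] := compact_open_margin cK oO KO.
pose B := [set y | exists2 x, K x & `|y - x| <= e / 2].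
have e20 : 0 < e / 2 by rewrite divr_gt0.
have [s s0 hs] := bounded_subset_box (compact_bounded cK).
exists (e / 2), (closure B); split => //.
- apply: (@compact_closure_bounded _ (s + e / 2)) => y [x Kx hy] /=.
  rewrite -(subrK x y) addrC; apply: le_trans (ler_normD _ _) _.
  by rewrite lerD//; exact: hs.
- move=> y By; have [z [[x Kx zx] zy]] := By _ (near_dist_le y e20).
  apply: (KP x _ Kx); rewrite -(subrK z y) -addrA (splitr e); apply: le_trans (ler_normD _ _) _.
  by rewrite lerD// distrC.
by move=> x y Kx xy; apply: subset_closure; exists x.
Qed.

(** [G] is the distance to [A]. It turns closed sets into sublevel sets of continuous functions,
    whose preimages are measurable as soon as the coordinates of [phi] are. *)
Lemma closed_zero_set (A : set V) : closed A -> A !=set0 ->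
  exists2 G : V -> R, continuous G & A = [set v | G v <= 0].
Proof.
move=> clA [a0 Aa0]; pose S (v : V) : set R := [set `|v - a| | a in A].
have S0 v : S v !=set0 by exists `|v - a0|, a0.
have lb v : has_lbound (S v) by exists 0 => _ [a _ <-].
exists (fun v => inf (S v)).
  apply: (@locally_lipschitz_continuous _ _ _ 1) => // x y _; rewrite mul1r.
  have H (v w : V) : inf (S v) <= inf (S w) + `|v - w|.
    rewrite -lerBlDr; apply: lb_le_inf => // _ [a Aa <-]; rewrite lerBlDr.
    apply: le_trans (_ : `|v - a| <= _); first by apply: ge_inf => //; exists a.
    by have := ler_normD (v - w) (w - a); rewrite addrA subrK [leRHS]addrC; exact.
  rewrite ler_norml; apply/andP; split.
    by rewrite lerNl opprB lerBlDr addrC distrC.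
  by rewrite lerBlDr addrC.
apply/seteqP; split => v /=.
  by move=> Av; apply: ge_inf => //; exists v => //; rewrite subrr normr0.
move=> h; apply: clA => B /nbhs_normP[e /= e0 he].
have [_ [a Aa <-] hlt] : exists2 s, S v s & s < e.
  by apply: inf_lt => //; exact: le_lt_trans h e0.
by exists a; split => //; exact: he.
Qed.

Lemma within_compact_bound {T : topologicalType} (h : T -> R) (D K : set T) :
  {within D, continuous h} -> compact K -> K `<=` D -> exists2 C : R, 0 <= C & forall z, K z -> `|h z| <= C.
Proof.
move=> ch cK KD; have chK := continuous_subspaceW KD ch.
have /compact_bounded[r [_ hr]] := continuous_compact chK cK.
exists (Num.max 0 (r + 1)); first by rewrite le_max lexx.
move=> z Kz; apply: (hr (Num.max 0 (r + 1))); first by rewrite lt_max ltrDl ltr01 orbT.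
by exists z.
Qed.

End CompactSets.

Section MeasurablePreimages.
Context {R : realType} {d} {T : measurableType d} {n : nat}.
Local Notation V := 'rV[R]_n.+1.
Variable phi : T -> V.
Hypothesis mphi : forall i, measurable_fun setT (fun x => phi x ord0 i).

Lemma measurable_closed_preimage (A : set V) : closed A -> measurable (phi @^-1` A).
Proof.
move=> cA; have [->|/set0P A0] := eqVneq A set0; first by rewrite preimage_set0.
have [G cG ->] := closed_zero_set cA A0.
have mG := measurable_continuous_comp measurableT cG mphi.
rewrite (_ : _ @^-1` _ = setT `&` (fun x => G (phi x)) @^-1` `]-oo, 0]%classic).
  exact: mG.
by rewrite setTI; apply/seteqP; split => x /=; rewrite in_itv.
Qed.

Lemma measurable_open_preimage (O : set V) : open O -> measurable (phi @^-1` O).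
Proof.
by move=> oO; rewrite -(setCK O) preimage_setC; apply: measurableC; exact: (@measurable_closed_preimage (~` O) (open_closedC oO)).
Qed.

Lemma measurable_within_continuous (O : set V) (h : V -> R) : open O ->
  {within O, continuous h} -> measurable_fun (phi @^-1` O) (fun x => h (phi x)).
Proof.
move=> oO; rewrite continuous_open_subspace// => ch.
refine (measurability _ (RGenOInfty.measurableE R) _) => _ [_ [c ->] <-].
rewrite (_ : _ `&` _ = phi @^-1` (O `&` h @^-1` [set t | c < t])); last first.
  by apply/seteqP; split => x /= [Ox]; rewrite in_itv/= andbT.
apply: measurable_open_preimage; rewrite openE => v [Ov /= cv].
have h1 : nbhs v O by exact: open_nbhs_nbhs.
have h2 : nbhs v (h @^-1` [set t | c < t]).
  apply: (ch v (mem_set Ov)); apply: open_nbhs_nbhs; split => //; exact: open_gt.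
exact: filterI h1 h2.
Qed.

End MeasurablePreimages.

(** * Bounds for the flux and the source *)

Section Structure.
Context {R : realType} {n : nat}.
Local Notation V := 'rV[R]_n.+1.

(** Since [p < 2] the weight decreases as the gradients grow, so a bound on the gradients bounds it
    from below. *)
Lemma strong_monotonicity_bounded (p gamma M : R) (a : V -> V) : p < 2 -> 0 < gamma -> 0 <= M ->
  (forall xi eta : V, gamma * (1 + enorm xi + enorm eta) `^ (p - 2) * enorm (xi - eta) ^+ 2
     <= dotv (a xi - a eta) (xi - eta)) ->
  forall xi eta : V, (forall i, `|xi ord0 i| <= M) -> (forall i, `|eta ord0 i| <= M) ->
  gamma * (1 + 2 * (n.+1%:R * M)) `^ (p - 2) * dotv (xi - eta) (xi - eta)
     <= dotv (a xi - a eta) (xi - eta).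
Proof.
move=> p2 g0 M0 H xi eta hx he; apply: le_trans (H xi eta).
rewrite -sqr_enorm; apply: ler_wpM2r; first exact: sqr_ge0.
apply: ler_wpM2l; first exact: ltW.
have e1 := enorm_le hx; have e2 := enorm_le he.
have x0 := enorm_ge0 xi; have y0 := enorm_ge0 eta.
have -> : p - 2 = - (2 - p) by ring.
have A0 : 0 < 1 + enorm xi + enorm eta by rewrite -addrA ltr_pwDl// addr_ge0.
have AB : 1 + enorm xi + enorm eta <= 1 + 2 * (n.+1%:R * M) by lra.
have B0 := lt_le_trans A0 AB.
rewrite !powRN lef_pV2 ?posrE ?powR_gt0//.
apply: ge0_ler_powR => //; rewrite ?nnegrE; [lra|exact: ltW|exact: ltW].
Qed.

(** The increment of [f] over the fixed step [kappa] is continuous and positive, so it has a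
    positive minimum for [x] in [K] and [|t| <= M]. For steps tending to 0 no such uniform gap could
    be expected. *)
Lemma strict_increment_lower (O K : set V) (f : V -> R -> R) (M kappa : R) :
  open O -> compact K -> K `<=` O -> 0 < kappa ->
  {within [set z : V * R | O z.1], continuous (fun z => f z.1 z.2)} ->
  (forall x, O x -> {homo f x : s t / s < t}) ->
  exists2 delta, 0 < delta & forall x t, K x -> `|t| <= M -> f x t + delta <= f x (t + kappa).
Proof.
move=> oO cK KO k0 cf fi.
pose A := K `*` [set t : R | `|t| <= M].
have cA : compact A.
  apply: compact_setX => //; rewrite (_ : [set _ | _] = `[- M, M]%classic).
    exact: segment_compact.
  by apply/seteqP; split => t /=; rewrite in_itv/= -ler_norml.
have oP : open [set z : V * R | O z.1].
  rewrite (_ : [set _ | _] = fst @^-1` O)//; apply: open_comp => // z _; exact: cvg_fst.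
move: cf; rewrite continuous_open_subspace// => cf.
pose h (z : V * R) := f z.1 (z.2 + kappa) - f z.1 z.2.
have ch : {within A, continuous h}.
  apply: continuous_in_subspaceT => -[x t] /set_mem[/= Kx _].
  apply: cvgB; last by apply: (cf (x, t)); rewrite inE/=; exact: KO.
  apply: (continuous_comp (f := fun z : V * R => (z.1, z.2 + kappa)) (g := fun z => f z.1 z.2)).
    have c1 : (fun z : V * R => z.1) @ (x, t) --> x by exact: cvg_fst.
    have c2 : (fun z : V * R => z.2 + kappa) @ (x, t) --> t + kappa.
      by apply: cvgD; [exact: cvg_snd|exact: cvg_cst].
    exact: (cvg_pair c1 c2).
  by apply: (cf (x, t + kappa)); rewrite inE/=; exact: KO.
have [[z0 Az0]|A0] := pselect (A !=set0); last first.
  by exists 1 => // x t Kx tM; exfalso; apply: A0; exists (x, t).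
have [[x0 t0] /set_mem[/= Kx0 _] hmin] := compact_EVT_min (ex_intro _ z0 Az0) cA ch.
exists (h (x0, t0)).
  by rewrite /h/= subr_gt0; apply: (fi _ (KO _ Kx0)); rewrite ltrDl.
move=> x t Kx tM; have : h (x0, t0) <= h (x, t) by apply: hmin; rewrite inE.
by rewrite {2}/h/=; lra.
Qed.

(** Since [t < s], monotonicity of [g] allows [g x t] in place of [g x s] in the last term, and what
    remains is [g x t] times an increment of the power. This is Lipschitz for [sigma >= 1]; for
    [sigma < 1] its additive error is absorbed by the gap of [f]. *)
Lemma source_bound (O K : set V) (f g : V -> R -> R) (sigma M kappa : R) :
  open O -> compact K -> K `<=` O -> 0 < kappa -> 0 <= M -> 0 < sigma ->
  {within [set z : V * R | O z.1], continuous (fun z => f z.1 z.2)} ->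
  {within [set z : V * R | O z.1], continuous (fun z => g z.1 z.2)} ->
  (forall x, O x -> {homo f x : s t / s <= t}) ->
  (forall x, O x -> {homo g x : s t / s <= t}) ->
  ((sigma < 1 /\ forall x, O x -> {homo f x : s t / s < t}) \/ 1 <= sigma) ->
  exists2 C, 0 < C & forall x s t (xi eta : V), K x -> `|s| <= M -> `|t| <= M -> kappa < s - t ->
    (forall i, `|xi ord0 i| <= M) -> (forall i, `|eta ord0 i| <= M) ->
    f x t + g x t * enorm eta `^ sigma - f x s - g x s * enorm xi `^ sigma <= C * enorm (xi - eta).
Proof.
move=> oO cK KO k0 M0 s0 cf cg fm gm cases.
have cA : compact (K `*` [set t : R | `|t| <= M]).
  apply: compact_setX => //; rewrite (_ : [set _ | _] = `[- M, M]%classic).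
    exact: segment_compact.
  by apply/seteqP; split => t /=; rewrite in_itv/= -ler_norml.
have [Cg Cg0 hCg] := within_compact_bound cg cA (fun z Az => KO _ Az.1).
pose N := n.+1%:R * M; have N0 : 0 <= N by rewrite mulr_ge0.
have [L L0 hL] : exists2 L, 0 <= L & forall x s t y z, K x -> `|t| <= M -> kappa < s - t ->
    0 <= y <= N -> 0 <= z <= N -> f x t + Cg * `|y `^ sigma - z `^ sigma| <= f x s + L * `|y - z|.
  case: cases => [[_ fi]|s1].
    have [delta d0 hd] := @strict_increment_lower O K f M kappa oO cK KO k0 cf fi.
    (* [Cg] times this error is at most the gap [delta] of [f]; the [+ 1] covers [Cg = 0]. *)
    have e0 : 0 < delta / (Cg + 1) by rewrite divr_gt0// ltr_wpDl.
    have [L L0 hL] := powR_increment_eps s0 N0 e0.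
    exists (Cg * L); first exact: mulr_ge0.
    move=> x s t y z Kx tM st hy hz.
    have h1 := hd x t Kx tM.
    have h2 : f x (t + kappa) <= f x s by apply: (fm _ (KO _ Kx)); lra.
    have h3 : Cg * `|y `^ sigma - z `^ sigma| <= Cg * (delta / (Cg + 1)) + Cg * L * `|y - z|.
      by rewrite -mulrA -mulrDr; apply: ler_wpM2l => //; exact: hL.
    have h4 : Cg * (delta / (Cg + 1)) <= delta.
      rewrite mulrCA ger_pMr// ler_pdivrMr ?ltr_wpDl// mul1r lerDl//.
    by lra.
  have [L L0 hL] := powR_increment_lip s1 N0.
  exists (Cg * L); first exact: mulr_ge0.
  move=> x s t y z Kx tM st hy hz.
  have h2 : f x t <= f x s by apply: (fm _ (KO _ Kx)); lra.
  by rewrite lerD// -mulrA; apply: ler_wpM2l => //; exact: hL.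
(* The factor [n + 1] passes from a difference of norms to the norm of the difference; the final
   [+ 1] makes the constant positive. *)
exists (L * n.+1%:R + 1); first by rewrite ltr_wpDl// mulr_ge0.
move=> x s t xi eta Kx sM tM st hx he.
have gst : g x t <= g x s by apply: (gm _ (KO _ Kx)); lra.
have hX : 0 <= enorm xi <= N by rewrite enorm_ge0/= enorm_le.
have hE : 0 <= enorm eta <= N by rewrite enorm_ge0/= enorm_le.
have H := hL x s t _ _ Kx tM st hE hX.
have D := enorm_diff_le eta xi.
have -> : enorm (xi - eta) = enorm (eta - xi).
  by rewrite /enorm -[xi - eta]opprB /dotv; congr (Num.sqrt _); apply: eq_bigr => i _; rewrite !mxE mulrNN.
have E0 := enorm_ge0 (eta - xi).
have h1 : L * `|enorm eta - enorm xi| <= L * n.+1%:R * enorm (eta - xi).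
  by rewrite -mulrA; exact: ler_wpM2l.
have h2 : g x t * (enorm eta `^ sigma - enorm xi `^ sigma) <=
    Cg * `|enorm eta `^ sigma - enorm xi `^ sigma|.
  apply: le_trans (ler_norm _) _; rewrite normrM; apply: ler_wpM2r => //.
  exact: (hCg (x, t)).
have h3 : g x t * enorm xi `^ sigma <= g x s * enorm xi `^ sigma.
  by apply: ler_wpM2r => //; exact: powR_ge0.
rewrite mulrDl mul1r; move: h2; rewrite mulrBr; lra.
Qed.

End Structure.

Lemma C11_shift {R : realType} {n : nat} (F : 'rV[R]_n.+1 -> R) DF v : C11 F DF ->
  C11 (fun x => F (x - v)) (fun x => DF (x - v)).
Proof.
move=> [C [C0 hC]]; exists C; split=> // x; have [h1 h2 h3] := hC (x - v).
by split=> // h hh; rewrite (_ : x + h - v = x - v + h); [exact: h3|rewrite addrAC].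
Qed.

(** * Comparison of sub- and supersolutions *)

(* The notions of the statement over an abstract measure space [(T, mu)] with a coordinate map
   [phi]; at [mu = lebRn] and [phi = ofRn] they are convertible to the originals. *)
Section GoodSet.
Context {R : realType} {d} {T : measurableType d} {n : nat}.
Local Notation V := 'rV[R]_n.+1.
Variables (mu : {sigma_finite_measure set T -> \bar R}) (phi : T -> V).
Hypothesis mphi : forall i, measurable_fun setT (fun x => phi x ord0 i).
Hypothesis box_fin : forall r : R, (mu (box phi r) < +oo)%E.

Definition lmeas (D : set V) (F : V -> R) : Prop :=
  measurable_fun (phi @^-1` D) (fun x => F (phi x)).

Definition vint (D : set V) (F : V -> R) : \bar R :=
  (\int[mu]_(x in phi @^-1` D) (F (phi x))%:E)%E.

Definition linfloc (O : set V) (F : V -> R) : Prop :=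
  lmeas O F /\ forall K : set V, compact K -> K `<=` O ->
    exists M : R, mu.-negligible [set x | K (phi x) /\ ~ (`|F (phi x)| <= M)].

Definition l1loc (O : set V) (F : V -> R) : Prop :=
  lmeas O F /\ forall K : set V, compact K -> K `<=` O ->
    mu.-integrable (phi @^-1` K) (fun x => (F (phi x))%:E).

Definition weakgrad (O : set V) (u : V -> R) (Du : V -> V) : Prop :=
  forall F, C1c O F -> forall i,
    vint O (fun x => u x * pderiv F i x) = (- vint O (fun x => (Du x ord0 i * F x)%R))%E.

(* A subset [G] of full measure in [K] on which the essential bounds hold pointwise; cutting off
   outside [G] turns u, v, Du, Dv into everywhere bounded functions. *)
Lemma linfloc_good_set (I : finType) (O K : set V) (F : I -> V -> R) :
  open O -> compact K -> K `<=` O -> (forall i, linfloc O (F i)) ->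
  exists (M : R) (G : set T), [/\ 0 <= M, measurable G, G `<=` phi @^-1` K,
    {ae mu, forall x, K (phi x) -> G x} &
    forall x i, G x -> `|F i (phi x)| <= M].
Proof.
move=> oO cK KO hF.
have [m hm] : exists m : I -> R, forall i, mu.-negligible [set x | K (phi x) /\ ~ (`|F i (phi x)| <= m i)].
  have /choice : forall i, exists M : R, mu.-negligible [set x | K (phi x) /\ ~ (`|F i (phi x)| <= M)].
    by move=> i; have [_ /(_ K cK KO)] := hF i.
  by move=> [m hm]; exists m.
pose M := \sum_i `|m i|.
have M0 : 0 <= M by apply: sumr_ge0.
have mM i : m i <= M.
  by apply: le_trans (ler_norm _) _; rewrite /M (bigD1 i)//= lerDl sumr_ge0.
have mD : measurable (phi @^-1` K : set T).
  apply: (measurable_closed_preimage mphi); apply: compact_closed cK; exact: norm_hausdorff.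
have mO : measurable (phi @^-1` O : set T) by exact: (measurable_open_preimage mphi).
have mF i : measurable_fun (phi @^-1` K : set T) (fun x => F i (phi x)).
  by apply: (measurable_funS mO) => //; [exact: preimage_subset|have [] := hF i].
pose G : set T := (phi @^-1` K) `&`
   \bigcap_(i in [set: I]) ((phi @^-1` K) `&` (fun x => F i (phi x)) @^-1` `[- M, M]%classic).
exists M, G; split => //.
- apply: measurableI => //; apply: fin_bigcap_measurable => // i _; exact: mF.
- by move=> x [].
- have : {ae mu, forall x, forall i, K (phi x) -> `|F i (phi x)| <= m i}.
    apply: filter_forall => i; have := hm i; apply: negligibleS => x /= h.
    by apply: contrapT => hx; apply: h => Kx; apply: contrapT => nx; apply: hx.
  apply: filterS => x h Kx; split => // i _; split => //=.
  by rewrite in_itv/= -ler_norml (le_trans (h i Kx)).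
- by move=> x i [_ /(_ i Logic.I)[_ /=]]; rewrite in_itv/= -ler_norml.
Qed.

Variables (O K : set V) (M r0 : R) (G : set T).
Hypotheses (oO : open O) (cK : compact K) (KO : K `<=` O) (Kr0 : K `<=` [set v | `|v| <= r0]).
Hypotheses (M0 : 0 <= M) (mG : measurable G) (GK : G `<=` phi @^-1` K).
Hypothesis aeG : {ae mu, forall x, K (phi x) -> G x}.

Definition cut (F : V -> R) : T -> R := (fun x => F (phi x)) \_ G.

Lemma cutE F x : G x -> cut F x = F (phi x).
Proof. by move=> Gx; rewrite /cut patchE mem_set. Qed.

Lemma cut0 F x : ~ G x -> cut F x = 0.
Proof. by move=> Gx; rewrite /cut patchE memNset. Qed.

Lemma measurable_preimageK : measurable (phi @^-1` K : set T).
Proof.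
by apply: (measurable_closed_preimage mphi); apply: compact_closed cK; exact: norm_hausdorff.
Qed.

Lemma measurable_onG (F : V -> R) : lmeas O F -> measurable_fun G (fun x => F (phi x)).
Proof.
move=> mF; have mO : measurable (phi @^-1` O : set T) by exact: (measurable_open_preimage mphi).
by apply: (measurable_funS mO) => // x /GK /KO.
Qed.

Lemma cut_bounded_support F : lmeas O F -> (forall x, G x -> `|F (phi x)| <= M) ->
  bounded_support phi M r0 (cut F).
Proof.
move=> mF FM; split.
- by apply/(measurable_restrictT _ mG); exact: measurable_onG.
- move=> x; have [Gx|Gx] := pselect (G x); first by rewrite cutE// FM.
  by rewrite cut0// normr0.
- by move=> x hx; rewrite cut0// => /GK/Kr0/=; rewrite leNgt hx.
Qed.

(** The integrand vanishes off [K], and [G] fills [K] up to a null set, so integrals over the domain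
    may be taken over the good set. *)
Lemma vint_goodE (F : V -> R) : lmeas O F -> (forall v, ~ K v -> F v = 0) ->
  (vint O F = \int[mu]_(x in G) (F (phi x))%:E)%E.
Proof.
move=> mF F0; have mO : measurable (phi @^-1` O : set T) by exact: (measurable_open_preimage mphi).
have mFO : measurable_fun (phi @^-1` O : set T) (fun x => (F (phi x))%:E).
  by apply/measurable_EFinP; exact: mF.
have mgO : measurable_fun (phi @^-1` O : set T) (((fun x => (F (phi x))%:E) \_ G) : T -> \bar R).
  apply: measurable_funTS; apply/(measurable_restrictT _ mG).
  by apply/measurable_EFinP; exact: measurable_onG.
transitivity (\int[mu]_(x in phi @^-1` O) ((fun x => (F (phi x))%:E) \_ G) x)%E.
  apply: (@ae_eq_integral _ _ _ mu) => //.
  apply: filterS aeG => x h Ox; rewrite patchE; case: ifPn => // /negP xG.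
  by rewrite F0// => /h Gx; apply: xG; exact/mem_set.
rewrite [LHS]integral_mkcond [RHS]integral_mkcond; apply: eq_integral => x _.
rewrite !patchE; case: (ifPn (x \in G)) => xG; last by rewrite if_same.
by rewrite mem_set//; move: xG => /set_mem /GK /KO.
Qed.

(** The translated kernel is admissible in the definition of the weak gradient because its support
    lies in [K]. The minus sign of that definition cancels against the oddness of [Dbump]. *)
Lemma conv_cut_grad (u : V -> R) (Du : V -> V) (e : R) v i : lmeas O u -> lmeas O (fun x => Du x ord0 i) ->
  weakgrad O u Du -> 0 < e <= 1 ->
  (forall y, `|y - v| <= e -> K y) ->
  (forall x, G x -> `|u (phi x)| <= M) -> (forall x, G x -> `|Du (phi x) ord0 i| <= M) ->
  conv mu phi (fun z => Dbump e z ord0 i) (cut u) v =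
  conv mu phi (bump e) (cut (fun x => Du x ord0 i)) v.
Proof.
move=> lu mDu wg e01 eK uM DuM; have [e0 e1] := andP e01.
pose F y : R := bump e (y - v); pose DF y : V := Dbump e (y - v).
have cF : C11 F DF := C11_shift v (bump_C11 e01).
have nK y : ~ K y -> e < `|y - v| by move=> nKy; rewrite ltNge; apply/negP => /eK.
have F0 y : ~ K y -> F y = 0 by move=> /nK h; rewrite /F bump0// ltW.
have DF0 y : ~ K y -> DF y = 0 by move=> /nK h; rewrite /DF Dbump0// ltW.
have pF y : pderiv F i y = DF y ord0 i by have [_ ->] := C11_differentiable cF y.
have cDF : continuous (fun y => DF y ord0 i) := @C11_grad_continuous _ _ _ _ i cF.
have C1F : C1c O F.
  split; first by move=> x; have [] := C11_differentiable cF x.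
  split; last by exists K; split.
  move=> j; rewrite (_ : pderiv F j = fun y => DF y ord0 j); first exact: (@C11_grad_continuous _ _ _ _ j cF).
  by apply/funext => y; have [_ ->] := C11_differentiable cF y.
have mcO (H : V -> R) : continuous H -> lmeas O H.
  move=> cH; apply: measurable_funTS; exact: (measurable_continuous_comp measurableT cH mphi).
have := wg F C1F i.
rewrite (@vint_goodE (fun x => u x * pderiv F i x)); last 2 first.
- apply: measurable_funM => //; rewrite (_ : pderiv F i = fun y => DF y ord0 i); last exact/funext.
  exact: (mcO (fun y => DF y ord0 i) cDF).
- by move=> y nKy; rewrite pF DF0// mxE mulr0.
rewrite (@vint_goodE (fun x => Du x ord0 i * F x)); last 2 first.
- by apply: measurable_funM => //; apply: mcO; exact: C11_continuous cF.
- by move=> y nKy; rewrite F0// mulr0.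
move=> H.
have restr (A B : V -> R) : (\int[mu]_(x in G) (A (phi x) * B (phi x))%:E =
    \int[mu]_x (cut A x * B (phi x))%:E)%E.
  rewrite [LHS]integral_mkcond; apply: eq_integral => x _; rewrite patchE /cut patchE.
  by case: ifP => // _; rewrite mul0r.
have H2 : (\int[mu]_x (cut u x * DF (phi x) ord0 i)%:E =
    - \int[mu]_x (cut (fun y => Du y ord0 i) x * F (phi x))%:E)%E.
  have := H; rewrite (restr (fun y => Du y ord0 i) F) -(restr u (fun y => DF y ord0 i)) => <-.
  by apply: eq_integral => x _; rewrite pF.
have swap x : v - phi x = - (phi x - v) by rewrite opprB.
rewrite /conv /Rintegral.
under eq_integral do rewrite swap DbumpN mxE -/(DF _) mulNr mulrC EFinN.
under [in RHS]eq_integral do rewrite swap bumpN -/(F _) mulrC.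
have iu : mu.-integrable setT (fun x => (cut u x * DF (phi x) ord0 i)%:E).
  have [C [C0 hC]] := cF.
  apply: (@bounded_support_integrable _ _ _ _ mu phi mphi box_fin (C * M) r0).
  under eq_fun do rewrite mulrC.
  apply: (bounded_supportM (cut_bounded_support lu uM)) => //.
  + exact: (measurable_continuous_comp measurableT cDF mphi).
  + by move=> x; have [_ ->] := hC (phi x).
rewrite integralN/=; last by apply: integrable_add_def.
by rewrite H2 oppeK.
Qed.

End GoodSet.

Section Comparison.
Context {R : realType} {d} {T : measurableType d} {n : nat}.
Local Notation V := 'rV[R]_n.+1.
Variables (mu : {sigma_finite_measure set T -> \bar R}) (phi : T -> V).
Hypothesis mphi : forall i, measurable_fun setT (fun x => phi x ord0 i).
Hypothesis box_fin : forall r : R, (mu (box phi r) < +oo)%E.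
Hypothesis box_pos : forall r : R, 0 < r -> (0 < mu (box phi r))%E.
Hypothesis trans : forall (h : V) (G : V -> R), continuous G -> (forall v, 0 <= G v) ->
  (\int[mu]_x (G (phi x + h))%:E = \int[mu]_x (G (phi x))%:E)%E.
Hypothesis approx_indic : forall B : set T, measurable B -> approx_L1 mu phi \1_B.

Lemma lmeas_comp_grad (O : set V) (a : V -> V -> V) (Du : V -> V) i : open O ->
  (forall xi, lmeas phi O (fun x => a x xi ord0 i)) -> (forall x, O x -> continuous (a x)) ->
  (forall j, lmeas phi O (fun x => Du x ord0 j)) ->
  lmeas phi O (fun x => a x (Du x) ord0 i).
Proof.
move=> oO ma ca mDu; have mO := measurable_open_preimage mphi oO.
apply: (measurable_caratheodory mO (A := fun x xi => a (phi x) xi ord0 i)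
  (U := fun x => Du (phi x))) => //.
move=> x Ox xi; apply: (continuous_comp (f := a (phi x)) (g := fun y : V => y ord0 i)).
  exact: ca.
exact: coord_continuous.
Qed.

Lemma lmeas_comp (O : set V) (g : V -> R -> R) (u : V -> R) : open O ->
  {within [set z : V * R | O z.1], continuous (fun z => g z.1 z.2)} ->
  lmeas phi O u -> lmeas phi O (fun x => g x (u x)).
Proof.
move=> oO cg mu_; have mO := measurable_open_preimage mphi oO.
have oP : open [set z : V * R | O z.1].
  rewrite (_ : [set _ | _] = fst @^-1` O)//; apply: open_comp => // z _; exact: cvg_fst.
move: cg; rewrite continuous_open_subspace// => cg.
(* The real argument of [g] is wrapped into a row vector of length 1, so that
   [measurable_caratheodory] applies. *)
rewrite /lmeas (_ : (fun x => _) = fun x => g (phi x) ((const_mx (u (phi x)) : 'rV[R]_1) ord0 ord0)); last first.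
  by apply/funext => x; rewrite mxE.
apply: (measurable_caratheodory (m := 0) mO (A := fun x xi => g (phi x) (xi ord0 ord0))
  (U := fun x => const_mx (u (phi x)) : 'rV[R]_1)).
- move=> xi; apply: (measurable_within_continuous mphi (h := fun x => g x (xi ord0 ord0))) => //.
  rewrite continuous_open_subspace// => x /set_mem Ox.
  apply: (continuous_comp (f := fun x : V => (x, xi ord0 ord0)) (g := fun z => g z.1 z.2)).
    have c1 : (fun y : V => y) @ x --> x by exact: cvg_id.
    have c2 : (fun _ : V => xi ord0 ord0) @ x --> xi ord0 ord0 by exact: (@cst_continuous V R).
    exact: (cvg_pair c1 c2).
  by apply: (cg (x, xi ord0 ord0)); rewrite inE.
- move=> x Ox xi.
  apply: (continuous_comp (f := fun y : 'rV[R]_1 => (phi x, y ord0 ord0)) (g := fun z => g z.1 z.2)).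
    have c1 : (fun _ : 'rV[R]_1 => phi x) @ xi --> phi x by exact: (@cst_continuous 'rV[R]_1 V).
    have c2 : (fun y : 'rV[R]_1 => y ord0 ord0) @ xi --> xi ord0 ord0 by exact: coord_continuous.
    exact: (cvg_pair c1 c2).
  by apply: (cg (phi x, xi ord0 ord0)); rewrite inE.
- by move=> i; under eq_fun do rewrite mxE; exact: mu_.
Qed.

Lemma lmeas_enorm_powR (O : set V) (Du : V -> V) (sigma : R) :
  (forall j, lmeas phi O (fun x => Du x ord0 j)) ->
  lmeas phi O (fun x => enorm (Du x) `^ sigma).
Proof.
move=> mDu; apply: (measurableT_comp (measurable_powR sigma)).
apply: (measurableT_comp (continuous_measurable_fun (@sqrt_continuous R))).
by apply: measurable_sum => i; apply: measurable_funM; exact: mDu.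
Qed.

Lemma integrable_funD (G : set T) (A B : T -> R) : measurable G ->
  mu.-integrable G (fun x => (A x)%:E) -> mu.-integrable G (fun x => (B x)%:E) ->
  mu.-integrable G (fun x => (A x + B x)%:E).
Proof. by move=> mG iA iB; exact: (integrableD mG iA iB). Qed.

Lemma integrable_funB (G : set T) (A B : T -> R) : measurable G ->
  mu.-integrable G (fun x => (A x)%:E) -> mu.-integrable G (fun x => (B x)%:E) ->
  mu.-integrable G (fun x => (A x - B x)%:E).
Proof. by move=> mG iA iB; exact: (integrableB mG iA iB). Qed.

Lemma conv_sub (K : V -> R) (C M r : R) (A B : T -> R) v : continuous K -> (forall z, `|K z| <= C) ->
  bounded_support phi M r A -> bounded_support phi M r B ->
  conv mu phi K (fun x => A x - B x) v = conv mu phi K A v - conv mu phi K B v.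
Proof.
move=> cK KC hA hB; rewrite /conv -RintegralB//.
- by apply: eq_Rintegral => x _; rewrite mulrBr.
- exact: (bounded_support_integrable mphi box_fin (conv_kernel_support mphi v cK KC hA)).
- exact: (bounded_support_integrable mphi box_fin (conv_kernel_support mphi v cK KC hB)).
Qed.

Lemma bounded_supportB (M r : R) (A B : T -> R) : bounded_support phi M r A ->
  bounded_support phi M r B -> bounded_support phi (2 * M) r (fun x => A x - B x).
Proof.
move=> [mA AM A0] [mB BM B0]; split; first exact: measurable_funB.
- move=> x; apply: le_trans (ler_normB _ _) _; have h1 := AM x; have h2 := BM x; lra.
- by move=> x hx; rewrite A0// B0// subrr.
Qed.

Lemma dominated_integral_le (G : set T) (f h : nat -> T -> R) (f0 h0 F H : T -> R) : measurable G ->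
  (forall j, measurable_fun G (f j)) -> (forall j, measurable_fun G (h j)) ->
  measurable_fun G f0 -> measurable_fun G h0 ->
  {ae mu, forall x, G x -> (fun j => f j x) @ \oo --> f0 x} ->
  {ae mu, forall x, G x -> (fun j => h j x) @ \oo --> h0 x} ->
  mu.-integrable G (fun x => (F x)%:E) -> mu.-integrable G (fun x => (H x)%:E) ->
  (forall x j, G x -> `|f j x| <= F x) -> (forall x j, G x -> `|h j x| <= H x) ->
  (forall j, \int[mu]_(x in G) (f j x)%:E <= \int[mu]_(x in G) (h j x)%:E)%E ->
  mu.-integrable G (fun x => (h0 x)%:E) /\
  (\int[mu]_(x in G) (f0 x)%:E <= \int[mu]_(x in G) (h0 x)%:E)%E.
Proof.
move=> mG mf mh mf0 mh0 cf ch iF iH fF hH fh.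
have DC (q : nat -> T -> R) (q0 Q : T -> R) : (forall j, measurable_fun G (q j)) ->
    measurable_fun G q0 -> {ae mu, forall x, G x -> (fun j => q j x) @ \oo --> q0 x} ->
    mu.-integrable G (fun x => (Q x)%:E) -> (forall x j, G x -> `|q j x| <= Q x) ->
    mu.-integrable G (fun x => (q0 x)%:E) /\
    (fun j => \int[mu]_(x in G) (q j x)%:E)%E @ \oo --> (\int[mu]_(x in G) (q0 x)%:E)%E.
  move=> mq mq0 cq iQ qQ.
  have [|||| i0 _ cv] := @dominated_convergence _ _ _ mu G mG (fun j x => (q j x)%:E)
    (fun x => (q0 x)%:E) (fun x => (Q x)%:E) _ _ _ iQ _.
  - by move=> j; apply/measurable_EFinP.
  - exact/measurable_EFinP.
  - apply: filterS cq => x hx Gx; apply/fine_cvgP; split; first exact: nearW.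
    exact: (hx Gx).
  - by apply: aeW => x j Gx; rewrite /= lee_fin qQ.
  by split.
have [_ L1] := DC f f0 F mf mf0 cf iF fF; have [ih0 L2] := DC h h0 H mh mh0 ch iH hH.
split => //; rewrite -(cvg_lim _ L1)// -(cvg_lim _ L2)//; apply: lee_lim.
- by apply/cvg_ex; eexists; exact: L1.
- by apply/cvg_ex; eexists; exact: L2.
- exact: nearW.
Qed.

Section Fixed_level.
Variables (O K0 K1 : set V) (u v : V -> R) (Du Dv : V -> V) (kappa r r0 M : R) (G : set T).
Hypotheses (oO : open O) (kappa0 : 0 < kappa) (rp : 0 < r) (r00 : 0 <= r0) (M0 : 0 <= M).
Hypotheses (cK1 : compact K1) (K1O : K1 `<=` O) (K1r0 : K1 `<=` [set v | `|v| <= r0]).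
Hypothesis K01 : forall x y : V, K0 x -> `|y - x| <= r -> K1 y.
Hypothesis K0sup : forall x, O x -> kappa < u x - v x -> K0 x.
Hypotheses (mG : measurable G) (GK : G `<=` phi @^-1` K1).
Hypothesis aeG : {ae mu, forall x, K1 (phi x) -> G x}.
Hypotheses (mu_ : lmeas phi O u) (mv_ : lmeas phi O v).
Hypotheses (mDu : forall i, lmeas phi O (fun x => Du x ord0 i))
  (mDv : forall i, lmeas phi O (fun x => Dv x ord0 i)).
Hypotheses (wu : weakgrad mu phi O u Du) (wv : weakgrad mu phi O v Dv).
Hypotheses (uM : forall x, G x -> `|u (phi x)| <= M) (vM : forall x, G x -> `|v (phi x)| <= M).
Hypotheses (DuM : forall x i, G x -> `|Du (phi x) ord0 i| <= M)
  (DvM : forall x i, G x -> `|Dv (phi x) ord0 i| <= M).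

(** [u] and [v] are cut off separately, so that each is bounded with bounded support. [K0] contains
    the superlevel set and [K1] its [r]-neighbourhood, which leaves room for mollification with
    radius at most [r / 2]. *)
Definition Wcut x := cut phi G u x - cut phi G v x.
Definition Dcut i x := cut phi G (fun y => Du y ord0 i) x - cut phi G (fun y => Dv y ord0 i) x.

Let cbs := cut_bounded_support mphi oO K1O K1r0 M0 mG GK.

Lemma Wcut_bounded_support : bounded_support phi (2 * M) r0 Wcut.
Proof. by apply: bounded_supportB; apply: cbs. Qed.

Lemma Dcut_bounded_support i : bounded_support phi (2 * M) r0 (Dcut i).
Proof. by apply: bounded_supportB; apply: cbs => // x; [exact: DuM|exact: DvM]. Qed.

Lemma Wcut_gt x : kappa < Wcut x -> G x /\ Wcut x = u (phi x) - v (phi x).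
Proof.
have [Gx|Gx] := pselect (G x); first by rewrite /Wcut !cutE.
by rewrite /Wcut !cut0// subrr => h; have := lt_trans kappa0 h; rewrite ltxx.
Qed.

Lemma Wcut_gt_K0 x : kappa < Wcut x -> K0 (phi x).
Proof.
by move=> h; have [Gx E] := Wcut_gt h; apply: K0sup; [exact/K1O/GK|rewrite -E].
Qed.

(** A mean exceeds [kappa] only if some value nearby does, and such values occur only over [K0].
    This confines the supports of all test functions to [K1]. *)
Lemma mollify_gt_near e y : 0 < e <= 1 -> kappa < mollify mu phi e Wcut y ->
  exists2 x, K0 x & `|y - x| <= e.
Proof.
move=> e01; apply: contraPP => /forall2NP H; apply/negP; rewrite -leNgt.
apply: (mollify_le mphi box_fin box_pos trans e01 Wcut_bounded_support) => z yz.
rewrite leNgt; apply/negP => /Wcut_gt_K0 K0z.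
by have [] := H (phi z).
Qed.

(** Mollification commutes with the weak gradient where the kernel stays in [K1]. Here [y] is within
    [e] of [K0] and the kernel has radius [e], whence the bound [r / 2]. *)
Lemma mollify_grad e y i : 0 < e <= 1 -> e <= r / 2 -> kappa < mollify mu phi e Wcut y ->
  ((kmass mu phi e)^-1 *: \row_l conv mu phi (fun z => Dbump e z ord0 l) Wcut y) ord0 i =
  mollify mu phi e (Dcut i) y.
Proof.
move=> e01 er hy; have [x K0x yx] := mollify_gt_near e01 hy.
have yK z : `|z - y| <= e -> K1 z.
  move=> zy; apply: (K01 K0x); rewrite -(subrK y z) -addrA (splitr r).
  by apply: le_trans (ler_normD _ _) _; rewrite lerD// (le_trans _ er).
rewrite !mxE /mollify mulrC; congr (_ / _).
have [C [C0 hC]] := @bump_C11 R n e e01.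
have cb := C11_continuous (@bump_C11 R n e e01).
have cDb := @C11_grad_continuous _ _ _ _ i (@bump_C11 R n e e01).
have bb (z : V) : `|bump e z| <= C by have [] := hC z.
have bDb (z : V) : `|Dbump e z ord0 i| <= C by have [_ ->] := hC z.
rewrite (@conv_sub (fun z => Dbump e z ord0 i) C M r0 (cut phi G u) (cut phi G v) y cDb bDb); last 2 first.
- exact: cbs.
- exact: cbs.
rewrite (@conv_sub (bump e) C M r0 _ _ y cb bb); last 2 first.
- by apply: cbs => // z; exact: DuM.
- by apply: cbs => // z; exact: DvM.
have cg := conv_cut_grad mphi box_fin oO cK1 K1O K1r0 M0 mG GK aeG.
congr (_ - _).
  by apply: cg => // z; exact: DuM.
by apply: cg => // z; exact: DvM.
Qed.

Variable e : nat -> R.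
Hypothesis he : forall j, 0 < e j <= 1 /\ e j <= r / 2.
Hypothesis cvW : {ae mu, forall x, (fun j => mollify mu phi (e j) Wcut (phi x)) @ \oo --> Wcut x}.
Hypothesis cvD : {ae mu, forall x i,
  (fun j => mollify mu phi (e j) (Dcut i) (phi x)) @ \oo --> Dcut i x}.

Let w j := mollify mu phi (e j) Wcut.
Let Dw j (y : V) : V := (kmass mu phi (e j))^-1 *:
  \row_l conv mu phi (fun z => Dbump (e j) z ord0 l) Wcut y.

Let cw j : C11 (w j) (Dw j).
Proof. exact: (mollify_C11 mphi box_fin (he j).1 Wcut_bounded_support). Qed.

Let wM j y : `|w j y| <= 2 * M.
Proof. exact: (mollify_bound mphi box_fin box_pos trans y (he j).1 Wcut_bounded_support). Qed.

Let wK j y : ~ K1 y -> w j y <= kappa.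
Proof.
move=> nKy; rewrite leNgt; apply/negP => /(mollify_gt_near (he j).1)[x K0x yx].
apply: nKy; apply: (K01 K0x); apply: (le_trans yx); apply: (le_trans (he j).2).
by rewrite ler_pdivrMr// ler_peMr ?ler1n// ltW.
Qed.

Let wout j (y : V) : r0 < `|y| -> w j y <= kappa.
Proof. by move=> hy; apply: wK => /K1r0/=; rewrite leNgt hy. Qed.

Let DwE j y i : kappa < w j y -> Dw j y ord0 i = mollify mu phi (e j) (Dcut i) y.
Proof. exact: (mollify_grad i (he j).1 (he j).2). Qed.

Let DwM j y i : kappa < w j y -> `|Dw j y ord0 i| <= 2 * M.
Proof.
by move=> /DwE ->; exact: (mollify_bound mphi box_fin box_pos trans y (he j).1 (Dcut_bounded_support i)).
Qed.

Let cvDw : {ae mu, forall x, kappa < Wcut x -> forall i,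
  (fun j => Dw j (phi x) ord0 i) @ \oo --> Dcut i x}.
Proof.
apply: filterS2 cvW cvD => x h1 h2 kx i.
have h3 : \forall j \near \oo, kappa < w j (phi x) by exact: (cvgr_gt (Wcut x)).
apply/cvgrPdist_le => t t0; have /cvgrPdist_le/(_ _ t0) := h2 i.
by apply: filterS2 h3 => j hj; rewrite DwE.
Qed.

Section Test.
Variables (A : V -> V) (b : V -> R).
Hypotheses (lA : forall i, lmeas phi O (fun x => A x ord0 i)) (lb : lmeas phi O b).
Hypotheses (iA : forall i, mu.-integrable G (fun x => (A (phi x) ord0 i)%:E))
  (ib : mu.-integrable G (fun x => (b (phi x))%:E)).
Hypothesis test : forall F, C1c O F -> (forall x, 0 <= F x) ->
  (vint mu phi O (fun x => dotv (A x) (grad F x)) <= vint mu phi O (fun x => (b x * F x)%R))%E.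

(** The test function is the cube of the truncated mollification, and [j] tends to infinity. The
    flux [A] and the source [b] are only integrable, but they multiply gradients and functions
    bounded uniformly in [j], so dominated convergence applies to both sides. *)
Lemma tested_inequality k : kappa <= k ->
  mu.-integrable G (fun x => (b (phi x) * pospart (Wcut x - k) ^+ 3)%:E) /\
  (\int[mu]_(x in G) (\sum_i A (phi x) ord0 i * (3 * pospart (Wcut x - k) ^+ 2 * Dcut i x))%:E <=
   \int[mu]_(x in G) (b (phi x) * pospart (Wcut x - k) ^+ 3)%:E)%E.
Proof.
move=> hk; pose P t := pospart (t - k).
pose F j y := P (w j y) ^+ 3; pose DF j y : V := (3 * P (w j y) ^+ 2) *: Dw j y.
have cF j : C11 (F j) (DF j) by exact: (C11_comp (@pospart_cube_C11 R k) (cw j)).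
have P0 j y : ~ K1 y -> P (w j y) = 0.
  by move=> /(wK j) h; rewrite /P; have [[_ ->]//|[h2 _]] := pospartP (w j y - k); exfalso; lra.
have F0 j y : ~ K1 y -> F j y = 0 by move=> /(P0 j) h; rewrite /F h expr0n.
have DF0 j y : ~ K1 y -> DF j y = 0 by move=> /(P0 j) h; rewrite /DF h expr0n mulr0 scale0r.
have C1F j : C1c O (F j).
  split; first by move=> x; have [] := C11_differentiable (cF j) x.
  split; last by exists K1; split => // x; exact: F0.
  move=> i; rewrite (_ : pderiv (F j) i = fun y => DF j y ord0 i).
    exact: (@C11_grad_continuous _ _ _ _ i (cF j)).
  by apply/funext => y; have [_ ->] := C11_differentiable (cF j) y.
have Fge0 j y : 0 <= F j y by rewrite exprn_ge0// pospart_ge0.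
have lc (H : V -> R) : continuous H -> lmeas phi O H.
  by move=> cH; apply: measurable_funTS; exact: (measurable_continuous_comp measurableT cH mphi).
have lF j : lmeas phi O (F j) by apply: lc; exact: C11_continuous (cF j).
have lDF j i : lmeas phi O (fun y => DF j y ord0 i).
  by apply: (lc (fun y => DF j y ord0 i)); exact: (@C11_grad_continuous _ _ _ _ i (cF j)).
pose fl j (x : T) := \sum_i A (phi x) ord0 i * DF j (phi x) ord0 i.
pose fr j (x : T) := b (phi x) * F j (phi x).
have ineq j : (\int[mu]_(x in G) (fl j x)%:E <= \int[mu]_(x in G) (fr j x)%:E)%E.
  have := test (C1F j) (Fge0 j).
  rewrite (vint_goodE mphi oO K1O mG GK aeG); last 2 first.
  - under eq_fun do rewrite (C11_grad _ (cF j)).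
    by apply: measurable_sum => i; apply: measurable_funM; [exact: lA|exact: lDF].
  - move=> y nK; rewrite (C11_grad _ (cF j)) DF0// /dotv big1// => i _.
    by rewrite mxE mulr0.
  rewrite (vint_goodE mphi oO K1O mG GK aeG); last 2 first.
  - exact: (measurable_funM lb (lF j)).
  - by move=> y nK; rewrite F0// mulr0.
  by under eq_integral do rewrite (C11_grad _ (cF j)).
have onG H : lmeas phi O H -> measurable_fun G (fun x => H (phi x)) by exact: (measurable_onG mphi oO K1O GK).
have mPW m : measurable_fun G (fun x => pospart (Wcut x - k) ^+ m).
  apply: measurable_funTS; apply: measurable_funX; apply: measurable_maxr; first exact: measurable_cst.
  by apply: measurable_funB => //; have [] := Wcut_bounded_support.
have M20 : 0 <= 2 * M by rewrite mulr_ge0.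
have PM j y : P (w j y) <= 2 * M.
  rewrite /P; have [[_ ->]//|[_ ->]] := pospartP (w j y - k).
  have h1 := ler_norm (w j y); have h2 := wM j y; have h3 := kappa0; move: (w j y) h1 h2 => t; lra.
have cvP x : (fun j => w j (phi x)) @ \oo --> Wcut x -> (fun j => P (w j (phi x))) @ \oo --> P (Wcut x).
  move=> /cvgrPdist_le hx; apply/cvgrPdist_le => t t0; apply: filterS (hx t t0) => j.
  by apply: le_trans; apply: le_trans (pospart_lip _ _) _; rewrite opprB addrA subrK.
pose B1 := 3 * (2 * M) ^+ 2 * (2 * M).
have B10 : 0 <= B1 by rewrite !mulr_ge0.
apply: (@dominated_integral_le G fl fr _ _ (fun x => \sum_i `|A (phi x) ord0 i| * B1)
  (fun x => `|b (phi x)| * (2 * M) ^+ 3)) => //.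
- by move=> j; apply: measurable_sum => i; apply: measurable_funM; [exact: (onG _ (lA i))|exact: (onG _ (lDF j i))].
- by move=> j; apply: measurable_funM; [exact: (onG _ lb)|exact: (onG _ (lF j))].
- apply: measurable_sum => i; apply: measurable_funM; first exact: (onG _ (lA i)).
  apply: measurable_funM; first by apply: measurable_funM.
  by apply: measurable_funTS; have [] := Dcut_bounded_support i.
- by apply: measurable_funM => //; exact: (onG _ lb).
- apply: filterS2 cvW cvDw => x h1 h2 Gx; apply: fcvg_sum => i; apply: cvgM; first exact: cvg_cst.
  have p := cvP x h1.
  (* As for the energy: where [Wcut <= kappa] the gradients have no known limit, but they are
     bounded while the factor in front tends to 0. One power of that factor gives the convergence,
     the other goes into the constant. *)
  case: (leP (Wcut x) kappa) => hx.
    have z : pospart (Wcut x - k) = 0.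
      by have [[_ ->]//|[h3 _]] := pospartP (Wcut x - k); exfalso; lra.
    rewrite z expr0n/= mulr0 mul0r; apply/cvgr0Pnorm_le => t t0.
    have q0 : 0 < 3 * (2 * M) * (2 * M) + 1 by rewrite ltr_wpDl// !mulr_ge0.
    have e20 : 0 < t / (3 * (2 * M) * (2 * M) + 1) by rewrite divr_gt0.
    have := p; rewrite /P z => /cvgr0Pnorm_le/(_ _ e20); apply: filterS => j hj.
    rewrite mxE; case: (leP (w j (phi x)) kappa) => hw.
      rewrite (_ : P (w j (phi x)) = 0); first by rewrite expr0n/= mulr0 mul0r normr0 ltW.
      by rewrite /P; have [[_ ->]//|[h3 _]] := pospartP (w j (phi x) - k); exfalso; lra.
    have hd := DwM i hw; set D0 := Dw _ _ _ _ in hd *; set q := P _.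
    have qM : q <= 2 * M := PM j (phi x).
    have qge : 0 <= q by exact: pospart_ge0.
    rewrite ger0_norm// -/q in hj.
    have q30 : 0 <= 3 * q ^+ 2 by rewrite mulr_ge0// sqr_ge0.
    rewrite normrM (ger0_norm q30) expr2.
    have -> : 3 * (q * q) * `|D0| = (3 * q * `|D0|) * q by ring.
    apply: (@le_trans _ _ ((3 * (2 * M) * (2 * M)) * q)).
      apply: ler_wpM2r => //; apply: ler_pM => //; first by rewrite mulr_ge0.
      by rewrite ler_wpM2l.
    apply: (@le_trans _ _ ((3 * (2 * M) * (2 * M) + 1) * q)).
      by apply: ler_wpM2r => //; rewrite lerDl.
    by rewrite mulrC -ler_pdivlMr.
  under eq_fun do rewrite mxE.
  apply: cvgM; last exact: h2.
  by apply: cvgM; [exact: cvg_cst|rewrite expr2; under eq_fun do rewrite expr2; exact: cvgM].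
- apply: filterS cvW => x h1 Gx; apply: cvgM; first exact: cvg_cst.
  have p := cvP x h1; rewrite /fr /F.
  have -> : pospart (Wcut x - k) ^+ 3 = P (Wcut x) * (P (Wcut x) * P (Wcut x)) by rewrite exprS expr2.
  have -> : (fun j => P (w j (phi x)) ^+ 3) =
    (fun j => P (w j (phi x)) * (P (w j (phi x)) * P (w j (phi x)))).
    by apply/funext => j; rewrite exprS expr2.
  by apply: cvgM => //; exact: cvgM.
- under eq_fun do rewrite -mulr_suml EFinM muleC.
  apply: integrableZl => //.
  under eq_fun do rewrite -sumEFin.
  by apply: integrable_sum => // i _; exact: (integrable_abse (iA i)).
- under eq_fun do rewrite EFinM muleC.
  by apply: integrableZl => //; exact: (integrable_abse ib).
- move=> x j Gx; apply: le_trans (ler_norm_sum _ _ _) _; apply: ler_sum => i _.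
  rewrite normrM; apply: ler_wpM2l => //; rewrite mxE.
  case: (leP (w j (phi x)) kappa) => hw.
    rewrite (_ : P (w j (phi x)) = 0); first by rewrite expr0n/= mulr0 mul0r normr0.
    by rewrite /P; have [[_ ->]//|[h3 _]] := pospartP (w j (phi x) - k); exfalso; lra.
  rewrite normrM; apply: ler_pM => //; last exact: DwM.
  rewrite ger0_norm; last by rewrite mulr_ge0// sqr_ge0.
  by rewrite ler_wpM2l// lerXn2r ?nnegrE// pospart_ge0.
- move=> x j Gx; rewrite /fr normrM; apply: ler_wpM2l => //.
  rewrite ger0_norm ?Fge0// lerXn2r ?nnegrE//; exact: pospart_ge0.
Qed.

(** The two pointwise estimates are asked only where [kappa < Wcut x], as the truncation vanishes
    elsewhere. Inserted into [tested_inequality] they yield the hypothesis [caccioppoli] of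
    [level_set_null]. *)
Lemma superlevel_Wcut_null (c0 C1 : R) : 0 < c0 -> 0 < C1 ->
  (forall x, kappa < Wcut x ->
     c0 * sqgrad Dcut x <= \sum_i A (phi x) ord0 i * Dcut i x /\
     b (phi x) <= C1 * Num.sqrt (sqgrad Dcut x)) ->
  mu [set x | kappa < Wcut x] = 0%E.
Proof.
move=> c00 C10 H; have hD := Dcut_bounded_support; have hW := Wcut_bounded_support.
apply: (level_set_null mphi box_fin box_pos trans kappa0 c00 C10 r00 hW hD cw wM wout DwM cvW cvDw).
move=> k hk; have [ib3 I3] := tested_inequality hk; pose P x := pospart (Wcut x - k).
have P0 x : ~ G x -> P x = 0.
  move=> nGx; have W0 : Wcut x = 0 by rewrite /Wcut !cut0// subrr.
  rewrite /P W0; have k0 := kappa0; have [[_ ->]//|[h _]] := pospartP (0 - k); exfalso; lra.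
have Ppos x : P x = 0 \/ kappa < Wcut x.
  by rewrite /P; have [[_ ->]|[h _]] := pospartP (Wcut x - k); [left|right; lra].
have S0 x : 0 <= sqgrad Dcut x by apply: sumr_ge0 => i _; exact: sqr_ge0.
have mS : measurable_fun setT (sqgrad Dcut).
  by apply: measurable_sum => i; apply: measurable_funX; have [] := hD i.
have mP : measurable_fun setT P.
  apply: measurable_maxr; first exact: measurable_cst.
  by apply: measurable_funB => //; have [] := hW.
have msS : measurable_fun setT (fun x => Num.sqrt (sqgrad Dcut x)).
  exact: (measurableT_comp (continuous_measurable_fun (@sqrt_continuous R)) mS).
have toG (F : T -> R) : (forall x, P x = 0 -> F x = 0) ->
    (\int[mu]_x (F x)%:E = \int[mu]_(x in G) (F x)%:E)%E.
  move=> F0; rewrite [RHS]integral_mkcond; apply: eq_integral => x _; rewrite patchE.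
  by case: ifPn => // /negP nG; rewrite F0// P0// => Gx; apply: nG; exact/mem_set.
rewrite (toG (fun x => 3 * c0 * (P x ^+ 2 * sqgrad Dcut x))); last first.
  by move=> x ->; rewrite expr0n mul0r mulr0.
rewrite (toG (fun x => C1 * (P x ^+ 3 * Num.sqrt (sqgrad Dcut x)))); last first.
  by move=> x ->; rewrite expr0n mul0r mulr0.
have pw x : 3 * c0 * (P x ^+ 2 * sqgrad Dcut x) <=
    \sum_i A (phi x) ord0 i * (3 * P x ^+ 2 * Dcut i x).
  have -> : \sum_i A (phi x) ord0 i * (3 * P x ^+ 2 * Dcut i x) =
      3 * P x ^+ 2 * \sum_i A (phi x) ord0 i * Dcut i x.
    by rewrite mulr_sumr; apply: eq_bigr => i _; ring.
  have [->|/H[h _]] := Ppos x; first by rewrite expr0n/= !(mul0r, mulr0).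
  have -> : 3 * c0 * (P x ^+ 2 * sqgrad Dcut x) = 3 * P x ^+ 2 * (c0 * sqgrad Dcut x) by ring.
  by apply: ler_wpM2l => //; rewrite mulr_ge0// sqr_ge0.
have L0 x : 0 <= 3 * c0 * (P x ^+ 2 * sqgrad Dcut x).
  by rewrite mulr_ge0//; [rewrite mulr_ge0// ltW|rewrite mulr_ge0// sqr_ge0].
apply: (@le_trans _ _ (\int[mu]_(x in G)
    (\sum_i A (phi x) ord0 i * (3 * P x ^+ 2 * Dcut i x))%:E)%E).
  apply: ge0_le_integral => //.
  - by move=> x _; rewrite lee_fin.
  - apply/measurable_EFinP/measurable_funTS; apply: measurable_funM => //.
    by apply: measurable_funM => //; apply: measurable_funX.
  - apply/measurable_EFinP; apply: measurable_sum => i; apply: measurable_funM.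
      exact: (measurable_onG mphi oO K1O GK (lA i)).
    apply: measurable_funTS; apply: measurable_funM; last by have [] := hD i.
    by apply: measurable_funM => //; exact: measurable_funX.
  by move=> x _; rewrite lee_fin.
(* [b] may be negative, so this comparison goes through the integrability of both sides. *)
apply: (le_trans I3); apply: le_integral => //.
- apply: (@integrableS _ _ _ mu setT) => //.
  apply: (@bounded_support_integrable _ _ _ _ mu phi mphi box_fin
    (C1 * ((2 * M) ^+ 3 * (n.+1%:R * (2 * M) ^+ 2 + 1))) r0); split.
  + by apply: measurable_funM => //; apply: measurable_funM => //; exact: measurable_funX.
  + have M20 : 0 <= 2 * M by rewrite mulr_ge0.
    move=> x; rewrite ger0_norm; last first.
      by rewrite mulr_ge0 ?(ltW C10)// mulr_ge0 ?sqrtr_ge0// exprn_ge0// pospart_ge0.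
    apply: ler_wpM2l; first exact: ltW.
    apply: ler_pM; rewrite ?sqrtr_ge0 ?exprn_ge0 ?pospart_ge0//.
      rewrite lerXn2r ?nnegrE ?pospart_ge0//; have k0 := kappa0.
      rewrite /P; have [[_ ->]//|[_ ->]] := pospartP (Wcut x - k).
      have [_ /(_ x) hx _] := hW; have := le_trans (ler_norm _) hx; move: (Wcut x) => t ht; lra.
    set Q := n.+1%:R * _ + 1.
    have Q1 : 1 <= Q by rewrite /Q lerDr mulr_ge0// exprn_ge0.
    have SQ : sqgrad Dcut x <= Q by apply: le_trans (sqgrad_le hD wM x) _; rewrite /Q lerDl.
    have Q0 : 0 <= Q by exact: le_trans Q1.
    rewrite -[leRHS]ger0_norm// -sqrtr_sqr ler_wsqrtr// (le_trans SQ)//.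
    by rewrite expr2 ler_peMl.
  + by move=> x hx; rewrite P0 ?expr0n ?mul0r ?mulr0// => /GK/K1r0/=; rewrite leNgt hx.
move=> x _; rewrite lee_fin -/(P x).
have [->|/H[_ h]] := Ppos x; first by rewrite expr0n/= !(mul0r, mulr0).
have -> : C1 * (P x ^+ 3 * Num.sqrt (sqgrad Dcut x)) =
  (C1 * Num.sqrt (sqgrad Dcut x)) * P x ^+ 3 by ring.
by apply: ler_wpM2r => //; rewrite exprn_ge0// pospart_ge0.
Qed.

End Test.
End Fixed_level.

(** * Assembly of the comparison principle *)

Section Conclusion.
Variables (O : set V) (p sigma gamma : R) (a : V -> V -> V) (f g : V -> R -> R).
Variables (u v : V -> R) (Du Dv : V -> V).
Hypotheses (oO : open O) (bO : bounded_set O) (p2 : p < 2) (s0 : 0 < sigma) (g0 : 0 < gamma).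
Hypothesis ma : forall xi i, lmeas phi O (fun x => a x xi ord0 i).
Hypothesis ca : forall x, O x -> continuous (a x).
Hypothesis mono : forall x, O x -> forall xi eta : V,
  gamma * (1 + enorm xi + enorm eta) `^ (p - 2) * enorm (xi - eta) ^+ 2
     <= dotv (a x xi - a x eta) (xi - eta).
Hypothesis cf : {within [set z : V * R | O z.1], continuous (fun z => f z.1 z.2)}.
Hypothesis cg : {within [set z : V * R | O z.1], continuous (fun z => g z.1 z.2)}.
Hypothesis fm : forall x, O x -> {homo f x : s t / s <= t}.
Hypothesis gm : forall x, O x -> {homo g x : s t / s <= t}.
Hypotheses (lu : linfloc mu phi O u) (lDu : forall i, linfloc mu phi O (fun x => Du x ord0 i)).
Hypotheses (lv : linfloc mu phi O v) (lDv : forall i, linfloc mu phi O (fun x => Dv x ord0 i)).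
Hypotheses (wu : weakgrad mu phi O u Du) (wv : weakgrad mu phi O v Dv).
Hypothesis cases : (sigma < 1 /\ forall x, O x -> {homo f x : s t / s < t}) \/ 1 <= sigma.
Hypotheses (Q1 : l1loc mu phi O (fun x => enorm (a x (Du x))))
  (Q2 : l1loc mu phi O (fun x => enorm (a x (Dv x))))
  (Q3 : l1loc mu phi O (fun x => f x (u x))) (Q4 : l1loc mu phi O (fun x => f x (v x))).
Hypothesis Q5 : forall F, C1c O F -> (forall x, 0 <= F x) ->
  (vint mu phi O (fun x => dotv (a x (Du x) - a x (Dv x))%R (grad F x))
   <= vint mu phi O (fun x => ((f x (v x) + g x (v x) * enorm (Dv x) `^ sigma
                          - f x (u x) - g x (u x) * enorm (Du x) `^ sigma) * F x)%R))%E.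
Hypothesis bd : bdry_le O u v.

Lemma superlevel_negligible kappa : 0 < kappa ->
  mu.-negligible [set x | O (phi x) /\ kappa < u (phi x) - v (phi x)].
Proof.
move=> k0; have [K0 [cK0 K0O K0sup]] := bdry_superlevel_compact bO bd k0.
have [r [K1 [r_gt0 cK1 K1O K01]]] := compact_neighborhood cK0 oO K0O.
have [r0 r00 K1r0] := bounded_subset_box (compact_bounded cK1).
(* All the functions to be bounded form one family, so that a single [M] and a single good set [G]
   serve them all. *)
pose Fam (z : bool * option 'I_n.+1) : V -> R := match z with
  | (true, None) => u | (false, None) => v
  | (true, Some i) => fun x => Du x ord0 i | (false, Some i) => fun x => Dv x ord0 i end.
have lFam z : linfloc mu phi O (Fam z).
  by case: z => [[] [i|]]; [exact: lDu|exact: lu|exact: lDv|exact: lv].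
have [M [G [M0 mG GK aeG FM]]] := linfloc_good_set mphi oO cK1 K1O lFam.
have uM x : G x -> `|u (phi x)| <= M by exact: (FM x (true, None)).
have vM x : G x -> `|v (phi x)| <= M by exact: (FM x (false, None)).
have DuM x i : G x -> `|Du (phi x) ord0 i| <= M by exact: (FM x (true, Some i)).
have DvM x i : G x -> `|Dv (phi x) ord0 i| <= M by exact: (FM x (false, Some i)).
have mDu i := (lDu i).1; have mDv i := (lDv i).1.
pose W := Wcut u v G; pose D := Dcut Du Dv G.
have hW : bounded_support phi (2 * M) r0 W.
  exact: (Wcut_bounded_support oO M0 K1O K1r0 mG GK lu.1 lv.1).
have hD i : bounded_support phi (2 * M) r0 (D i).
  exact: (Dcut_bounded_support oO M0 K1O K1r0 mG GK mDu mDv).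
(* [W] and the [n + 1] components of its gradient form one family, to obtain a common sequence of
   radii. *)
pose fam (l : 'I_n.+2) := if unlift ord0 l is Some i then D i else W.
have hfam l : bounded_support phi (2 * M) r0 (fam l) by rewrite /fam; case: unlift.
have afam l : approx_L1 mu phi (fam l).
  have [h1 h2 _] := hfam l; exact: (approx_L1_bounded mphi box_fin approx_indic h1 h2).
have r2 : 0 < r / 2 by rewrite divr_gt0.
have [e [he cve]] := mollify_ae_cvg mphi box_fin box_pos trans r2 hfam afam.
have cvW : {ae mu, forall x, (fun j => mollify mu phi (e j) W (phi x)) @ \oo --> W x}.
  by apply: filterS cve => x /(_ ord0); rewrite /fam unlift_none.
have cvD : {ae mu, forall x i, (fun j => mollify mu phi (e j) (D i) (phi x)) @ \oo --> D i x}.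
  by apply: filterS cve => x h i; have := h (lift ord0 i); rewrite /fam liftK.
pose A x := a x (Du x) - a x (Dv x).
pose b x := f x (v x) + g x (v x) * enorm (Dv x) `^ sigma
                          - f x (u x) - g x (u x) * enorm (Du x) `^ sigma.
have lau i : lmeas phi O (fun x => a x (Du x) ord0 i) by exact: (@lmeas_comp_grad _ a Du i oO).
have lav i : lmeas phi O (fun x => a x (Dv x) ord0 i) by exact: (@lmeas_comp_grad _ a Dv i oO).
have lA i : lmeas phi O (fun x => A x ord0 i).
  by rewrite /lmeas; under eq_fun do rewrite !mxE; exact: (measurable_funB (lau i) (lav i)).
have lgu : lmeas phi O (fun x => g x (u x) * enorm (Du x) `^ sigma).
  exact: (measurable_funM (lmeas_comp oO cg lu.1) (@lmeas_enorm_powR O Du sigma mDu)).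
have lgv : lmeas phi O (fun x => g x (v x) * enorm (Dv x) `^ sigma).
  exact: (measurable_funM (lmeas_comp oO cg lv.1) (@lmeas_enorm_powR O Dv sigma mDv)).
have lb : lmeas phi O b.
  exact: (measurable_funB (measurable_funB (measurable_funD Q4.1 lgv) Q3.1) lgu).
have mK1 := measurable_preimageK mphi cK1.
have onG H : lmeas phi O H -> measurable_fun G (fun x => H (phi x)) by exact: (measurable_onG mphi oO K1O GK).
have iL1 F : l1loc mu phi O F -> mu.-integrable G (fun x => (F (phi x))%:E).
  by move=> [_ /(_ K1 cK1 K1O)]; exact: integrableS.
have iau i (Dz : V -> V) : lmeas phi O (fun x => a x (Dz x) ord0 i) ->
    l1loc mu phi O (fun x => enorm (a x (Dz x))) ->
    mu.-integrable G (fun x => (a (phi x) (Dz (phi x)) ord0 i)%:E).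
  move=> la /iL1; apply: le_integrable => //; first exact/measurable_EFinP/(onG _ la).
  by move=> x _; rewrite /= lee_fin [leRHS]ger0_norm ?enorm_ge0//; exact: coord_le_enorm.
have iA i : mu.-integrable G (fun x => (A (phi x) ord0 i)%:E).
  under eq_fun do rewrite !mxE.
  by apply: integrable_funB => //; [exact: (iau i Du)|exact: (iau i Dv)].
have Gfin : (mu G < +oo)%E.
  apply: le_lt_trans (box_fin r0); apply: le_measure; rewrite ?inE//.
    exact: measurable_phibox.
  by move=> x /GK/K1r0.
have cB : compact (K1 `*` [set t : R | `|t| <= M]).
  apply: compact_setX => //; rewrite (_ : [set _ | _] = `[- M, M]%classic).
    exact: segment_compact.
  by apply/seteqP; split => t /=; rewrite in_itv/= -ler_norml.
(* The integrability convention does not mention the terms with [g]; they are integrable because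
   they are bounded on [G], which has finite measure. *)
have [Cg Cg0 hCg] := within_compact_bound cg cB (fun z Az => K1O _ Az.1).
have ig (z : V -> R) (Dz : V -> V) : lmeas phi O (fun x => g x (z x) * enorm (Dz x) `^ sigma) ->
    (forall x, G x -> `|z (phi x)| <= M) -> (forall x i, G x -> `|Dz (phi x) ord0 i| <= M) ->
    mu.-integrable G (fun x => (g (phi x) (z (phi x)) * enorm (Dz (phi x)) `^ sigma)%:E).
  move=> lz zM DzM; apply: measurable_bounded_integrable => //; first exact: (onG _ lz).
  exists (Cg * (n.+1%:R * M) `^ sigma); split; first exact: num_real.
  move=> y hy x Gx; apply: le_trans (ltW hy); rewrite normrM; apply: ler_pM => //.
    by apply: (hCg (phi x, z (phi x))); split => /=; [exact: GK|exact: zM].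
  rewrite ger0_norm ?powR_ge0//; apply: ge0_ler_powR; rewrite ?nnegrE ?(ltW s0)// ?enorm_ge0//.
    by rewrite mulr_ge0.
  by apply: enorm_le => i; exact: DzM.
have ib : mu.-integrable G (fun x => (b (phi x))%:E).
  apply: integrable_funB => //; last exact: (ig u Du).
  apply: integrable_funB => //; last exact: (iL1 _ Q3).
  by apply: integrable_funD => //; [exact: (iL1 _ Q4)|exact: (ig v Dv)].
pose c0 := gamma * (1 + 2 * (n.+1%:R * M)) `^ (p - 2).
have c00 : 0 < c0 by rewrite mulr_gt0// powR_gt0// ltr_pwDl// !mulr_ge0.
have [C1 C10 hC1] := source_bound oO cK0 K0O k0 M0 s0 cf cg fm gm cases.
have Wgt x : kappa < W x -> [/\ G x, K0 (phi x) & kappa < u (phi x) - v (phi x)].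
  move=> h; have [Gx E] := Wcut_gt k0 h; split => //; last by rewrite -E.
  by apply: K0sup; [exact/K1O/GK|rewrite -E].
have sq x : G x -> sqgrad D x = dotv (Du (phi x) - Dv (phi x)) (Du (phi x) - Dv (phi x)).
  by move=> Gx; apply: eq_bigr => i _; rewrite /D /Dcut !cutE// !mxE -expr2.
have key : mu [set x | kappa < W x] = 0%E.
  apply: (@superlevel_Wcut_null O K0 K1 u v Du Dv kappa r r0 M G oO k0 r_gt0 r00 M0 cK1 K1O K1r0 K01
    K0sup mG GK aeG lu.1 lv.1 mDu mDv wu wv uM vM DuM DvM e he cvW cvD A b lA lb iA ib Q5 c0 C1) => //.
  move=> x /Wgt[Gx K0x hx]; split.
    rewrite -/D (sq x Gx).
    have -> : \sum_i A (phi x) ord0 i * Dcut Du Dv G i x =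
        dotv (a (phi x) (Du (phi x)) - a (phi x) (Dv (phi x))) (Du (phi x) - Dv (phi x)).
      by apply: eq_bigr => i _; rewrite /Dcut !cutE// !mxE.
    apply: (strong_monotonicity_bounded p2 g0 M0 (mono (K0O _ K0x))) => i; [exact: DuM|exact: DvM].
  rewrite -/D (sq x Gx); apply: hC1 => //; [exact: uM|exact: vM| |].
    by move=> i; exact: DuM.
  by move=> i; exact: DvM.
have nk : mu.-negligible [set x | kappa < W x].
  exists [set x | kappa < W x]; split => //.
  rewrite (_ : [set _ | _] = setT `&` W @^-1` `]kappa, +oo[%classic).
    by have [mW _ _] := hW; exact: mW.
  by rewrite setTI; apply/seteqP; split => x /=; rewrite in_itv/= andbT.
(* A point of the superlevel set lies in [K0], hence in [K1]. It belongs either to [G], where [W] is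
   [u - v], or to the null set of points over [K1] outside [G]. *)
apply: negligibleS (negligibleU nk aeG) => x [/= Ox hx].
have [Gx|nGx] := pselect (G x); [left|right] => /=; first by rewrite /W /Wcut !cutE.
move=> h; apply: nGx; apply: h; apply: (K01 (phi x)); first exact: K0sup.
by rewrite subrr normr0 ltW.
Qed.

Lemma comparison_ae : mu.-negligible [set x | O (phi x) /\ ~ (u (phi x) <= v (phi x))].
Proof.
pose F (j : nat) := [set x | O (phi x) /\ j.+1%:R^-1 < u (phi x) - v (phi x)].
apply: (@negligibleS _ _ _ mu (\bigcup_j F j)); last first.
  by apply: negligible_bigcup => j; apply: superlevel_negligible.
move=> x [/= Ox /negP]; rewrite -ltNge -subr_gt0 => d0.
have [j _ /(_ j (leqnn _)) hj] := near_infty_natSinv_lt (PosNum d0).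
by exists j.
Qed.

End Conclusion.
End Comparison.

(** * The comparison principle for Lebesgue measure *)

Definition sf_lebRn (R : realType) (n : nat) :
    {sigma_finite_measure set (caratheodory_type ((@lebn R n)^*)%mu) -> \bar R} :=
  sfmeasure (@lebRn_sigma_finite R n).

Lemma box_posCT (R : realType) (n : nat) (r : R) : 0 < r ->
  (0 < sf_lebRn R n (box (@ofRn R n) r))%E.
Proof.
move=> r0; have E := @lebn_boxE R n r (ltW r0).
rewrite [X in (_ < X)%E](_ : _ = ((r *+ 2) ^+ n.+1)%:E); last exact: E.
by rewrite lte_fin exprn_gt0// mulrn_wgt0.
Qed.

Unset Implicit Arguments.

Theorem theorem1p4 (R : realType) (n : nat) (Omega : set 'rV[R]_n.+1)
  (p sigma gamma : R) (a : 'rV[R]_n.+1 -> 'rV[R]_n.+1 -> 'rV[R]_n.+1)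
  (f g : 'rV[R]_n.+1 -> R -> R) (u v : 'rV[R]_n.+1 -> R)
  (Du Dv : 'rV[R]_n.+1 -> 'rV[R]_n.+1) :
  is_domain Omega -> bounded_set Omega ->
  1 < p -> p < 2 -> 0 < sigma -> 0 < gamma ->
  (* a is Caratheodory: measurable in x, continuous in xi *)
  (forall (xi : 'rV[R]_n.+1) (i : 'I_n.+1),
     Lmeasurable Omega (fun x => a x xi ord0 i)) ->
  (forall x, Omega x -> continuous (a x)) ->
  (* strong monotonicity *)
  (forall x, Omega x -> forall xi eta : 'rV[R]_n.+1,
     gamma * (1 + enorm xi + enorm eta) `^ (p - 2) * enorm (xi - eta) ^+ 2
     <= dotv (a x xi - a x eta) (xi - eta)) ->
  (* f, g continuous on Omega x R, non-decreasing in t *)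
  {within [set z : 'rV[R]_n.+1 * R | Omega z.1], continuous (fun z => f z.1 z.2)} ->
  {within [set z : 'rV[R]_n.+1 * R | Omega z.1], continuous (fun z => g z.1 z.2)} ->
  (forall x, Omega x -> {homo f x : s t / s <= t}) ->
  (forall x, Omega x -> {homo g x : s t / s <= t}) ->
  (* u, v in W^{1,oo}_loc(Omega) with weak gradients Du, Dv *)
  W1inf_loc Omega u Du -> W1inf_loc Omega v Dv ->
  (* (A~1) or (A~2) *)
  ((sigma < 1 /\ forall x, Omega x -> {homo f x : s t / s < t}) \/ 1 <= sigma) ->
  Qstar_le Omega a f g sigma u Du v Dv ->
  bdry_le Omega u v ->
  ae_on Omega (fun x => u x <= v x).
Proof.
move=> [oO _ _] bO _ p2 s0 g0 ma ca mono cf cg fm gm [lu lDu wu] [lv lDv wv] cases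
  [Q1 Q2 Q3 Q4 Q5] bd.
exact: (@comparison_ae R _ _ n (sf_lebRn R n) (@ofRn R n) (@measurable_phiCT R n)
  (@box_finCT R n) (@box_posCT R n) (@integral_translationCT R n) (@approx_indicCT R n)
  Omega p sigma gamma a f g u v Du Dv oO bO p2 s0 g0 ma ca mono cf cg fm gm lu lDu lv lDv wu wv
  cases Q1 Q2 Q3 Q4 Q5 bd).
Qed.
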